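(* Let $\alpha\in\mathbb{R}\setminus\pi\mathbb{Z}$, let $\phi,\psi$ be two wavelets satisfying $$\int_{\mathbb{R}_{0}^n}\left|\left(\mathfrak{F}_\alpha\left\{e^{-\frac{i}{2}\|\cdot\|^2\cot\alpha}\phi(\cdot)\right\}\right)(u)\right|\left|\left(\mathfrak{F}_\alpha\left\{e^{-\frac{i}{2}\|\cdot\|^2\cot\alpha}\psi(\cdot)\right\}\right)(u)\right|\frac{1}{|u|_{p}}\,du<\infty ,$$ and let $f\in L^2(\mathbb{R}^n)$. Suppose also that $$C_{\phi,\psi,\alpha}=\int_{\mathbb{R}_{0}^n}\overline{\left(\mathfrak{F}_\alpha\left\{e^{-\frac{i}{2}\|\cdot\|^2\cot\alpha}\phi(\cdot)\right\}\right)(u)}\left(\mathfrak{F}_\alpha\left\{e^{-\frac{i}{2}\|\cdot\|^2\cot\alpha}\psi(\cdot)\right\}\right)(u)\frac{1}{|u|_{p}}\,du$$ is non-zero. Then the reconstruction formula for $f$ is given by $$f(t)=\frac{|C_{\alpha}|^2}{C_{\phi,\psi,\alpha}}\int_{\mathbb{R}_{0}^n}\int_{\mathbb{R}^n}\phi_{a,b,\alpha}(t)\,(W_{\psi,\alpha}f)(b,a)\,\frac{db\,da}{|a|_{p}^2}.$$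
   Context: For $x,y\in\mathbb{R}^n$: $\|x\|$ is the Euclidean norm, $\langle x,y\rangle$ the Euclidean inner product, $|x|_p=|x_1x_2\cdots x_n|$, and $\mathbb{R}_0^n=\{x\in\mathbb{R}^n:|x|_p\ne 0\}$. For $y\in\mathbb{R}^n_0$, $\frac{x}{y}=(x_1/y_1,\dots,x_n/y_n)$. The inner product on $L^2(\mathbb{R}^n)$ is $\langle f,g\rangle_{L^2(\mathbb{R}^n)}=\int_{\mathbb{R}^n} f(t)\overline{g(t)}\,dt$. For $\alpha\in\mathbb{R}\setminus\pi\mathbb{Z}$ let $C_\alpha=\left(\frac{1-i\cot\alpha}{2\pi}\right)^{n/2}$ and $K_\alpha(t,\xi)=C_\alpha e^{\frac{i}{2}(\|t\|^2+\|\xi\|^2)\cot\alpha-i\langle t,\xi\rangle\csc\alpha}$. The fractional Fourier transform (FrFT) of $f\in L^1(\mathbb{R}^n)$ is $(\mathfrak{F}_\alpha f)(\xi)=\int_{\mathbb{R}^n}f(t)K_\alpha(t,\xi)\,dt$. For $f\in L^2(\mathbb{R}^n)$, $\mathfrak{F}_\alpha f\in L^2(\mathbb{R}^n)$ is the $L^2$-limit of $\mathfrak{F}_\alpha f_k$ for any sequence $f_k\in L^1(\mathbb{R}^n)\cap L^2(\mathbb{R}^n)$ converging to $f$ in $L^2(\mathbb{R}^n)$. For $\psi\in L^2(\mathbb{R}^n)$, $a\in\mathbb{R}^n_0$, $b\in\mathbb{R}^n$: $\psi_{a,b,\alpha}(t)=\frac{1}{\sqrt{|a|_p}}\psi\left(\frac{t-b}{a}\right)e^{-\frac{i}{2}(\|t\|^2-\|b\|^2)\cot\alpha}$;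 $\phi_{a,b,\alpha}$ is defined in the same way from $\phi$. A non-zero $\psi\in L^2(\mathbb{R}^n)$ is a wavelet (wavelet admissible) if $\int_{\mathbb{R}_0^n}\int_{\mathbb{R}^n}|\langle\psi_{a,b,\alpha},\psi\rangle_{L^2(\mathbb{R}^n)}|^2\frac{db\,da}{|a|_p^2}<\infty$. The continuous fractional wavelet transform (CFrWT) of $f$ with respect to $\psi$ is $(W_{\psi,\alpha}f)(b,a)=\int_{\mathbb{R}^n}f(t)\overline{\psi_{a,b,\alpha}(t)}\,dt$, $(b,a)\in\mathbb{R}^n\times\mathbb{R}_0^n$.
   Formalization: The formula is proved with the complex conjugate of C_{φ,ψ,α} in the denominator (as printed it fails for φ = iψ); the double integral is understood weakly in L²(R^n), and the equality holds for almost every t. *)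

(* Defs.v *)
From HB Require Import structures.
From mathcomp Require Import all_boot all_order all_algebra.
From mathcomp Require Import all_classical all_reals all_analysis.
From mathcomp Require Import complex.

Set Implicit Arguments.
Unset Strict Implicit.
Unset Printing Implicit Defensive.

Import Order.TTheory GRing.Theory Num.Theory.
Import numFieldNormedType.Exports.
Import Normc.

Local Open Scope classical_set_scope.
Local Open Scope ring_scope.

(* R^n with the product of the Borel sigma-algebras of its n factors. *)
Notation Rn R n := (n.-tuple (measurableTypeR R)).

Section lebesgue_cons.
Context (R : realType) (n : nat).
Variable m : {sigma_finite_measure set (Rn R n) -> \bar R}.

Definition cons_pair (p : measurableTypeR R * Rn R n) : Rn R n.+1 :=
  [tuple of p.1 :: p.2].

Definition uncons_pair (x : Rn R n.+1) : measurableTypeR R * Rn R n :=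
  (thead x, [tuple of behead x]).

Lemma cons_pairK : cancel cons_pair uncons_pair.
Proof. by case=> x t; congr pair => //; apply: val_inj. Qed.

Lemma uncons_pairK : cancel uncons_pair cons_pair.
Proof. by move=> x; rewrite [RHS]tuple_eta. Qed.

Lemma measurable_cons_pair : measurable_fun setT cons_pair.
Proof. exact: measurable_cons. Qed.

Lemma measurable_uncons_pair : measurable_fun setT uncons_pair.
Proof.
apply/measurable_fun_pair; first exact: measurable_tnth.
exact: measurable_behead.
Qed.

Definition lebesgue_cons : set (Rn R n.+1) -> \bar R :=
  pushforward (@lebesgue_measure R \x m)%E cons_pair.

Let lebesgue_cons_pushforward :
    {measure set (Rn R n.+1) -> \bar R} :=
  measure_function_pushforward__canonical__measure_function_Measure
    (@lebesgue_measure R \x m)%E measurable_cons_pair.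

Let lebesgue_cons0 : lebesgue_cons set0 = 0%E.
Proof. exact: (measure0 lebesgue_cons_pushforward). Qed.

Let lebesgue_cons_ge0 A : (0 <= lebesgue_cons A)%E.
Proof. exact: (measure_ge0 lebesgue_cons_pushforward). Qed.

Let lebesgue_cons_sigma_additive : semi_sigma_additive lebesgue_cons.
Proof.
exact: (@measure_semi_sigma_additive _ _ _ lebesgue_cons_pushforward).
Qed.

HB.instance Definition _ := isMeasure.Build _ _ _ lebesgue_cons
  lebesgue_cons0 lebesgue_cons_ge0 lebesgue_cons_sigma_additive.

Let lebesgue_cons_sigma_finite : sigma_finite setT lebesgue_cons.
Proof.
have /sigma_finiteP[F [TF ndF Foo]] := sigma_finiteT (@lebesgue_measure R).
have /sigma_finiteP[G [TG ndG Goo]] := sigma_finiteT m.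
exists (fun k => uncons_pair @^-1` (F k `*` G k)).
  rewrite -preimage_bigcup; apply/esym/seteqP; split => // x _ /=.
  have [i _ Fi] : (\bigcup_k F k) (thead x) by rewrite -TF.
  have [j _ Gj] : (\bigcup_k G k) [tuple of behead x] by rewrite -TG.
  exists (maxn i j) => //; split => /=.
    by move: Fi; apply/subsetPset/ndF/leq_maxl.
  by move: Gj; apply/subsetPset/ndG/leq_maxr.
move=> k; have [mF Fk] := Foo k; have [mG Gk] := Goo k.
have mFG : measurable (F k `*` G k) by exact: measurableX.
split; first by rewrite -[X in measurable X]setTI; exact: measurable_uncons_pair.
rewrite /lebesgue_cons /pushforward -comp_preimage.
rewrite (_ : uncons_pair \o cons_pair = id) ?preimage_id; last first.
  by apply/funext => p /=; rewrite cons_pairK.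
by rewrite product_measure1E// lte_mul_pinfty// ge0_fin_numE.
Qed.

HB.instance Definition _ := @Measure_isSigmaFinite.Build _ _ _ lebesgue_cons
  lebesgue_cons_sigma_finite.

End lebesgue_cons.

Fixpoint lebesgue_Rn (R : realType) (n : nat) :
    {sigma_finite_measure set (Rn R n) -> \bar R} :=
  if n is n'.+1 then lebesgue_cons (lebesgue_Rn R n') else dirac [tuple].

Section complex_integration.
Context d (T : measurableType d) (R : realType).
Variables (mu : {measure set T -> \bar R}) (D : set T).
Implicit Types f : T -> R[i].

Definition cmeasurable f :=
  measurable_fun D (@complex.Re R \o f) /\ measurable_fun D (@complex.Im R \o f).

Definition cintegrable f :=
  mu.-integrable D (EFin \o (@complex.Re R \o f)) /\
  mu.-integrable D (EFin \o (@complex.Im R \o f)).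

Definition cintegral f : R[i] :=
  ((\int[mu]_(x in D) complex.Re (f x)) +i*
   (\int[mu]_(x in D) complex.Im (f x)))%C.

End complex_integration.

Section vectors.
Context (R : realType) (n : nat).
Implicit Types x y t a b : Rn R n.

Definition dotp x y : R := \sum_(i < n) (tnth x i : R) * (tnth y i : R).

Definition sqnorm x : R := dotp x x.

Definition absp x : R := `| \prod_(i < n) (tnth x i : R) |.

Definition Rn0 : set (Rn R n) := [set x | absp x != 0].

(* (t - b) / a, componentwise *)
Definition dilate a b t : Rn R n :=
  [tuple ((tnth t i : R) - (tnth b i : R)) / (tnth a i : R) | i < n].

End vectors.
Arguments Rn0 : clear implicits.

Section L2.
Context (R : realType) (n : nat).
Implicit Types f g : Rn R n -> R[i].
Let mu := lebesgue_Rn R n.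

(* L^p(R^n) is handled through Borel representatives of its classes. *)
Definition memL1 f := cintegrable mu setT f.

Definition memL2 f :=
  cmeasurable setT f /\ (\int[mu]_t (normc (f t) ^+ 2)%:E < +oo)%E.

Definition L2inner f g : R[i] :=
  cintegral mu setT (fun t => f t * ((g t)^*)%C).

Definition L2cvg (f_ : nat -> Rn R n -> R[i]) f :=
  (fun k => \int[mu]_t (normc (f_ k t - f t) ^+ 2)%:E)%E @ \oo --> 0%E.

End L2.

Definition cot (R : realType) (x : R) : R := cos x / sin x.

Definition csc (R : realType) (x : R) : R := (sin x)^-1.

(* exp(i x) for real x *)
Definition expi (R : realType) (x : R) : R[i] := (cos x +i* sin x)%C.

Section FrFT.
Context (R : realType) (n : nat) (alpha : R).
Implicit Types f F phi psi : Rn R n -> R[i].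
Let mu := lebesgue_Rn R n.

(* [sqrtc] is the principal square root, so its n-th power is the principal
   value of z `^ (n / 2) for z = (1 - i cot alpha) / (2 pi), whose real part
   is positive. *)
Definition Calpha : R[i] :=
  sqrtc ((1 - 'i * (cot alpha)%:C) / (2 * pi)%:C)%C ^+ n.

Definition Kalpha (t xi : Rn R n) : R[i] :=
  Calpha * expi ((sqnorm t + sqnorm xi) * cot alpha / 2
                 - dotp t xi * csc alpha).

(* the transform as an integral, for f in L^1 *)
Definition FrFT1 f : Rn R n -> R[i] :=
  fun xi => cintegral mu setT (fun t => f t * Kalpha t xi).

Definition is_FrFT f F :=
  memL2 F /\
  forall f_ : nat -> Rn R n -> R[i],
    (forall k, memL1 (f_ k) /\ memL2 (f_ k)) -> L2cvg f_ f ->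
    L2cvg (fun k => FrFT1 (f_ k)) F.

(* the transform on L^2: the L^2-limit, which is unique up to a null set *)
Definition FrFT f : Rn R n -> R[i] := xget (fun=> 0) [set F | is_FrFT f F].

Definition chirp f : Rn R n -> R[i] :=
  fun t => expi (- (sqnorm t * cot alpha / 2)) * f t.

(* psi_{a,b,alpha} *)
Definition atom psi (a b : Rn R n) : Rn R n -> R[i] :=
  fun t => (((Num.sqrt (absp a))^-1)%:C)%C * psi (dilate a b t)
           * expi (- ((sqnorm t - sqnorm b) * cot alpha / 2)).

Definition wavelet psi :=
  [/\ memL2 psi,
      ~ {ae mu, forall t, psi t = 0}
    & (\int[mu]_(a in Rn0 R n) \int[mu]_b
         (normc (L2inner (atom psi a b) psi) ^+ 2 / absp a ^+ 2)%:E < +oo)%E].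

Definition CFrWT psi f (b a : Rn R n) : R[i] :=
  cintegral mu setT (fun t => f t * ((atom psi a b t)^*)%C).

(* finiteness of the integral of |F phi| |F psi| / |u|_p, with F applied to
   the chirped functions *)
Definition cross_admissible phi psi :=
  (\int[mu]_(u in Rn0 R n)
     (normc (FrFT (chirp phi) u) * normc (FrFT (chirp psi) u)
      * (absp u)^-1)%:E < +oo)%E.

(* C_{phi,psi,alpha}, linear in psi and conjugate-linear in phi.  Analysing with
   psi and synthesising with phi is linear in phi and conjugate-linear in psi,
   so a reconstruction formula has to divide by the conjugate of this constant
   (compare the pairs (psi, psi) and ('i psi, psi)). *)
Definition cross_const phi psi : R[i] :=
  cintegral mu (Rn0 R n) (fun u =>
    ((FrFT (chirp phi) u)^*)%C * FrFT (chirp psi) u * (((absp u)^-1)%:C)%C).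

End FrFT.
Arguments Calpha {R} n alpha.

(* [I] is the integral of the L^2-valued family [G a b] over a in R^n_0 and
   b in R^n, in the weak sense: for an L^2 synthesis integral the pointwise
   integral over a need not converge absolutely. *)
Definition is_weak_integral (R : realType) (n : nat)
    (G : Rn R n -> Rn R n -> Rn R n -> R[i]) (I : Rn R n -> R[i]) :=
  memL2 I /\
  forall g, memL2 g ->
    cintegrable (lebesgue_Rn R n \x lebesgue_Rn R n)%E (Rn0 R n `*` setT)
      (fun ab => L2inner (G ab.1 ab.2) g) /\
    L2inner I g =
      cintegral (lebesgue_Rn R n) (Rn0 R n) (fun a =>
        cintegral (lebesgue_Rn R n) setT (fun b => L2inner (G a b) g)).

(* Main.v *)
Require Import Defs.
From HB Require Import structures.
From mathcomp Require Import all_boot all_order all_algebra.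
From mathcomp Require Import all_classical all_reals all_analysis.
From mathcomp Require Import measurable_realfun complex ring lra.

Import Order.TTheory GRing.Theory Num.Theory.
Import numFieldNormedType.Exports.
Import Normc.

Local Open Scope classical_set_scope.
Local Open Scope ring_scope.

(** Once the chirps are removed, the formula is Parseval's identity used twice.

Put [s = - csc alpha], let [FT s] be the Fourier integral with kernel
[expi (s * dotp t u)], and let [Phi], [Psi], [H], [K] be the transforms of
[phi], [psi] and of [h = unchirp f], [k = unchirp g], the functions [f] and [g]
multiplied by the conjugate chirp. Completing the square shows that
[CFrWT psi f b a] is the ordinary wavelet transform [cwt psi h a b] times a
unimodular factor depending on [b] only, and that [FrFT] of the chirped [phi] is
[Phi] times a factor of constant modulus [normc (Calpha n alpha)]. Hence
[cross_const phi psi] is [normc (Calpha n alpha) ^+ 2] times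
[cross Phi Psi], the integral of [Psi u * (Phi u)^* / absp u].

For a fixed scale [a], the function [cwt psi h a] is, up to a constant, the
transform of [freq Psi H a u = H u * (Psi (a u))^*] ([cwt_freq]). Parseval in
the variable [b] turns the integral of [cwt psi h a b * (cwt phi k a b)^*] into
an integral over [u] of [H u * (K u)^* * (Psi (a u))^* * Phi (a u)]. Integrating
over [a] first and substituting [v = a u] leaves, for every [u] without zero
coordinate, the same constant [(cross Phi Psi)^*]; a second use of Parseval, in
[u], ends with [(cross Phi Psi)^*] times the inner product of [f] and [g]
([cintegral_reconstruction]). The synthesis integral is therefore
[(cross Phi Psi)^* * f] in the weak sense.

Exchanging the integrals needs absolute convergence. The same computation with
[phi = psi], in which all integrands are nonnegative, is the identity [energy]:
the energy of [cwt psi h] is [sqL2 h * adm Psi], possibly infinite. Applied to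
[h = unchirp psi] it shows that a wavelet has finite [adm Psi]
([wavelet_adm]); applied to [f] and [g], together with the inequality between
arithmetic and geometric means, it dominates the mixed integrals.

The transform on square-integrable functions is characterised by duality
([is_hat]) and rests on two facts about Fourier integrals. Inserting the product
[weight e] of two-sided exponentials replaces the composition of [FT s] and
[FT (- s)] by convolution with a Poisson kernel of total mass [planch n s]. Schur's test for
this kernel bounds the transform ([bessel]), and truncations then converge by
completeness ([riesz_fischer], [hat_exists]). Letting [e] tend to 0 against the
indicator of a box gives inversion ([inversion_box]); integrals over boxes
determine a function ([ae_eq0_boxes]), which yields [hat_inv] and [parseval]. *)

Set Implicit Arguments.
Unset Strict Implicit.
Unset Printing Implicit Defensive.

(** * Complex numbers, limits and integrals of complex functions *)

Section complex_modulus.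
Context {R : realType}.
Implicit Types z w : R[i].

Lemma ReM z w : complex.Re (z * w)
  = complex.Re z * complex.Re w - complex.Im z * complex.Im w.
Proof. by case: z => a b; case: w => c d. Qed.

Lemma ImM z w : complex.Im (z * w)
  = complex.Re z * complex.Im w + complex.Im z * complex.Re w.
Proof. by case: z => a b; case: w => c d. Qed.

Lemma ReD z w : complex.Re (z + w) = complex.Re z + complex.Re w.
Proof. by case: z => a b; case: w => c d. Qed.

Lemma ImD z w : complex.Im (z + w) = complex.Im z + complex.Im w.
Proof. by case: z => a b; case: w => c d. Qed.

Lemma ReN z : complex.Re (- z) = - complex.Re z. Proof. by case: z. Qed.

Lemma ImN z : complex.Im (- z) = - complex.Im z. Proof. by case: z. Qed.

Lemma ReJ z : complex.Re (z^*)%C = complex.Re z. Proof. by case: z. Qed.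

Lemma ImJ z : complex.Im (z^*)%C = - complex.Im z. Proof. by case: z. Qed.

Lemma conjM z w : ((z * w)^*)%C = (z^*)%C * (w^*)%C.
Proof. exact: rmorphM. Qed.

Lemma eqC z w : complex.Re z = complex.Re w -> complex.Im z = complex.Im w ->
  z = w.
Proof. by case: z => a b; case: w => c d /= -> ->. Qed.

Lemma normc_ge0 z : 0 <= normc z.
Proof. by case: z => a b /=; exact: sqrtr_ge0. Qed.

Lemma sqr_normcE z : normc z ^+ 2 = complex.Re z ^+ 2 + complex.Im z ^+ 2.
Proof. by case: z => a b /=; rewrite sqr_sqrtr// addr_ge0// sqr_ge0. Qed.

Lemma mulJc z : z * (z^*)%C = ((normc z ^+ 2)%:C)%C.
Proof.
apply: eqC; rewrite ?ReM ?ImM ReJ ImJ ?sqr_normcE /= ?expr2; first by rewrite mulrN opprK.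
by rewrite mulrN mulrC addrC subrr.
Qed.

Lemma normc_real (x : R) : normc (x%:C)%C = `|x|.
Proof. by rewrite /= expr0n /= addr0 sqrtr_sqr. Qed.

Lemma normcJ z : normc (z^*)%C = normc z.
Proof. by case: z => a b /=; rewrite sqrrN. Qed.

Lemma normc_expi (x : R) : normc (expi x) = 1.
Proof. by rewrite /expi /= cos2Dsin2 sqrtr1. Qed.

Lemma expiD (x y : R) : expi (x + y) = expi x * expi y.
Proof.
apply: eqC; rewrite ?ReM ?ImM /expi /=; first exact: cosD.
by rewrite sinD addrC.
Qed.

Lemma expi0 : expi 0 = 1 :> R[i].
Proof. by rewrite /expi cos0 sin0. Qed.

Lemma expiJ (x : R) : ((expi x)^*)%C = expi (- x).
Proof. by rewrite /expi /= cosN sinN. Qed.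

Lemma expiNM (x : R) : expi (- x) * expi x = 1.
Proof. by rewrite -expiD addNr expi0. Qed.

Lemma abs_Re z : `|complex.Re z| <= normc z.
Proof.
case: z => a b /=; rewrite -sqrtr_sqr ler_wsqrtr// lerDl; exact: sqr_ge0.
Qed.

Lemma abs_Im z : `|complex.Im z| <= normc z.
Proof.
case: z => a b /=; rewrite -sqrtr_sqr ler_wsqrtr// lerDr; exact: sqr_ge0.
Qed.

Lemma normc_le z : normc z <= `|complex.Re z| + `|complex.Im z|.
Proof.
rewrite -(@ler_pXn2r _ 2) ?nnegrE ?normc_ge0 ?addr_ge0//.
rewrite sqr_normcE sqrrD !real_normK ?num_real// -addrA [_ *+ 2 + _]addrC addrA.
by rewrite lerDl mulrn_wge0// mulr_ge0.
Qed.

Lemma normc_distC z w : normc (z - w) = normc (w - z).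
Proof. by rewrite -opprB normcN. Qed.

End complex_modulus.

(** Convergence in modulus, so that limit arguments reduce to real sequences. *)
Definition ccvg (R : realType) (u : nat -> R[i]) (l : R[i]) :=
  (fun k => normc (u k - l)) @ \oo --> (0 : R).

Section complex_limits.
Context {R : realType}.
Implicit Types (u v : nat -> R[i]) (l : R[i]).

Lemma ccvg_cst l : ccvg (fun=> l) l.
Proof.
rewrite /ccvg (_ : (fun=> _) = cst (0 : R)); first exact: cvg_cst.
by apply/funext => k /=; rewrite subrr normc0.
Qed.

Lemma ccvg_le u l (b : nat -> R) :
  (forall k, normc (u k - l) <= b k) -> b @ \oo --> (0 : R) -> ccvg u l.
Proof.
move=> ub b0; apply: (squeeze_cvgr _ (cvg_cst 0) b0).
by near=> k; rewrite normc_ge0 ub.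
Unshelve. all: by end_near. Qed.

Lemma ccvg_unique u l l' : ccvg u l -> ccvg u l' -> l = l'.
Proof.
move=> ul ul'; apply/eqP; rewrite -subr_eq0; apply/eqP/eq0_normc.
apply/eqP; rewrite eq_le normc_ge0 andbT.
have : (fun k => normc (u k - l) + normc (u k - l')) @ \oo --> (0 : R).
  by rewrite -[X in _ --> X]addr0; exact: cvgD.
move=> cv; apply: (cvgr_to_ge cv); near=> k; rewrite /= [normc (u k - l)]normc_distC.
by rewrite (le_trans _ (le_normcD _ _))// addrA subrK.
Unshelve. all: by end_near. Qed.

Lemma dist_cvg0 (x : nat -> R) (y : R) :
  (fun k => `|x k - y|) @ \oo --> (0 : R) <-> x @ \oo --> y.
Proof.
split=> h.
  by apply/subr_cvg0; apply/norm_cvg0P.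
by apply/norm_cvg0P/subr_cvg0.
Qed.

Lemma ccvgE u l : ccvg u l <->
  (fun k => complex.Re (u k)) @ \oo --> complex.Re l /\
  (fun k => complex.Im (u k)) @ \oo --> complex.Im l.
Proof.
split=> [ul|[/dist_cvg0 re /dist_cvg0 im]].
  split; apply/dist_cvg0; apply: (squeeze_cvgr _ (cvg_cst 0) ul); near=> k;
    rewrite normr_ge0 /= -?ReN -?ReD -?ImN -?ImD ?abs_Re ?abs_Im//.
apply: (@ccvg_le _ _ (fun k => `|complex.Re (u k) - complex.Re l| +
    `|complex.Im (u k) - complex.Im l|)) => [k|].
  by rewrite -!ReN -!ReD -!ImN -!ImD normc_le.
by rewrite -[X in _ --> X]addr0; exact: cvgD.
Unshelve. all: by end_near. Qed.

End complex_limits.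

Section cmeasurable_theory.
Context d (T : measurableType d) (R : realType).
Variable D : set T.
Hypothesis mD : measurable D.
Implicit Types f g : T -> R[i].

Lemma cmeasurable_cst (c : R[i]) : cmeasurable D (fun=> c).
Proof. by split; exact: measurable_cst. Qed.

Lemma cmeasurableD f g : cmeasurable D f -> cmeasurable D g ->
  cmeasurable D (fun x => f x + g x).
Proof.
move=> [f1 f2] [g1 g2]; split.
  rewrite (_ : _ \o _ = (complex.Re (R:=R) \o f) \+ (complex.Re (R:=R) \o g)).
    exact: measurable_funD.
  by apply/funext => x /=; rewrite ReD.
rewrite (_ : _ \o _ = (complex.Im (R:=R) \o f) \+ (complex.Im (R:=R) \o g)).
  exact: measurable_funD.
by apply/funext => x /=; rewrite ImD.
Qed.

Lemma cmeasurableM f g : cmeasurable D f -> cmeasurable D g ->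
  cmeasurable D (fun x => f x * g x).
Proof.
move=> [f1 f2] [g1 g2]; split.
  rewrite (_ : _ \o _ = (fun x => complex.Re (f x) * complex.Re (g x)
      - complex.Im (f x) * complex.Im (g x))).
    by apply: measurable_funB; apply: measurable_funM.
  by apply/funext => x /=; rewrite ReM.
rewrite (_ : _ \o _ = (fun x => complex.Re (f x) * complex.Im (g x)
    + complex.Im (f x) * complex.Re (g x))).
  by apply: measurable_funD; apply: measurable_funM.
by apply/funext => x /=; rewrite ImM.
Qed.

Lemma cmeasurableZ (c : R[i]) f : cmeasurable D f ->
  cmeasurable D (fun x => c * f x).
Proof. by apply: cmeasurableM; exact: cmeasurable_cst. Qed.

Lemma cmeasurableJ f : cmeasurable D f -> cmeasurable D (fun x => (f x)^*%C).
Proof.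
move=> [f1 f2]; split.
  by rewrite (_ : _ \o _ = complex.Re (R:=R) \o f)//; apply/funext => x /=; rewrite ReJ.
rewrite (_ : _ \o _ = \- (complex.Im (R:=R) \o f)); last first.
  by apply/funext => x /=; rewrite ImJ.
exact: measurable_funN.
Qed.

Lemma cmeasurableB f g : cmeasurable D f -> cmeasurable D g ->
  cmeasurable D (fun x => f x - g x).
Proof.
move=> mf mg; rewrite (_ : (fun _ => _) = fun x => f x + (-1) * g x).
  by apply: cmeasurableD => //; exact: cmeasurableZ.
by apply/funext => x; rewrite mulN1r.
Qed.

Lemma cmeasurable_real (f : T -> R) : measurable_fun D f ->
  cmeasurable D (fun x => ((f x)%:C)%C).
Proof. by move=> mf; split => //; exact: measurable_cst. Qed.

Lemma cmeasurable_expi (f : T -> R) : measurable_fun D f ->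
  cmeasurable D (fun x => expi (f x)).
Proof.
move=> mf; split.
  apply: (@measurableT_comp _ _ _ _ _ _ (@cos R)) => //.
  by apply: continuous_measurable_fun => x; exact: continuous_cos.
apply: (@measurableT_comp _ _ _ _ _ _ (@sin R)) => //.
by apply: continuous_measurable_fun => x; exact: continuous_sin.
Qed.

Lemma measurable_normc f : cmeasurable D f ->
  measurable_fun D (fun x => normc (f x)).
Proof.
move=> [f1 f2].
rewrite (_ : (fun _ => _) = Num.sqrt \o
    (fun x => complex.Re (f x) ^+ 2 + complex.Im (f x) ^+ 2)); last first.
  by apply/funext => x /=; case: (f x).
apply: measurableT_comp.
  by apply: continuous_measurable_fun => x; exact: sqrt_continuous.
by apply: measurable_funD; exact: measurable_funX.
Qed.

Lemma measurable_normcE f : cmeasurable D f ->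
  measurable_fun D (fun x => (normc (f x))%:E).
Proof. by move=> mf; apply/measurable_EFinP/measurable_normc. Qed.

Lemma measurable_normc2 f : cmeasurable D f ->
  measurable_fun D (fun x => (normc (f x) ^+ 2)%:E).
Proof.
by move=> mf; apply/measurable_EFinP; apply: measurable_funX; exact: measurable_normc.
Qed.

End cmeasurable_theory.

Lemma cmeasurable_comp d d' (T : measurableType d) (T' : measurableType d')
    (R : realType) (f : T' -> R[i]) (g : T -> T') :
  cmeasurable setT f -> measurable_fun setT g -> cmeasurable setT (f \o g).
Proof.
by move=> [f1 f2] mg; split; [apply: (measurableT_comp f1)|apply: (measurableT_comp f2)].
Qed.

Section cintegral_theory.
Context d (T : measurableType d) (R : realType).
Variables (mu : {measure set T -> \bar R}) (D : set T).
Hypothesis mD : measurable D.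
Implicit Types f g : T -> R[i].

Lemma rintegrableZ (k : R) (h : T -> R) : mu.-integrable D (EFin \o h) ->
  mu.-integrable D (EFin \o (fun x => k * h x)).
Proof.
move=> hi; have := integrableZl mD k hi; apply: eq_integrable => // x _.
Qed.

Lemma rintegrableD (h h' : T -> R) : mu.-integrable D (EFin \o h) ->
  mu.-integrable D (EFin \o h') -> mu.-integrable D (EFin \o (fun x => h x + h' x)).
Proof.
move=> hi hi'; have := integrableD mD hi hi'; apply: eq_integrable => // x _.
Qed.

Lemma cintegrable_measurable f : cintegrable mu D f -> cmeasurable D f.
Proof.
by move=> [f1 f2]; split; apply/measurable_EFinP; [exact: measurable_int f1|exact: measurable_int f2].
Qed.

(** The modulus lies between the absolute values of the two parts and their sum,
so it controls the componentwise notion of integrability. *)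
Lemma cintegrableP f : cintegrable mu D f <->
  cmeasurable D f /\ (\int[mu]_(x in D) (normc (f x))%:E < +oo)%E.
Proof.
split=> [fi|[mf fi]].
  have mf := cintegrable_measurable fi; split => //; case: fi => f1 f2.
  have : mu.-integrable D (fun x => `|(complex.Re (f x))%:E| + `|(complex.Im (f x))%:E|)%E.
    by apply: integrableD => //; apply: integrable_abse.
  move/integrableP => [_]; apply: le_lt_trans; apply: ge0_le_integral => //.
  - by move=> x _; rewrite lee_fin normc_ge0.
  - exact: measurable_normcE.
  - case: mf => m1 m2; apply: measurableT_comp => //.
    by apply: emeasurable_funD; apply: measurableT_comp => //; exact/measurable_EFinP.
  - move=> x _; rewrite gee0_abs ?adde_ge0//=.
    by rewrite -EFinD lee_fin normc_le.
have ni : mu.-integrable D (fun x => (normc (f x))%:E).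
  apply/integrableP; split; first exact: measurable_normcE.
  rewrite (eq_integral (fun x => (normc (f x))%:E))// => x _.
  by rewrite gee0_abs// lee_fin normc_ge0.
case: mf => m1 m2; split.
  apply: le_integrable ni => //; first exact/measurable_EFinP.
  by move=> x _ /=; rewrite lee_fin (ger0_norm (normc_ge0 _)) abs_Re.
apply: le_integrable ni => //; first exact/measurable_EFinP.
by move=> x _ /=; rewrite lee_fin (ger0_norm (normc_ge0 _)) abs_Im.
Qed.

Lemma integrable_normc f : cintegrable mu D f ->
  mu.-integrable D (fun x => (normc (f x))%:E).
Proof.
move/cintegrableP => [mf fi]; apply/integrableP; split.
  exact: measurable_normcE.
rewrite (eq_integral (fun x => (normc (f x))%:E))// => x _.
by rewrite gee0_abs// lee_fin normc_ge0.
Qed.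

Lemma cintegrable_le f (g : T -> R) : cmeasurable D f ->
  mu.-integrable D (EFin \o g) -> (forall x, D x -> normc (f x) <= g x) ->
  cintegrable mu D f.
Proof.
move=> mf gi fg; apply/cintegrableP; split=> //.
move/integrableP : (gi) => [mg]; apply: le_lt_trans; apply: ge0_le_integral => //.
- by move=> x _; rewrite lee_fin normc_ge0.
- exact: measurable_normcE.
- exact: measurableT_comp.
- by move=> x Dx /=; rewrite lee_fin (le_trans (fg _ Dx))// ler_norm.
Qed.

Lemma cintegrable_lec f g : cmeasurable D f -> cintegrable mu D g ->
  (forall x, D x -> normc (f x) <= normc (g x)) -> cintegrable mu D f.
Proof. by move=> mf /integrable_normc gi; exact: cintegrable_le. Qed.

Lemma eq_cintegral g f : {in D, f =1 g} -> cintegral mu D f = cintegral mu D g.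
Proof.
by move=> fg; rewrite /cintegral; congr (_ +i* _)%C; apply: eq_Rintegral => x Dx;
  rewrite fg.
Qed.

Lemma cintegralD f g : cintegrable mu D f -> cintegrable mu D g ->
  cintegral mu D (fun x => f x + g x) = cintegral mu D f + cintegral mu D g.
Proof.
move=> [f1 f2] [g1 g2]; apply: eqC; rewrite ?ReD ?ImD /cintegral /=.
  by rewrite -RintegralD//; apply: eq_Rintegral => x _; rewrite ReD.
by rewrite -RintegralD//; apply: eq_Rintegral => x _; rewrite ImD.
Qed.

Lemma cintegrableD f g : cintegrable mu D f -> cintegrable mu D g ->
  cintegrable mu D (fun x => f x + g x).
Proof.
move=> fi gi; apply: (@cintegrable_le _ (fun x => normc (f x) + normc (g x))).
- by apply: cmeasurableD; exact: cintegrable_measurable.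
- by apply: rintegrableD; exact: integrable_normc.
- by move=> x _; exact: le_normcD.
Qed.

Lemma cintegrableZ (c : R[i]) f : cintegrable mu D f ->
  cintegrable mu D (fun x => c * f x).
Proof.
move=> fi; apply: (@cintegrable_le _ (fun x => normc c * normc (f x))).
- by apply: cmeasurableZ; exact: cintegrable_measurable.
- by apply: rintegrableZ; exact: integrable_normc.
- by move=> x _; rewrite normcM.
Qed.

Lemma cintegralZ (c : R[i]) f : cintegrable mu D f ->
  cintegral mu D (fun x => c * f x) = c * cintegral mu D f.
Proof.
move=> [f1 f2]; apply: eqC; rewrite ?ReM ?ImM /cintegral /=.
  rewrite -!RintegralZl// -RintegralB//; first by apply: eq_Rintegral => x _; rewrite ReM.
  - exact: rintegrableZ.
  - exact: rintegrableZ.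
rewrite -!RintegralZl// -RintegralD//; first by apply: eq_Rintegral => x _; rewrite ImM.
- exact: rintegrableZ.
- exact: rintegrableZ.
Qed.

Lemma cintegrableJ f : cintegrable mu D f -> cintegrable mu D (fun x => (f x)^*%C).
Proof.
move=> fi; apply: (cintegrable_lec _ fi); last by move=> x _; rewrite normcJ.
by apply: cmeasurableJ; exact: cintegrable_measurable.
Qed.

Lemma cintegralJ f : cintegrable mu D f ->
  cintegral mu D (fun x => (f x)^*%C) = ((cintegral mu D f)^*)%C.
Proof.
move=> [f1 f2]; apply: eqC; rewrite ?ReJ ?ImJ /cintegral /=.
  by apply: eq_Rintegral => x _; rewrite ReJ.
rewrite -mulN1r -RintegralZl//; apply: eq_Rintegral => x _.
by rewrite ImJ mulN1r.
Qed.

Lemma cintegrableB f g : cintegrable mu D f -> cintegrable mu D g ->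
  cintegrable mu D (fun x => f x - g x).
Proof.
move=> fi gi; rewrite (_ : (fun _ => _) = fun x => f x + (-1) * g x).
  by apply: cintegrableD => //; exact: cintegrableZ.
by apply/funext => x; rewrite mulN1r.
Qed.

Lemma cintegralB f g : cintegrable mu D f -> cintegrable mu D g ->
  cintegral mu D (fun x => f x - g x) = cintegral mu D f - cintegral mu D g.
Proof.
move=> fi gi; rewrite (_ : (fun x => f x - g x) = fun x => f x + (-1) * g x).
  rewrite cintegralD//; last exact: cintegrableZ.
  by rewrite cintegralZ// mulN1r.
by apply/funext => x; rewrite mulN1r.
Qed.

Lemma ae_eq_cintegral g f : cmeasurable D f -> cmeasurable D g ->
  {ae mu, forall x, D x -> f x = g x} -> cintegral mu D f = cintegral mu D g.
Proof.
move=> [f1 f2] [g1 g2] fg; rewrite /cintegral; congr (_ +i* _)%C; congr fine.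
  apply: ae_eq_integral => //; try exact/measurable_EFinP.
  by apply: filterS fg => x fgx Dx; rewrite fgx.
apply: ae_eq_integral => //; try exact/measurable_EFinP.
by apply: filterS fg => x fgx Dx; rewrite fgx.
Qed.

(** Multiplying by the conjugate of the integral makes the integral real, which
reduces the claim to the inequality for real parts. *)
Lemma le_normc_cintegral f : cintegrable mu D f ->
  ((normc (cintegral mu D f))%:E <= \int[mu]_(x in D) (normc (f x))%:E)%E.
Proof.
move=> fi; have ni := integrable_normc fi.
set z := cintegral mu D f.
have [z0|z0] := eqVneq (normc z) 0.
  by rewrite z0; apply: integral_ge0 => x _; rewrite lee_fin normc_ge0.
have zp : 0 < normc z by rewrite lt_neqAle eq_sym z0 normc_ge0.
have [zf1 _] := cintegrableZ (z^*)%C fi.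
have E : normc z ^+ 2 = \int[mu]_(x in D) complex.Re ((z^*)%C * f x).
  have := cintegralZ (z^*)%C fi; rewrite -/z mulrC mulJc => /(congr1 (@complex.Re R)) /=.
  by move=> <-.
have : normc z ^+ 2 <= \int[mu]_(x in D) (normc z * normc (f x)).
  rewrite E; apply: le_Rintegral => //.
    exact: rintegrableZ.
  move=> x _; rewrite (le_trans (ler_norm _))// (le_trans (abs_Re _))//.
  by rewrite normcM normcJ.
rewrite RintegralZl// expr2 ler_pM2l// => h.
rewrite -(@fineK _ (\int[mu]_(x in D) _)%E) ?lee_fin//.
exact: integrable_fin_num.
Qed.

End cintegral_theory.

Lemma cintegral0 d (T : measurableType d) (R : realType)
    (mu : {measure set T -> \bar R}) : cintegral mu setT (fun=> 0) = 0.
Proof. by rewrite /cintegral !Rintegral_cst//= !mul0r. Qed.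

Lemma cintegral_mkcond d (T : measurableType d) (R : realType)
    (mu : {measure set T -> \bar R}) (D : set T) (f : T -> R[i]) :
  (forall x, ~ D x -> f x = 0) -> cintegral mu D f = cintegral mu setT f.
Proof.
move=> f0; rewrite /cintegral; congr (_ +i* _)%C; rewrite Rintegral_mkcond;
  apply: eq_Rintegral => x _; rewrite patchE; case: ifPn => //;
  by move=> /negP xD; rewrite f0// => Dx; apply: xD; rewrite inE.
Qed.

Section cdominated.
Context d (T : measurableType d) (R : realType).
Variables (mu : {measure set T -> \bar R}) (D : set T).
Hypothesis mD : measurable D.

Let real_dominated (h_ : nat -> T -> R) (h g : T -> R) :
  (forall k, measurable_fun D (h_ k)) -> measurable_fun D h ->
  {ae mu, forall x, D x -> (fun k => h_ k x) @ \oo --> h x} ->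
  mu.-integrable D (EFin \o g) -> (forall k x, D x -> `|h_ k x| <= g x) ->
  (fun k => \int[mu]_(x in D) h_ k x) @ \oo --> \int[mu]_(x in D) h x.
Proof.
move=> mh_ mh hh gi hg.
have [||||hi _ cv] := @dominated_convergence _ _ _ mu D mD
  (fun k => EFin \o h_ k) (EFin \o h) (EFin \o g) _ _ _ gi.
- by move=> k; exact/measurable_EFinP.
- exact/measurable_EFinP.
- by apply: filterS hh => x hx Dx; apply/fine_cvgP; split;
    [exact: nearW|exact: hx].
- by apply: aeW => x k Dx /=; rewrite lee_fin hg.
have hki k : mu.-integrable D (EFin \o h_ k).
  apply: le_integrable gi => //; first exact/measurable_EFinP.
  by move=> x Dx /=; rewrite lee_fin (le_trans (hg _ _ Dx))// ler_norm.
have fi := integrable_fin_num mD hi.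
move: cv; rewrite -(fineK fi) => /fine_cvgP[_].
exact.
Qed.

Lemma cdominated_convergence (f_ : nat -> T -> R[i]) (f : T -> R[i]) (g : T -> R) :
  (forall k, cmeasurable D (f_ k)) -> cmeasurable D f ->
  {ae mu, forall x, D x -> ccvg (f_ ^~ x) (f x)} ->
  mu.-integrable D (EFin \o g) -> (forall k x, D x -> normc (f_ k x) <= g x) ->
  ccvg (fun k => cintegral mu D (f_ k)) (cintegral mu D f).
Proof.
move=> mf_ [mf1 mf2] ff gi fg; apply/ccvgE; split; rewrite /cintegral /=.
  apply: (real_dominated _ _ _ gi) => //.
  - by move=> k; case: (mf_ k).
  - by apply: filterS ff => x fx Dx; have /ccvgE[] := fx Dx.
  - by move=> k x Dx; rewrite (le_trans (abs_Re _))// fg.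
apply: (real_dominated _ _ _ gi) => //.
- by move=> k; case: (mf_ k).
- by apply: filterS ff => x fx Dx; have /ccvgE[] := fx Dx.
- by move=> k x Dx; rewrite (le_trans (abs_Im _))// fg.
Qed.

End cdominated.

Lemma measurable_Rintegral_section d1 d2 (T1 : measurableType d1)
    (T2 : measurableType d2) (R : realType)
    (m2 : {sigma_finite_measure set T2 -> \bar R}) (h : T1 * T2 -> R) :
  measurable_fun setT h -> measurable_fun setT (fun x => \int[m2]_y h (x, y)).
Proof.
move=> mh; rewrite /Rintegral.
apply: (@measurableT_comp _ _ _ _ _ _ fine) => //.
rewrite (_ : (fun _ => _) = (fun x => \int[m2]_y ((EFin \o h)^\+ (x, y)))%E
   \- (fun x => \int[m2]_y ((EFin \o h)^\- (x, y)))%E)%E; last first.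
  apply/funext => x; rewrite [LHS]integralE.
  by congr (_ - _)%E; apply: eq_integral => y _; rewrite ?funeposE ?funenegE.
apply: emeasurable_funB.
  apply: (measurable_fun_fubini_tonelli_F ((EFin \o h)^\+)%E) => //.
  exact/measurable_funepos/measurable_EFinP.
apply: (measurable_fun_fubini_tonelli_F ((EFin \o h)^\-)%E) => //.
exact/measurable_funeneg/measurable_EFinP.
Qed.

Section cfubini.
Context d1 d2 (T1 : measurableType d1) (T2 : measurableType d2) (R : realType).
Variable m1 : {sigma_finite_measure set T1 -> \bar R}.
Variable m2 : {sigma_finite_measure set T2 -> \bar R}.
Implicit Type f : T1 * T2 -> R[i].

Lemma cmeasurable_cintegral f : cmeasurable setT f ->
  cmeasurable setT (fun x => cintegral m2 setT (fun y => f (x, y))).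
Proof.
by move=> [f1 f2]; split;
  [exact: (measurable_Rintegral_section m2 f1)|exact: (measurable_Rintegral_section m2 f2)].
Qed.

Let real_fubini1 (h : T1 * T2 -> R) : (m1 \x m2)%E.-integrable setT (EFin \o h) ->
  \int[(m1 \x m2)%E]_z h z = \int[m1]_x \int[m2]_y h (x, y).
Proof.
move=> hi; have mh : measurable_fun setT h.
  by apply/measurable_EFinP; exact: measurable_int hi.
rewrite /Rintegral; congr fine; rewrite -integral12_prod_meas1//.
apply: ae_eq_integral => //.
- exact: (measurable_fubini_F hi).
- apply/measurable_EFinP; exact: measurable_Rintegral_section.
- apply: filterS (ae_integrable1 hi) => x xi _.
  by rewrite fineK//; exact: integrable_fin_num xi.
Qed.

Let real_fubini2 (h : T1 * T2 -> R) : (m1 \x m2)%E.-integrable setT (EFin \o h) ->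
  \int[(m1 \x m2)%E]_z h z = \int[m2]_y \int[m1]_x h (x, y).
Proof.
move=> hi; have mh : measurable_fun setT h.
  by apply/measurable_EFinP; exact: measurable_int hi.
rewrite /Rintegral; congr fine; rewrite -integral21_prod_meas1//.
apply: ae_eq_integral => //.
- exact: (measurable_fubini_G hi).
- apply/measurable_EFinP; apply: (@measurable_Rintegral_section _ _ _ _ _ m1 (h \o unstable.swap)).
  by apply: measurableT_comp => //; exact: measurable_swap.
- apply: filterS (ae_integrable2 hi) => x xi _.
  by rewrite fineK//; exact: integrable_fin_num xi.
Qed.

Lemma cintegral_prod1 f : cintegrable (m1 \x m2)%E setT f ->
  cintegral (m1 \x m2)%E setT f =
  cintegral m1 setT (fun x => cintegral m2 setT (fun y => f (x, y))).
Proof.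
move=> [f1 f2]; rewrite /cintegral /=; congr (_ +i* _)%C.
  exact: (real_fubini1 f1).
exact: (real_fubini1 f2).
Qed.

Lemma cintegral_prod2 f : cintegrable (m1 \x m2)%E setT f ->
  cintegral (m1 \x m2)%E setT f =
  cintegral m2 setT (fun y => cintegral m1 setT (fun x => f (x, y))).
Proof.
move=> [f1 f2]; rewrite /cintegral /=; congr (_ +i* _)%C.
  exact: (real_fubini2 f1).
exact: (real_fubini2 f2).
Qed.

Lemma cintegrable_prod f : cmeasurable setT f ->
  (\int[m1]_x \int[m2]_y (normc (f (x, y)))%:E < +oo)%E ->
  cintegrable (m1 \x m2)%E setT f.
Proof.
move=> mf fi; apply/cintegrableP => //; split => //.
by rewrite (fubini_tonelli1 (fun z => (normc (f z))%:E))//; [exact: measurable_normcE|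
  move=> x; rewrite lee_fin normc_ge0].
Qed.

Lemma cFubini f : cmeasurable setT f ->
  (\int[m1]_x \int[m2]_y (normc (f (x, y)))%:E < +oo)%E ->
  cintegral m1 setT (fun x => cintegral m2 setT (fun y => f (x, y))) =
  cintegral m2 setT (fun y => cintegral m1 setT (fun x => f (x, y))).
Proof.
move=> mf fi; have fp := cintegrable_prod mf fi.
by rewrite -cintegral_prod1// cintegral_prod2.
Qed.

Lemma cintegrable_cintegral f : cmeasurable setT f ->
  (\int[m1]_x \int[m2]_y (normc (f (x, y)))%:E < +oo)%E ->
  cintegrable m1 setT (fun x => cintegral m2 setT (fun y => f (x, y))).
Proof.
move=> mf fi; apply/cintegrableP => //; split.
  exact: cmeasurable_cintegral.
have [f1 f2] := cintegrable_prod mf fi.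
apply: le_lt_trans fi; apply: ae_ge0_le_integral => //.
- by move=> x _; rewrite lee_fin normc_ge0.
- by apply: measurable_normcE; exact: cmeasurable_cintegral.
- by move=> x _; apply: integral_ge0 => y _; rewrite lee_fin normc_ge0.
- apply: (measurable_fun_fubini_tonelli_F (fun z => (normc (f z))%:E)).
    exact: measurable_normcE.
  by move=> x; rewrite lee_fin normc_ge0.
apply: filterS2 (ae_integrable1 f1) (ae_integrable1 f2) => x xi1 xi2 _.
by apply: le_normc_cintegral.
Qed.

End cfubini.

(** * Lebesgue measure on R^n *)

Section affine_line.
Context {R : realType}.
Local Notation lam := (@lebesgue_measure R).

Definition affine (a b : R) : measurableTypeR R -> measurableTypeR R :=
  fun t => a * t + b.

Lemma measurable_affine (a b : R) : measurable_fun setT (affine a b).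
Proof.
by apply: measurable_funD; [apply: measurable_funM|].
Qed.

Let scaled_pushforward (a b : R) := mscale `|a|%:nng
  (measure_function_pushforward__canonical__measure_function_Measure lam
    (measurable_affine a b)).

(** By uniqueness of Lebesgue measure it is enough to compare half-open
intervals; for [a < 0] the preimage is half-open at the other end, which does
not change its length. *)
Lemma lebesgue_measure_affine (a b : R) (A : set R) : a != 0 -> measurable A ->
  lam A = (`|a|%:E * lam (affine a b @^-1` A))%E.
Proof.
move=> a0 mA.
apply: (@lebesgue_measure_unique R (scaled_pushforward a b)) => // X [[p q] /= pq <-].
rewrite /mscale /= /pushforward.
have pos c r : (0 < a)%R -> (r < a * c + b) = ((r - b) / a < c).
  by move=> a_gt0; rewrite ltr_pdivrMr// ltrBlDr mulrC.
have pos' c r : (0 < a)%R -> (a * c + b <= r) = (c <= (r - b) / a).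
  by move=> a_gt0; rewrite ler_pdivlMr// lerBrDr mulrC.
have neg c r : (a < 0)%R -> (r < a * c + b) = (c < (r - b) / a).
  by move=> a_lt0; rewrite ltr_ndivlMr// ltrBlDr mulrC.
have neg' c r : (a < 0)%R -> (a * c + b <= r) = ((r - b) / a <= c).
  by move=> a_lt0; rewrite ler_ndivrMr// lerBrDr mulrC.
have [a_lt0|a_gt0|a_eq0] := ltgtP a 0; last by rewrite a_eq0 eqxx in a0.
  rewrite (_ : affine a b @^-1` _ = `[(q - b) / a, (p - b) / a[%classic); last first.
    by apply/seteqP; split => x /=; rewrite !in_itv /= /affine neg// neg'// andbC.
  rewrite !lebesgue_measure_itv /= !lte_fin ltr_ndivrMr// divfK ?lt_eqF//.
  rewrite ltrBrDr subrK; case: ifP => _; last by rewrite mule0.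
  rewrite -!EFinB -EFinM ltr0_norm//; congr EFin.
  by rewrite -mulrBl mulrC -mulrA mulrN mulVf ?lt_eqF// mulrN1; ring.
rewrite (_ : affine a b @^-1` _ = `](p - b) / a, (q - b) / a]%classic); last first.
  by apply/seteqP; split => x /=; rewrite !in_itv /= /affine pos// pos'//.
rewrite !lebesgue_measure_itv /= !lte_fin ltr_pdivrMr// divfK ?gt_eqF//.
rewrite ltrBrDr subrK; case: ifP => _; last by rewrite mule0.
rewrite -!EFinB -EFinM gtr0_norm//; congr EFin.
by rewrite -mulrBl mulrC -mulrA mulVf ?gt_eqF// mulr1; ring.
Qed.

Lemma ge0_integral_affine (a b : R) (f : R -> \bar R) : a != 0 ->
  measurable_fun setT f -> (forall x, 0 <= f x)%E ->
  (\int[lam]_x f x = `|a|%:E * \int[lam]_x f (a * x + b)%R)%E.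
Proof.
move=> a0 mf f0.
rewrite (eq_measure_integral (scaled_pushforward a b)).
  rewrite ge0_integral_mscale//=.
  by rewrite ge0_integral_pushforward//; exact: measurable_affine.
by move=> A mA _; exact: lebesgue_measure_affine.
Qed.

End affine_line.

Section cons_integral.
Context {R : realType} (n : nat).
Local Notation lam := (@lebesgue_measure R).
Local Notation mu := (lebesgue_Rn R n).

Lemma ge0_integral_cons (f : Rn R n.+1 -> \bar R) :
  measurable_fun setT f -> (forall x, 0 <= f x)%E ->
  (\int[lebesgue_Rn R n.+1]_x f x =
   \int[lam]_x \int[mu]_t f (cons_pair (x, t)))%E.
Proof.
move=> mf f0.
transitivity (\int[pushforward (lam \x mu)%E (@cons_pair R n)]_x f x)%E; first by [].
rewrite ge0_integral_pushforward//; last exact: measurable_cons_pair.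
rewrite preimage_setT -(fubini_tonelli1 (f \o @cons_pair R n))//.
  by apply: measurableT_comp => //; exact: measurable_cons_pair.
by move=> x; exact: f0.
Qed.

Lemma lebesgue_consE (A : set (Rn R n.+1)) :
  lebesgue_Rn R n.+1 A = (lam \x mu)%E (@cons_pair R n @^-1` A).
Proof. by []. Qed.

Lemma thead_cons_pair (x : R) (t : Rn R n) : tnth (cons_pair (x, t)) ord0 = x.
Proof. by []. Qed.

Lemma tnth_cons_pair (x : R) (t : Rn R n) j :
  tnth (cons_pair (x, t)) (lift ord0 j) = tnth t j.
Proof. by rewrite /cons_pair tnthS. Qed.

End cons_integral.

Section almost_everywhere.
Context {R : realType}.
Local Notation lam := (@lebesgue_measure R).

(** A cylinder over a null set of one coordinate is null, by Tonelli. *)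
Lemma lebesgue_Rn_coord0 n (i : 'I_n) (N : set R) : measurable N -> lam N = 0%E ->
  lebesgue_Rn R n ((fun x : Rn R n => tnth x i) @^-1` N) = 0%E.
Proof.
move=> mN N0; elim: n i => [[]//|n IH] i.
rewrite lebesgue_consE; have [j ->|->] := unliftP ord0 i.
  rewrite (_ : _ @^-1` _ = setT `*` ((fun x : Rn R n => tnth x j) @^-1` N)); last first.
    apply/seteqP; split => -[x t] /=; first by rewrite tnth_cons_pair.
    by move=> [_]; rewrite tnth_cons_pair.
  rewrite product_measure1E//; first by rewrite IH mule0.
  by rewrite -[X in measurable X]setTI; exact: measurable_tnth.
rewrite (_ : _ @^-1` _ = N `*` setT); last first.
  by apply/seteqP; split => -[x t] //= [].
by rewrite product_measure1E// [X in (X * _)%E](_ : _ = 0%E) ?mul0e.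
Qed.

Lemma ae_tnth n (i : 'I_n) (P : R -> Prop) :
  {ae lam, forall x, P x} -> {ae lebesgue_Rn R n, forall x, P (tnth x i)}.
Proof.
move=> [N [mN N0 PN]]; exists ((fun x : Rn R n => tnth x i) @^-1` N); split.
- by rewrite -[X in measurable X]setTI; exact: measurable_tnth.
- exact: lebesgue_Rn_coord0.
- by move=> x /= nP; apply: PN.
Qed.

Lemma ae_imply d (T : measurableType d) (mu : {measure set T -> \bar R})
    (P Q : T -> Prop) :
  (forall x, P x -> Q x) -> {ae mu, forall x, P x} -> {ae mu, forall x, Q x}.
Proof. by move=> PQ; apply: filterS. Qed.

Lemma ae_imply2 d (T : measurableType d) (mu : {measure set T -> \bar R})
    (P P' Q : T -> Prop) :
  (forall x, P x -> P' x -> Q x) -> {ae mu, forall x, P x} ->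
  {ae mu, forall x, P' x} -> {ae mu, forall x, Q x}.
Proof. by move=> PQ; apply: filterS2. Qed.

Lemma ae_neq (p : R) : {ae lam, forall x, x != p}.
Proof.
exists [set p]; split => //; first exact: lebesgue_measure_set1.
by move=> x /= /negP; rewrite negbK => /eqP.
Qed.

Lemma ae_Rn0 n : {ae lebesgue_Rn R n, forall x, Rn0 R n x}.
Proof.
have h : {ae lebesgue_Rn R n, forall x, forall i : 'I_n, tnth x i != 0 :> R}.
  by apply: filter_forall => i; exact: (@ae_tnth _ i (fun y => y != 0) (ae_neq 0)).
apply: (ae_imply _ h) => x xi; rewrite /Rn0 /= /absp normr_eq0.
by apply/prodf_neq0 => i _.
Qed.

Lemma measurable_absp n : measurable_fun setT (@absp R n).
Proof.
apply: measurableT_comp => //; apply: measurable_prod => i _; exact: measurable_tnth.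
Qed.

Lemma measurable_Rn0 n : measurable (Rn0 R n).
Proof.
rewrite (_ : Rn0 R n = (@absp R n) @^-1` (~` [set 0])).
  by rewrite -[X in measurable X]setTI; apply: measurable_absp => //; exact: measurableC.
by apply/seteqP; split => x /=; [move=> /eqP|move=> /eqP].
Qed.

End almost_everywhere.

Section tensor.
Context {R : realType}.
Local Notation lam := (@lebesgue_measure R).

Definition ctensor n (f : 'I_n -> R -> R[i]) : Rn R n -> R[i] :=
  fun x => \prod_(i < n) f i (tnth x i).

Lemma cmeasurable_prod d (T : measurableType d) n (f : 'I_n -> T -> R[i]) :
  (forall i, cmeasurable setT (f i)) ->
  cmeasurable setT (fun x => \prod_(i < n) f i x).
Proof.
elim: n f => [|n IH] f mf.
  rewrite (_ : (fun _ => _) = fun=> 1); first exact: cmeasurable_cst.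
  by apply/funext => x; rewrite big_ord0.
rewrite (_ : (fun _ => _) = fun x => f ord0 x * \prod_(i < n) f (lift ord0 i) x).
  by apply: cmeasurableM => //; exact: IH.
by apply/funext => x; rewrite big_ord_recl.
Qed.

Lemma cmeasurable_ctensor n (f : 'I_n -> R -> R[i]) :
  (forall i, cmeasurable setT (f i)) -> cmeasurable setT (ctensor f).
Proof.
move=> mf; apply: (@cmeasurable_prod _ _ _ (fun i (x : Rn R n) => f i (tnth x i))) => i.
by apply: (cmeasurable_comp (mf i)); exact: measurable_tnth.
Qed.

Lemma ge0_integral_tensor n (f : 'I_n -> R -> R) :
  (forall i, measurable_fun setT (f i)) -> (forall i x, 0 <= f i x) ->
  (\int[lebesgue_Rn R n]_x (\prod_(i < n) f i (tnth x i))%:E =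
   \prod_(i < n) \int[lam]_x (f i x)%:E)%E.
Proof.
elim: n f => [|n IH] f mf f0.
  rewrite big_ord0 (_ : (fun _ => _) = cst 1%E) ?integral_cst//=.
    by rewrite mul1e diracT.
  by apply/funext => x; rewrite big_ord0.
have mprod : measurable_fun setT (fun x : Rn R n => \prod_(i < n) f (lift ord0 i) (tnth x i)).
  apply: measurable_prod => i _; apply: (measurableT_comp (mf _)); exact: measurable_tnth.
rewrite big_ord_recl ge0_integral_cons; last 2 first.
- apply/measurable_EFinP; apply: measurable_prod => i _.
  by apply: (measurableT_comp (mf _)); exact: measurable_tnth.
- by move=> x; rewrite lee_fin prodr_ge0.
rewrite -IH// -ge0_integralZr//; last 3 first.
- by apply/measurable_EFinP; exact: mf.
- by move=> x _; rewrite lee_fin.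
- by apply: integral_ge0 => x _; rewrite lee_fin prodr_ge0.
apply: eq_integral => x _; rewrite -ge0_integralZl//; last 3 first.
- by apply/measurable_EFinP; exact: mprod.
- by move=> t _; rewrite lee_fin prodr_ge0.
- by rewrite lee_fin.
apply: eq_integral => t _; rewrite big_ord_recl -EFinM; congr (_ * _)%:E.
by apply: eq_bigr => i _; rewrite tnth_cons_pair.
Qed.

(** Change of variables in the form needed for [lebesgue_Rn], which is defined
in each dimension as an image measure. *)
Lemma cintegrable_pushforward d d' (X : measurableType d) (Y : measurableType d')
    (mu : {measure set X -> \bar R}) (nu : {measure set Y -> \bar R})
    (p : X -> Y) (f : Y -> R[i]) :
  measurable_fun setT p -> (forall A, nu A = pushforward mu p A) ->
  cintegrable nu setT f -> cintegrable mu setT (f \o p) /\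
  cintegral nu setT f = cintegral mu setT (f \o p).
Proof.
move=> mp nuE fi.
have mf := cintegrable_measurable fi.
have fpi : cintegrable mu setT (f \o p).
  move/cintegrableP : (fi) => [//|_ fi']; apply/cintegrableP => //; split.
    exact: cmeasurable_comp.
  suff <- : (\int[nu]_x (normc (f x))%:E = \int[mu]_x (normc (f (p x)))%:E)%E by [].
  rewrite (eq_measure_integral (measure_function_pushforward__canonical__measure_function_Measure mu mp))//.
  rewrite [LHS](ge0_integral_pushforward mp)//.
    exact: measurable_normcE.
  by move=> y _; rewrite lee_fin normc_ge0.
split => //; case: mf => mf1 mf2.
case: fpi => fp1 fp2; rewrite /cintegral /Rintegral; congr (fine _ +i* fine _)%C.
  rewrite [LHS](eq_measure_integral (measure_function_pushforward__canonical__measure_function_Measure mu mp))//.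
  by rewrite integral_pushforward//; exact/measurable_EFinP.
rewrite [LHS](eq_measure_integral (measure_function_pushforward__canonical__measure_function_Measure mu mp))//.
by rewrite integral_pushforward//; exact/measurable_EFinP.
Qed.

Lemma cintegral_cons n (f : Rn R n.+1 -> R[i]) :
  cintegrable (lebesgue_Rn R n.+1) setT f ->
  cintegral (lebesgue_Rn R n.+1) setT f =
  cintegral lam setT (fun x => cintegral (lebesgue_Rn R n) setT
    (fun t => f (cons_pair (x, t)))).
Proof.
move=> fi; have [] := @cintegrable_pushforward _ _ _ _
  (lam \x lebesgue_Rn R n)%E (lebesgue_Rn R n.+1) _ f (@measurable_cons_pair R n) (fun A => erefl) fi.
by move=> fpi ->; rewrite cintegral_prod1.
Qed.

Lemma cintegrable_tensor n (f : 'I_n -> R -> R[i]) :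
  (forall i, cintegrable lam setT (f i)) ->
  cintegrable (lebesgue_Rn R n) setT (ctensor f).
Proof.
move=> fi; apply/cintegrableP => //; split.
  by apply: cmeasurable_ctensor => i; exact: (cintegrable_measurable (fi i)).
rewrite [ltLHS](_ : _ = \int[lebesgue_Rn R n]_x
    (\prod_(i < n) normc (f i (tnth x i)))%:E)%E; last first.
  apply: eq_integral => x _; congr EFin; rewrite /ctensor.
  exact: (big_morph (@normc R) (@normcM R) (@normc1 R)).
rewrite (ge0_integral_tensor (f := fun i x => normc (f i x))).
- apply: (@proj2 (0 <= \prod_(i < n) \int[lam]_x (normc (f i x))%:E)%E).
  apply: (big_ind (fun x => 0 <= x /\ x < +oo)%E).
  + by rewrite lee01 ltry.
  + move=> x y [x0 xoo] [y0 yoo]; rewrite mule_ge0//; split => //.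
    by rewrite lte_mul_pinfty// ge0_fin_numE.
  + move=> i _; split; first by apply: integral_ge0 => x _; rewrite lee_fin normc_ge0.
    by have /cintegrableP[] := fi i.
- by move=> i; apply: measurable_normc; exact: (cintegrable_measurable (fi i)).
- by move=> i x; exact: normc_ge0.
Qed.

Lemma cintegral_tensor n (f : 'I_n -> R -> R[i]) :
  (forall i, cintegrable lam setT (f i)) ->
  cintegral (lebesgue_Rn R n) setT (ctensor f) =
  \prod_(i < n) cintegral lam setT (f i).
Proof.
elim: n f => [|n IH] f fi.
  rewrite big_ord0 (_ : ctensor f = fun=> 1); last first.
    by apply/funext => x; rewrite /ctensor big_ord0.
  rewrite /cintegral /= !Rintegral_cst//=.
  by rewrite indicT !mulr1.
rewrite cintegral_cons; last exact: cintegrable_tensor.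
rewrite big_ord_recl -IH// mulrC -cintegralZ//.
apply: eq_cintegral => x _; rewrite mulrC -cintegralZ; last 2 first.
- by [].
- exact: cintegrable_tensor.
apply: eq_cintegral => t _; rewrite /ctensor big_ord_recl; congr (_ * _).
by apply: eq_bigr => i _; rewrite tnth_cons_pair.
Qed.

End tensor.

Section affine_space.
Context {R : realType}.
Local Notation lam := (@lebesgue_measure R).

Definition affine_map n (a b : Rn R n) (t : Rn R n) : Rn R n :=
  [tuple ((tnth a i : R) * (tnth t i : R) + (tnth b i : R)) | i < n].

Lemma measurable_affine_map n (a b : Rn R n) : measurable_fun setT (affine_map a b).
Proof.
apply/measurable_fun_tnthP => i.
rewrite (_ : _ \o _ = fun t : Rn R n => (tnth a i : R) * (tnth t i : R) + (tnth b i : R)).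
  apply: measurable_funD => //; apply: measurable_funM => //; exact: measurable_tnth.
by apply/funext => t /=; rewrite tnth_mktuple.
Qed.

(** One coordinate at a time: Tonelli reduces the substitution to the affine
substitution on the line. *)
Lemma ge0_integral_affine_map n (a b : Rn R n) (f : Rn R n -> \bar R) : Rn0 R n a ->
  measurable_fun setT f -> (forall x, 0 <= f x)%E ->
  (\int[lebesgue_Rn R n]_x f x =
   (absp a)%:E * \int[lebesgue_Rn R n]_x f (affine_map a b x))%E.
Proof.
elim: n a b f => [|n IH] a b f a0 mf f0.
  rewrite /absp big_ord0 normr1 mul1e; apply: eq_integral => x _; congr f.
  by rewrite [LHS]tuple0 [RHS]tuple0.
have ta0 : (tnth a ord0 : R) != 0.
  by move: a0; rewrite /Rn0 /= /absp normr_eq0 big_ord_recl mulf_eq0 negb_or => /andP[].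
pose a' : Rn R n := [tuple of behead a]; pose b' : Rn R n := [tuple of behead b].
have tnthb (c : Rn R n.+1) j : tnth [tuple of behead c] j = tnth c (lift ord0 j).
  by rewrite [in RHS](tuple_eta c) tnthS.
have absE : absp a = `|tnth a ord0 : R| * absp a'.
  rewrite /absp big_ord_recl normrM; congr (_ * `|_|).
  by apply: eq_bigr => i _; rewrite tnthb.
have a'0 : Rn0 R n a'.
  by move: a0; rewrite /Rn0 /= absE mulf_eq0 negb_or => /andP[].
have mfc : measurable_fun setT (f \o @cons_pair R n).
  by apply: measurableT_comp => //; exact: measurable_cons_pair.
have mf1 x : measurable_fun setT (fun t => f (cons_pair (x, t))).
  by apply: (measurableT_comp mfc); exact: measurable_pair1.
rewrite !ge0_integral_cons//; last first.
  by apply: (measurableT_comp mf); exact: measurable_affine_map.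
rewrite absE EFinM -muleA.
have affE x t : affine_map a b (cons_pair (x, t)) =
    cons_pair ((tnth a ord0 : R) * x + (tnth b ord0 : R), affine_map a' b' t).
  apply: eq_from_tnth => i; rewrite tnth_mktuple.
  have [j ->|->] := unliftP ord0 i; last by rewrite !thead_cons_pair.
  by rewrite !tnth_cons_pair tnth_mktuple !tnthb.
rewrite (@ge0_integral_affine _ (tnth a ord0) (tnth b ord0))//; last 2 first.
- apply: (measurable_fun_fubini_tonelli_F (f \o @cons_pair R n)) => [|x]; last exact: f0.
  exact: mfc.
- by move=> x; apply: integral_ge0 => t _.
congr (_ * _)%E; rewrite -ge0_integralZl//; last 3 first.
- apply: (measurable_fun_fubini_tonelli_F
    ((f \o affine_map a b) \o @cons_pair R n)) => [|x]; last exact: f0.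
  apply: measurableT_comp; last exact: measurable_cons_pair.
  by apply: (measurableT_comp mf); exact: measurable_affine_map.
- by move=> x _; apply: integral_ge0 => t _.
- by rewrite lee_fin normr_ge0.
apply: eq_integral => x _; rewrite (IH a' b')//.
by under [in RHS]eq_integral do rewrite affE.
Qed.

Let Rintegral_affine_map n (a b : Rn R n) (h : Rn R n -> R) : Rn0 R n a ->
  (lebesgue_Rn R n).-integrable setT (EFin \o h) ->
  (lebesgue_Rn R n).-integrable setT (EFin \o (h \o affine_map a b)) ->
  \int[lebesgue_Rn R n]_x h x = absp a * \int[lebesgue_Rn R n]_x h (affine_map a b x).
Proof.
move=> a0 hi hai; have mh := measurable_int _ hi.
rewrite /Rintegral [in LHS]integralE.
rewrite (ge0_integral_affine_map b a0 (measurable_funepos mh))//.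
rewrite (ge0_integral_affine_map b a0 (measurable_funeneg mh))//.
have posE : (fun x => (EFin \o h)^\+ (affine_map a b x))%E =
    ((EFin \o (h \o affine_map a b))^\+)%E.
  by apply/funext => x; rewrite !funeposE.
have negE : (fun x => (EFin \o h)^\- (affine_map a b x))%E =
    ((EFin \o (h \o affine_map a b))^\-)%E.
  by apply/funext => x; rewrite !funenegE.
rewrite posE negE -muleBr//; last first.
  apply: fin_num_adde_defr.
  exact: (integrable_pos_fin_num measurableT hai).
rewrite fineM//; last first.
  by have := integrable_fin_num measurableT hai; rewrite integralE.
by rewrite [in RHS]integralE.
Qed.

Lemma cintegral_affine_map n (a b : Rn R n) (f : Rn R n -> R[i]) : Rn0 R n a ->
  cintegrable (lebesgue_Rn R n) setT f ->
  cintegrable (lebesgue_Rn R n) setT (f \o affine_map a b) /\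
  cintegral (lebesgue_Rn R n) setT f =
  ((absp a)%:C)%C * cintegral (lebesgue_Rn R n) setT (f \o affine_map a b).
Proof.
move=> a0 fi; have mf := cintegrable_measurable fi.
have ap : 0 < absp a by rewrite lt_neqAle eq_sym a0 normr_ge0.
have fai : cintegrable (lebesgue_Rn R n) setT (f \o affine_map a b).
  move/cintegrableP : (fi) => [//|_ fi']; apply/cintegrableP => //; split.
    by apply: cmeasurable_comp => //; exact: measurable_affine_map.
  move: fi'; rewrite (ge0_integral_affine_map b a0); last 2 first.
  - exact: measurable_normcE.
  - by move=> x; rewrite lee_fin normc_ge0.
  by rewrite -lte_pdivlMl// mulry gtr0_sg ?invr_gt0// mul1e.
split => //; case: (fi) => f1 f2; case: (fai) => fa1 fa2.
apply: eqC; rewrite ?ReM ?ImM /cintegral /=.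
  by rewrite mul0r subr0 (@Rintegral_affine_map _ a b (fun x => complex.Re (f x))).
by rewrite mul0r addr0 (@Rintegral_affine_map _ a b (fun x => complex.Im (f x))).
Qed.

End affine_space.

Section boxes.
Context {R : realType} (n : nat).
Local Notation mu := (lebesgue_Rn R n).

(** Half-open boxes: they are stable under intersection and generate the
product sigma-algebra, so that integrals over boxes determine a function. *)
Definition box (p q : Rn R n) : set (Rn R n) :=
  [set x | forall i, (tnth p i : R) < tnth x i <= (tnth q i : R)].

Lemma measurable_box p q : measurable (box p q).
Proof.
rewrite (_ : box p q = \bigcap_(i in [set: 'I_n])
    ((fun x : Rn R n => tnth x i) @^-1` `](tnth p i : R), (tnth q i : R)])).
  apply: fin_bigcap_measurable => // i _.
  by rewrite -[X in measurable X]setTI; exact: measurable_tnth.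
apply/seteqP; split => x /= bx i; first by move=> _; rewrite /= in_itv /= bx.
by have /= := bx i I; rewrite in_itv.
Qed.

Definition boxes : set (set (Rn R n)) := [set A | exists p q, A = box p q].

Lemma boxI : setI_closed boxes.
Proof.
move=> _ _ [p [q ->]] [p' [q' ->]].
exists [tuple Num.max (tnth p i : R) (tnth p' i) | i < n].
exists [tuple Num.min (tnth q i : R) (tnth q' i) | i < n].
apply/seteqP; split => x /=.
  move=> [bx bx'] i; rewrite !tnth_mktuple gt_max le_min.
  by have /andP[-> ->] := bx i; have /andP[-> ->] := bx' i.
by move=> bx; split => i; have := bx i; rewrite !tnth_mktuple gt_max le_min;
  move=> /andP[/andP[h1 h2] /andP[h3 h4]]; apply/andP.
Qed.

Definition cube (k : nat) : set (Rn R n) :=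
  box [tuple - (k%:R : R) | _ < n] [tuple (k%:R : R) | _ < n].

Lemma cubeP k x : cube k x <-> forall i, - (k%:R : R) < tnth x i <= k%:R.
Proof.
by split => cx i; have := cx i; rewrite !tnth_mktuple.
Qed.

Lemma cube_boxes k : boxes (cube k). Proof. by eexists; eexists. Qed.

Lemma cube_sub k l : (k <= l)%N -> cube k `<=` cube l.
Proof.
move=> kl x /cubeP cx; apply/cubeP => i; have /andP[h1 h2] := cx i.
have klR : (k%:R : R) <= l%:R by rewrite ler_nat.
by rewrite (le_lt_trans _ h1) ?lerN2// (le_trans h2).
Qed.

Lemma bigcup_cube : \bigcup_k cube k = setT.
Proof.
apply/seteqP; split => // x _.
pose M := \sum_(i < n) `|(tnth x i : R)|.
exists (Num.bound M).+1 => //; apply/cubeP => i.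
have xM : `|(tnth x i : R)| < (Num.bound M).+1%:R.
  rewrite (@le_lt_trans _ _ M)//.
    by rewrite /M (bigD1 i)//= lerDl sumr_ge0.
  rewrite (lt_trans (archi_boundP _)) ?sumr_ge0//.
  by rewrite ltr_nat.
by move: xM; rewrite ltr_norml => /andP[-> /ltW].
Qed.

(** A slab in one coordinate is the increasing union of the boxes that are
bounded by [k] in the other coordinates. *)
Lemma generated_boxes : @measurable _ (Rn R n) = <<s boxes >>.
Proof.
apply/seteqP; split; last first.
  apply: smallest_sub; first exact: sigma_algebra_measurable.
  by move=> _ [p [q ->]]; exact: measurable_box.
apply: smallest_sub; first exact: smallest_sigma_algebra.
apply: (big_ind (fun X => X `<=` <<s boxes >>)) => //.
  by move=> X Y XS YS; rewrite subUset.
move=> i _ _ [A mA <-].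
pose T' := g_sigma_algebraType boxes.
have mi : measurable_fun (setT : set T') (fun x : T' => tnth (x : Rn R n) i : measurableTypeR R).
  apply: (@measurability _ _ T' (measurableTypeR R) setT _ (R.-ocitv).-measurable) => //.
  move=> _ [_ [[a b] /= _ <-] <-]; rewrite setTI.
  rewrite (_ : _ @^-1` _ = \bigcup_k (box
     [tuple if j == i then a else - (k%:R : R) | j < n]
     [tuple if j == i then b else (k%:R : R) | j < n])).
    apply: bigcup_measurable => k _; apply: sub_sigma_algebra.
    by eexists; eexists.
  apply/seteqP; split => x /=.
    rewrite in_itv /= => xab.
    have : (\bigcup_k cube k) x by rewrite bigcup_cube.
    move=> [k _ /cubeP cx]; exists k => // j; rewrite !tnth_mktuple.
    by case: eqP => [->|_].
  move=> [k _] bx; have := bx i; rewrite !tnth_mktuple eqxx in_itv //.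
by have := mi measurableT A mA; rewrite setTI.
Qed.

(** For a fixed cube, the measurable sets [A] such that the integral over the part
of [A] in the cube vanishes form a Dynkin system containing the boxes, hence
are all the measurable sets. *)
Lemma ae_eq0_boxes (h : Rn R n -> R) :
  (forall k, mu.-integrable (cube k) (EFin \o h)) ->
  (forall p q k, box p q `<=` cube k -> (\int[mu]_(x in box p q) (h x)%:E = 0)%E) ->
  {ae mu, forall x, h x = 0}.
Proof.
move=> hi h0.
have mcube k : measurable (cube k) by exact: measurable_box.
have step k A : measurable A -> (\int[mu]_(x in A `&` cube k) (h x)%:E = 0)%E.
  move=> mA; rewrite generated_boxes in mA.
  pose P (B : set (Rn R n)) := (\int[mu]_(x in B `&` cube k) (h x)%:E = 0)%E.
  apply: (@dynkin_induction _ _ _ P generated_boxes boxI _ _ _ _ A mA); rewrite /P.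
  - by rewrite setTI; apply: (h0 _ _ k).
  - move=> B bB; have [p [q E]] := boxI bB (cube_boxes k).
    by rewrite E; apply: (h0 _ _ k); rewrite -E; exact: subIsetr.
  - move=> B mB IB.
    have := @integral_setU_EFin _ _ _ mu (B `&` cube k) (~` B `&` cube k) h.
    rewrite -setIUl setUv setTI IB add0e => <- //.
    + exact: (h0 _ _ k).
    + exact: measurableI.
    + by apply: measurableI => //; exact: measurableC.
    + by apply/measurable_EFinP; exact: measurable_int (hi k).
    + by apply/disj_set2P; rewrite setIACA setICr set0I.
  - move=> F mF tF IF; rewrite setI_bigcupl integral_bigcup//.
    + by rewrite eseries0// => i _ _; exact: IF.
    + exact: trivIset_setIr.
    + by move=> i; apply: measurableI.
    + rewrite -setI_bigcupl; apply: integrableS (hi k) => //.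
      by apply: measurableI => //; exact: bigcupT_measurable.
have aek k : {ae mu, forall x, cube k x -> h x = 0}.
  have := @integral_ae_eq _ _ _ mu (cube k) (mcube k) (cst 0%E) (EFin \o h) (hi k).
  case.
  - exact: measurable_cst.
  - move=> E Ek mE; rewrite integral0 -[RHS](step k E mE).
    by congr integral; apply/esym/setIidPl.
  - move=> N [mN N0 sN]; exists N; split => // x /= nx; apply: sN => /= H; apply: nx => cx.
    by have := H cx => /= -[].
have : {ae mu, forall x, forall k, cube k x -> h x = 0} by exact: ae_foralln.
apply: ae_imply => x xk; have : (\bigcup_k cube k) x by rewrite bigcup_cube.
by move=> [k _ /xk].
Qed.

End boxes.

(** * The two-sided exponential and its Fourier transform *)

Section abel_kernel.
Context {R : realType}.
Local Notation lam := (@lebesgue_measure R).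

Definition poisson (e x : R) : R := 2 * e / (e ^+ 2 + x ^+ 2).

Lemma poisson_ge0 (e x : R) : 0 < e -> 0 <= poisson e x.
Proof.
by move=> e0; rewrite /poisson divr_ge0 ?mulr_ge0 ?addr_ge0 ?sqr_ge0// ltW.
Qed.

(** [F] is the primitive of [f] that vanishes at infinity. The integrand [f]
carries [1 + cos] instead of [cos] because the fundamental theorem of calculus
on a half-line is applied to nonnegative functions. *)
Let F (e x u : R) : R := expR (- e * u) *
  ((x * sin (x * u) - e * cos (x * u)) / (e ^+ 2 + x ^+ 2) - e^-1).

Let f (e x u : R) : R := expR (- e * u) * (1 + cos (x * u)).

Let den_gt0 (e x : R) : 0 < e -> 0 < e ^+ 2 + x ^+ 2.
Proof. by move=> e0; rewrite ltr_wpDr ?sqr_ge0// exprn_gt0. Qed.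

Let is_derive_F (e x u : R) : 0 < e -> is_derive u 1 (F e x) (f e x u).
Proof.
move=> e0; have d0 := den_gt0 x e0.
have dm (c : R) : is_derive u 1 (fun v : R => c * v) c.
  by apply: is_derive_eq; rewrite /GRing.scale /= mulr1.
have d1 : is_derive u 1 (fun v : R => expR (- e * v)) (expR (- e * u) * - e).
  exact: (@is_derive1_comp R (@expR R) (fun v => - e * v)).
have d2 : is_derive u 1 (fun v : R => sin (x * v)) (cos (x * u) * x).
  exact: (@is_derive1_comp R (@sin R) (fun v => x * v)).
have d3 : is_derive u 1 (fun v : R => cos (x * v)) (- sin (x * u) * x).
  exact: (@is_derive1_comp R (@cos R) (fun v => x * v)).
rewrite /F.
apply: is_derive_eq.
rewrite /GRing.scale /= /f.
field.
by rewrite gt_eqF//= gt_eqF.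
Qed.

Let continuous_f (e x : R) : continuous (f e x).
Proof.
move=> u; rewrite /f.
have dm (c : R) : is_derive u 1 (fun v : R => c * v) c.
  by apply: is_derive_eq; rewrite /GRing.scale /= mulr1.
have d1 : is_derive u 1 (fun v : R => expR (- e * v)) (expR (- e * u) * - e).
  exact: (@is_derive1_comp R (@expR R) (fun v => - e * v)).
have d3 : is_derive u 1 (fun v : R => cos (x * v)) (- sin (x * u) * x).
  exact: (@is_derive1_comp R (@cos R) (fun v => x * v)).
apply: differentiable_continuous; apply/derivable1_diffP.
by apply: ex_derive.
Qed.

Let f_ge0 (e x u : R) : 0 <= f e x u.
Proof.
rewrite /f mulr_ge0 ?expR_ge0//; have := cos_geN1 (x * u); lra.
Qed.

Let F_cvg (e x : R) : 0 < e -> F e x u @[u --> +oo] --> 0.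
Proof.
move=> e0; have d0 := den_gt0 x e0.
pose K := (`|x| + e) / (e ^+ 2 + x ^+ 2) + e^-1.
have ex0 : expR (- e * u) @[u --> +oo] --> 0.
  rewrite (_ : (fun u => expR (- e * u)) =
               (fun z => expR (- z)) \o (fun z => e * z)); last first.
    by apply: eq_fun => u; rewrite mulNr.
  apply: (@cvg_comp _ _ _ _ _ _ (pinfty_nbhs R)); last exact: cvgr_expR.
  exact: gt0_cvgMry.
have exK : expR (- e * u) * K @[u --> +oo] --> 0.
  by rewrite -[X in _ --> X](mul0r K); apply: cvgM => //; exact: cvg_cst.
apply/norm_cvg0P; apply: (squeeze_cvgr _ (cvg_cst 0) exK).
near=> u; rewrite normr_ge0 /= /F normrM (ger0_norm (expR_ge0 _)).
rewrite ler_pM2l ?expR_gt0// (le_trans (ler_normB _ _))// lerD//.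
  rewrite normrM (@gtr0_norm _ (_^-1)) ?invr_gt0// ler_pM2r ?invr_gt0//.
  rewrite (le_trans (ler_normB _ _))// lerD// normrM.
    by rewrite ler_piMr// sin_max.
  by rewrite (gtr0_norm e0) ler_piMr ?cos_max// ltW.
by rewrite gtr0_norm ?invr_gt0.
Unshelve. all: by end_near. Qed.

Let integral_f (e x : R) : 0 < e ->
  (\int[lam]_(u in `[0%R, +oo[) (f e x u)%:E = (e^-1 + e / (e ^+ 2 + x ^+ 2))%:E)%E.
Proof.
move=> e0; rewrite (@ge0_continuous_FTC2y _ _ (F e x) _ 0)//.
- rewrite /F !mulr0 expR0 sin0 cos0 -EFinB; congr EFin; ring.
- exact/continuous_subspaceT/continuous_f.
- exact: F_cvg.
- apply: cvg_at_right_filter; apply: differentiable_continuous.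
  by apply/derivable1_diffP; have [] := is_derive_F x 0 e0.
- move=> u _; rewrite derive1E; have H := is_derive_F x u e0.
  exact: (@derive_val _ _ _ _ _ _ _ H).
Qed.

Definition abel (e u : R) : R := expR (- e * `|u|).

Lemma abel_ge0 (e u : R) : 0 <= abel e u. Proof. exact: expR_ge0. Qed.

Lemma continuous_abel (e : R) : continuous (abel e).
Proof.
move=> u; apply: (@continuous_comp _ _ _ (fun v => - e * `|v|) (@expR R)).
  apply: cvgM; first exact: cvg_cst.
  exact: norm_continuous.
exact: continuous_expR.
Qed.

Lemma measurable_abel (e : R) : measurable_fun setT (abel e).
Proof. by apply: continuous_measurable_fun; exact: continuous_abel. Qed.

Let integral_abel_cos (e x : R) : 0 < e ->
  (\int[lam]_u (abel e u * (1 + cos (x * u)))%:E = (2 / e + poisson e x)%:E)%E.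
Proof.
move=> e0; rewrite ge0_symfun_integralT; first last.
- by move=> u; rewrite /= /abel normrN mulrN cosN.
- move=> u; apply: cvgM; first exact: continuous_abel.
  apply: cvgD; first exact: cvg_cst.
  apply: (@continuous_comp _ _ _ (fun v => x * v) (@cos R)).
    by apply: cvgM; [exact: cvg_cst|exact: cvg_id].
  exact: continuous_cos.
- by move=> u; rewrite mulr_ge0 ?abel_ge0//; have := cos_geN1 (x * u); lra.
rewrite (_ : [set u | (0 <= u)%R] = `[0%R, +oo[%classic); last first.
  by apply/seteqP; split => u /=; rewrite in_itv /= andbT.
rewrite [X in (_ * X)%E](_ : _ = \int[lam]_(u in `[0%R, +oo[) (f e x u)%:E)%E; last first.
  apply: eq_integral => u; rewrite inE /= in_itv /= andbT => u0.
  by rewrite /f /abel (ger0_norm u0).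
rewrite integral_f// -EFinM /poisson; congr EFin.
by rewrite mulrDr mulrA.
Qed.

Lemma integrable_abel (e : R) : 0 < e -> lam.-integrable setT (EFin \o abel e).
Proof.
move=> e0; apply/integrableP; split; first by apply/measurable_EFinP; exact: measurable_abel.
have := integral_abel_cos 0 e0.
rewrite (_ : (fun u => _) = (fun u => 2%:E * (abel e u)%:E)%E); last first.
  by apply/funext => u; rewrite mul0r cos0 mulrC EFinM; congr (_ * _)%E.
rewrite ge0_integralZl//; last 2 first.
- by apply/measurable_EFinP; exact: measurable_abel.
- by move=> u _; rewrite lee_fin abel_ge0.
move=> E; rewrite [ltLHS](_ : _ = \int[lam]_u (abel e u)%:E)%E; last first.
  by apply: eq_integral => u _; rewrite /= ger0_norm ?abel_ge0.
rewrite ltey; apply/eqP => H; move: E; rewrite H.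
by rewrite mulry gtr0_sg// mul1e.
Qed.

(** Subtracting the value at frequency 0 from the integral with [1 + cos] gives
the real part; the imaginary part vanishes because [1 + sin] and [1 - sin]
have the same integral by the reflection [u |-> - u]. *)
Lemma abel_fourier (e x : R) : 0 < e ->
  cintegrable lam setT (fun u => ((abel e u)%:C)%C * expi (x * u)) /\
  cintegral lam setT (fun u => ((abel e u)%:C)%C * expi (x * u)) =
    ((poisson e x)%:C)%C.
Proof.
move=> e0; have ai := integrable_abel e0.
have mexp : cmeasurable setT (fun u : measurableTypeR R => expi (x * u)).
  by apply: cmeasurable_expi; apply: measurable_funM.
have ci : cintegrable lam setT (fun u => ((abel e u)%:C)%C * expi (x * u)).
  apply: (cintegrable_le _ _ ai) => //.
    by apply: cmeasurableM => //; apply: cmeasurable_real; exact: measurable_abel.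
  by move=> u _; rewrite normcM normc_expi mulr1 normc_real ger0_norm ?abel_ge0.
split => //.
have intp (g : R -> R) : measurable_fun setT g -> (forall u, `|g u| <= 1) ->
    lam.-integrable setT (EFin \o (fun u => abel e u * g u)).
  move=> mg g1; apply: le_integrable ai => //.
    by apply/measurable_EFinP; apply: measurable_funM => //; exact: measurable_abel.
  move=> u _; rewrite /= lee_fin normrM ler_piMr//.
have mcos : measurable_fun setT (fun u : R => cos (x * u)) by case: mexp.
have msin : measurable_fun setT (fun u : R => sin (x * u)) by case: mexp.
have icos : lam.-integrable setT (EFin \o (fun u => abel e u * cos (x * u))).
  by apply: intp => // u; exact: cos_max.
have isin : lam.-integrable setT (EFin \o (fun u => abel e u * sin (x * u))).
  by apply: intp => // u; exact: sin_max.
have i1 : \int[lam]_u (abel e u) = 2 / e.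
  have := integral_abel_cos 0 e0.
  rewrite (_ : (fun u => _) = (fun u => 2%:E * (abel e u)%:E)%E); last first.
    by apply/funext => u; rewrite mul0r cos0 mulrC EFinM; congr (_ * _)%E.
  rewrite integralZl//= -(fineK (integrable_fin_num measurableT ai)) -EFinM => -[].
  rewrite /poisson expr0n addr0 => E; rewrite /Rintegral.
  have : 2 * fine (\int[lam]_u (abel e u)%:E)%E = 4 / e.
    rewrite E; field; by rewrite gt_eqF.
  move=> E2; apply: (@mulfI _ 2) => //; rewrite E2; field; by rewrite gt_eqF.
apply: eqC; rewrite /cintegral /=.
  under eq_Rintegral do rewrite mul0r subr0.
  have := congr1 fine (integral_abel_cos x e0) => /=.
  rewrite -/(Rintegral _ _ _).
  under eq_Rintegral do rewrite mulrDr mulr1.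
  rewrite RintegralD// i1; lra.
under eq_Rintegral do rewrite mul0r addr0.
have E : (\int[lam]_u (abel e u * (1 + sin (x * u)))%:E =
          \int[lam]_u (abel e u * (1 - sin (x * u)))%:E)%E.
  rewrite (@ge0_integral_affine _ (-1) 0)//.
  - rewrite normrN1 mul1e; apply: eq_integral => u _.
    by rewrite addr0 mulN1r /abel normrN mulrN sinN.
  - apply/measurable_EFinP; apply: measurable_funM; first exact: measurable_abel.
    by apply: measurable_funD.
  - by move=> u; rewrite lee_fin mulr_ge0 ?abel_ge0//; have := sin_geN1 (x * u); lra.
move: (congr1 fine E); rewrite -!/(Rintegral _ _ _).
under eq_Rintegral do rewrite mulrDr mulr1.
under [X in _ = X]eq_Rintegral do rewrite mulrBr mulr1.
rewrite RintegralD// RintegralB//; lra.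
Qed.

Lemma continuous_poisson (e : R) : 0 < e -> continuous (poisson e).
Proof.
move=> e0 x; rewrite /poisson; apply: cvgM; first exact: cvg_cst.
apply: cvgV; first by rewrite gt_eqF// den_gt0.
by apply: cvgD; [exact: cvg_cst|exact: exprn_continuous].
Qed.

Lemma measurable_poisson (e : R) : 0 < e -> measurable_fun setT (poisson e).
Proof. by move=> e0; apply: continuous_measurable_fun; exact: continuous_poisson. Qed.

(** A primitive is twice the arctangent. *)
Lemma integral_poisson : (\int[lam]_x (poisson 1 x)%:E = (2 * pi)%:E)%E.
Proof.
rewrite ge0_symfun_integralT; first last.
- by move=> u; rewrite /= /poisson sqrrN.
- exact: continuous_poisson.
- by move=> x; exact: poisson_ge0.
rewrite (_ : [set u | (0 <= u)%R] = `[0%R, +oo[%classic); last first.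
  by apply/seteqP; split => u /=; rewrite in_itv /= andbT.
have dF (u : R) : is_derive u 1 (fun v : R => 2 * atan v) (poisson 1 u).
  apply: is_derive_eq; rewrite /GRing.scale /= /poisson expr1n mulr1.
  ring.
rewrite (@ge0_continuous_FTC2y _ _ (fun v : R => 2 * atan v) _ pi)//.
- by rewrite atan0 mulr0 sube0 EFinM.
- by move=> x _; exact: poisson_ge0.
- exact/continuous_subspaceT/continuous_poisson.
- rewrite [X in _ --> X](_ : _ = 2 * (pi / 2)); last by rewrite mulrC divfK.
  by apply: cvgM; [exact: cvg_cst|exact: cvgy_atan].
- apply: cvg_at_right_filter.
  by apply: cvgM; [exact: cvg_cst|exact: continuous_atan].
- move=> u _; rewrite derive1E; have H := dF u.
  exact: (@derive_val _ _ _ _ _ _ _ H).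
Qed.

End abel_kernel.

(** * Square-integrable functions *)

Section square_integrable.
Context {R : realType} (n : nat).
Local Notation mu := (lebesgue_Rn R n).
Implicit Types f g H X : Rn R n -> R[i].

(** Valued in the extended reals, because the transform of an integrable function
and the sections of the wavelet transform at a given scale may have infinite
norm. *)
Definition sqL2 f : \bar R := (\int[mu]_t (normc (f t) ^+ 2)%:E)%E.

Lemma sqL2_ge0 f : (0 <= sqL2 f)%E.
Proof. by apply: integral_ge0 => t _; rewrite lee_fin sqr_ge0. Qed.

Lemma sqL2_fin f : memL2 f -> sqL2 f \is a fin_num.
Proof. by move=> [_ foo]; rewrite ge0_fin_numE// sqL2_ge0. Qed.

Lemma eq_sqL2 f g : (forall x, normc (f x) = normc (g x)) -> sqL2 f = sqL2 g.
Proof. by move=> fg; apply: eq_integral => x _; rewrite fg. Qed.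

Lemma memL2_le f g : cmeasurable setT f -> memL2 g ->
  (forall x, normc (f x) <= normc (g x)) -> memL2 f.
Proof.
move=> mf [mg goo] fg; split => //; apply: le_lt_trans goo.
apply: ge0_le_integral => //.
- by move=> x _; rewrite lee_fin sqr_ge0.
- exact: measurable_normc2.
- exact: measurable_normc2.
- by move=> x _; rewrite lee_fin ler_pXn2r ?nnegrE ?normc_ge0.
Qed.

Lemma memL2Z (c : R[i]) f : memL2 f -> memL2 (fun x => c * f x).
Proof.
move=> [mf foo]; split; first exact: cmeasurableZ.
rewrite [ltLHS](_ : _ = (normc c ^+ 2)%:E * sqL2 f)%E; last first.
  rewrite /sqL2 -ge0_integralZl//; last 3 first.
  - exact: measurable_normc2.
  - by move=> x _; rewrite lee_fin sqr_ge0.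
  - by rewrite lee_fin sqr_ge0.
  by apply: eq_integral => x _; rewrite normcM exprMn EFinM.
by rewrite lte_mul_pinfty// lee_fin sqr_ge0.
Qed.

Lemma sqr_normcD (z w : R[i]) :
  normc (z + w) ^+ 2 <= 2 * normc z ^+ 2 + 2 * normc w ^+ 2.
Proof.
apply: (@le_trans _ _ ((normc z + normc w) ^+ 2)).
  by rewrite ler_pXn2r ?nnegrE ?addr_ge0 ?normc_ge0 ?le_normcD.
have := sqr_ge0 (normc z - normc w); rewrite sqrrB sqrrD; lra.
Qed.

Lemma sqL2D f g : cmeasurable setT f -> cmeasurable setT g ->
  (sqL2 (fun x => f x + g x)%R <= 2%:E * sqL2 f + 2%:E * sqL2 g)%E.
Proof.
move=> mf mg; rewrite /sqL2 -!ge0_integralZl//; last 4 first.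
- exact: measurable_normc2.
- by move=> x _; rewrite lee_fin sqr_ge0.
- exact: measurable_normc2.
- by move=> x _; rewrite lee_fin sqr_ge0.
rewrite -ge0_integralD//; last 4 first.
- by move=> x _; rewrite mule_ge0 ?lee_fin ?sqr_ge0.
- by apply: measurable_funeM; exact: measurable_normc2.
- by move=> x _; rewrite mule_ge0 ?lee_fin ?sqr_ge0.
- by apply: measurable_funeM; exact: measurable_normc2.
apply: ge0_le_integral => //.
- by move=> x _; rewrite lee_fin sqr_ge0.
- by apply: measurable_normc2 => //; exact: cmeasurableD.
- by apply: emeasurable_funD; apply: measurable_funeM; exact: measurable_normc2.
- by move=> x _; rewrite -!EFinM -EFinD lee_fin sqr_normcD.
Qed.

Lemma memL2D f g : memL2 f -> memL2 g -> memL2 (fun x => f x + g x).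
Proof.
move=> [mf foo] [mg goo]; split; first exact: cmeasurableD.
apply: le_lt_trans (sqL2D mf mg) _.
by rewrite lte_add_pinfty// lte_mul_pinfty// lee_fin.
Qed.

Lemma memL2B f g : memL2 f -> memL2 g -> memL2 (fun x => f x - g x).
Proof.
move=> f2 g2; rewrite (_ : (fun _ => _) = fun x => f x + (-1) * g x).
  by apply: memL2D => //; exact: memL2Z.
by apply/funext => x; rewrite mulN1r.
Qed.

Lemma memL2J f : memL2 f -> memL2 (fun x => (f x)^*%C).
Proof.
move=> f2; apply: (memL2_le _ f2); last by move=> x; rewrite normcJ.
by apply: cmeasurableJ; case: f2.
Qed.

Lemma memL2M_expi f (g : Rn R n -> R) : memL2 f -> measurable_fun setT g ->
  memL2 (fun x => expi (g x) * f x).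
Proof.
move=> f2 mg; apply: (memL2_le _ f2); last first.
  by move=> x; rewrite normcM normc_expi mul1r.
by apply: cmeasurableM; [exact: cmeasurable_expi|case: f2].
Qed.

(** Young's inequality with a free scale [c]: letting [c] vary replaces the
Cauchy-Schwarz inequality in limit arguments. *)
Lemma integral_normcM f g (c : R) : 0 < c ->
  cmeasurable setT f -> cmeasurable setT g ->
  (\int[mu]_x (normc (f x * g x))%:E <= c%:E * sqL2 f + c^-1%:E * sqL2 g)%E.
Proof.
move=> c0 mf mg; rewrite /sqL2 -!ge0_integralZl//; last 6 first.
- exact: measurable_normc2.
- by move=> x _; rewrite lee_fin sqr_ge0.
- by rewrite lee_fin invr_ge0 ltW.
- exact: measurable_normc2.
- by move=> x _; rewrite lee_fin sqr_ge0.
- by rewrite lee_fin ltW.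
rewrite -ge0_integralD//; last 4 first.
- by move=> x _; rewrite mule_ge0 ?lee_fin ?sqr_ge0// ltW.
- by apply: measurable_funeM; exact: measurable_normc2.
- by move=> x _; rewrite mule_ge0 ?lee_fin ?sqr_ge0// invr_ge0 ltW.
- by apply: measurable_funeM; exact: measurable_normc2.
apply: ge0_le_integral => //.
- by move=> x _; rewrite lee_fin normc_ge0.
- by apply: measurable_normcE => //; exact: cmeasurableM.
- by apply: emeasurable_funD; apply: measurable_funeM; exact: measurable_normc2.
- move=> x _; rewrite -!EFinM -EFinD lee_fin normcM.
  set a := normc _; set b := normc _.
  have a0 : 0 <= a by exact: normc_ge0.
  have b0 : 0 <= b by exact: normc_ge0.
  have := sqr_ge0 (c * a - b); rewrite -subr_ge0 => h.
  have -> : c * a ^+ 2 + c^-1 * b ^+ 2 - a * b = c^-1 * ((c * a - b) ^+ 2 + c * (a * b)).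
    by field; rewrite gt_eqF.
  by rewrite mulr_ge0 ?invr_ge0 ?(ltW c0)// addr_ge0 ?sqr_ge0// mulr_ge0 ?(ltW c0)// mulr_ge0.
Qed.

Lemma cintegrableM f g : memL2 f -> memL2 g -> memL1 (fun x => f x * g x).
Proof.
move=> [mf foo] [mg goo]; apply/cintegrableP => //; split; first exact: cmeasurableM.
apply: le_lt_trans (integral_normcM ltr01 mf mg) _.
by rewrite lte_add_pinfty// lte_mul_pinfty// lee_fin// invr_ge0.
Qed.

Lemma cvg_cintegralM (f_ : nat -> Rn R n -> R[i]) f g :
  (forall k, memL2 (f_ k)) -> memL2 f -> memL2 g -> L2cvg f_ f ->
  ccvg (fun k => cintegral mu setT (fun x => f_ k x * g x))
       (cintegral mu setT (fun x => f x * g x)).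
Proof.
move=> f_2 f2 g2 ff; rewrite /ccvg; apply/cvgrPdist_le => e e0.
have gfin := sqL2_fin g2; pose G := fine (sqL2 g).
have G0 : 0 <= G by apply: fine_ge0; exact: sqL2_ge0.
(* This scale makes the term that does not tend to 0 at most [e / 2]. *)
pose c := 2 * (G + 1) / e.
have c0 : 0 < c by rewrite divr_gt0// mulr_gt0// ltr_wpDl.
have ec0 : 0 < e / 2 / c by rewrite divr_gt0// divr_gt0.
have : \forall k \near \oo, (sqL2 (fun x => f_ k x - f x)%R < (e / 2 / c)%:E)%E.
  move: ff => /fine_cvgP[fin /cvgrPdist_lt /(_ _ ec0) h].
  near=> k; have : `|0 - fine (sqL2 (fun x => f_ k x - f x))| < e / 2 / c.
    by near: k.
  rewrite sub0r normrN ger0_norm ?fine_ge0 ?sqL2_ge0// -lte_fin fineK//.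
  by near: k.
move=> h; near=> k; rewrite sub0r normrN ger0_norm ?normc_ge0//.
have fk2 : memL2 (fun x => f_ k x - f x) by exact: memL2B.
rewrite -cintegralB//; last 2 first.
- exact: cintegrableM.
- exact: cintegrableM.
rewrite (@eq_cintegral _ _ _ mu setT (fun x => (f_ k x - f x) * g x)); last first.
  by move=> x _; rewrite mulrBl.
rewrite -lee_fin.
apply: le_trans (le_normc_cintegral measurableT (cintegrableM fk2 g2)) _.
apply: le_trans (integral_normcM c0 (proj1 fk2) (proj1 g2)) _.
rewrite -(fineK gfin) -/G (splitr e) EFinD leeD//.
  rewrite muleC -lee_pdivlMr// -EFinM; apply: ltW; near: k; exact: h.
rewrite -EFinM lee_fin /c invf_div mulrAC ler_pdivrMr ?mulr_gt0 ?ltr_wpDl//.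
by rewrite (_ : e / 2 * _ = e * G + e) ?lerDl ?ltW//; field.
Unshelve. all: by end_near. Qed.

Lemma L2cvgJ (f_ : nat -> Rn R n -> R[i]) f : L2cvg f_ f ->
  L2cvg (fun k x => (f_ k x)^*%C) (fun x => (f x)^*%C).
Proof.
rewrite /L2cvg; have -> // : (fun k => \int[mu]_t (normc (f_ k t - f t) ^+ 2)%:E)%E =
  (fun k => \int[mu]_t (normc ((f_ k t)^*%C - (f t)^*%C) ^+ 2)%:E)%E.
apply/funext => k; apply: eq_integral => x _.
by rewrite -(@normcJ _ (f_ k x - f x)) rmorphB.
Qed.

End square_integrable.

(** * Fourier integrals and Abel summation *)

Section fourier_integral.
Context {R : realType} (n : nat).
Local Notation mu := (lebesgue_Rn R n).
Local Notation lam := (@lebesgue_measure R).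
Implicit Types f g H X : Rn R n -> R[i].

Lemma dotpC (x y : Rn R n) : dotp x y = dotp y x.
Proof. by apply: eq_bigr => i _; rewrite mulrC. Qed.

Lemma measurable_dotp d (T : measurableType d) (f g : T -> Rn R n) :
  measurable_fun setT f -> measurable_fun setT g ->
  measurable_fun setT (fun x => dotp (f x) (g x)).
Proof.
move=> mf mg; apply: measurable_sum => i; apply: measurable_funM.
  by apply: (measurableT_comp (measurable_tnth i)).
by apply: (measurableT_comp (measurable_tnth i)).
Qed.

(** The frequency scale [s] is kept as a parameter: the fractional transform of
angle [alpha] is [FT (- csc alpha)] up to chirps, and [FT (- s)] inverts [FT s]
up to a constant. *)
Definition FT (s : R) H : Rn R n -> R[i] :=
  fun u => cintegral mu setT (fun t => H t * expi (s * dotp t u)).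

Lemma cmeasurable_kernel (s : R) H : cmeasurable setT H ->
  cmeasurable setT (fun p : Rn R n * Rn R n => H p.2 * expi (s * dotp p.2 p.1)).
Proof.
move=> mH; apply: cmeasurableM => //.
  by apply: (cmeasurable_comp mH); exact: measurable_snd.
by apply: cmeasurable_expi; apply: measurable_funM => //; exact: measurable_dotp.
Qed.

Lemma cmeasurable_FT (s : R) H : cmeasurable setT H -> cmeasurable setT (FT s H).
Proof. by move=> mH; exact: (cmeasurable_cintegral mu (cmeasurable_kernel s mH)). Qed.

Lemma cintegrable_kernel (s : R) H u : memL1 H ->
  memL1 (fun t => H t * expi (s * dotp t u)).
Proof.
move=> H1; apply: (cintegrable_lec _ _ H1) => //; last first.
  by move=> t _; rewrite normcM normc_expi mulr1.
apply: cmeasurableM => //; first exact: (cintegrable_measurable H1).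
by apply: cmeasurable_expi; apply: measurable_funM => //; exact: measurable_dotp.
Qed.

Definition nL1 H : R := fine (\int[mu]_t (normc (H t))%:E)%E.

Lemma normc_FT (s : R) H u : memL1 H -> normc (FT s H u) <= nL1 H.
Proof.
move=> H1; have /cintegrableP[//|_ Hoo] := H1.
rewrite -lee_fin /nL1 fineK; last first.
  by rewrite ge0_fin_numE//; apply: integral_ge0 => t _; rewrite lee_fin normc_ge0.
apply: le_trans (le_normc_cintegral measurableT (cintegrable_kernel s u H1)) _.
rewrite le_eqVlt; apply/orP; left; apply/eqP; apply: eq_integral => t _.
by rewrite normcM normc_expi mulr1.
Qed.

Lemma cintegrable_FTM (s : R) H X : memL1 H -> memL1 X ->
  memL1 (fun u => FT s H u * X u).
Proof.
move=> H1 X1; apply: (@cintegrable_le _ _ _ _ _ measurableT _ (fun u => normc (((nL1 H)%:C)%C * X u))) => //.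
- by apply: cmeasurableM => //; [apply: cmeasurable_FT; exact: cintegrable_measurable H1|
    exact: cintegrable_measurable X1].
- apply: integrable_normc => //; exact: cintegrableZ.
- move=> u _; rewrite !normcM normc_real ler_wpM2r ?normc_ge0//.
  by rewrite (le_trans (normc_FT _ _ H1))// ler_norm.
Qed.

(** Fubini, the kernel being symmetric in its two arguments. *)
Lemma FT_pairing (s : R) H X : memL1 H -> memL1 X ->
  cintegral mu setT (fun u => FT s H u * X u) =
  cintegral mu setT (fun t => H t * FT s X t).
Proof.
move=> H1 X1; have /cintegrableP[//|mH Hoo] := H1; have /cintegrableP[//|mX Xoo] := X1.
pose K (p : Rn R n * Rn R n) := X p.1 * (H p.2 * expi (s * dotp p.2 p.1)).
have mK : cmeasurable setT K.
  apply: cmeasurableM => //; last exact: cmeasurable_kernel.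
  by apply: (cmeasurable_comp mX); exact: measurable_fst.
have Koo : (\int[mu]_u \int[mu]_t (normc (K (u, t)))%:E < +oo)%E.
  rewrite [ltLHS](_ : _ = (\int[mu]_u (normc (X u))%:E) * \int[mu]_t (normc (H t))%:E)%E.
    rewrite lte_mul_pinfty//.
    - by apply: integral_ge0 => t _; rewrite lee_fin normc_ge0.
    - rewrite ge0_fin_numE//; by apply: integral_ge0 => t _; rewrite lee_fin normc_ge0.
  rewrite -ge0_integralZr//; last 3 first.
  - exact: measurable_normcE.
  - by move=> t _; rewrite lee_fin normc_ge0.
  - by apply: integral_ge0 => t _; rewrite lee_fin normc_ge0.
  apply: eq_integral => u _; rewrite -ge0_integralZl//; last 3 first.
  - exact: measurable_normcE.
  - by move=> t _; rewrite lee_fin normc_ge0.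
  - by rewrite lee_fin normc_ge0.
  by apply: eq_integral => t _; rewrite /K /= !normcM normc_expi mulr1 EFinM.
transitivity (cintegral mu setT (fun u => cintegral mu setT (fun t => K (u, t)))).
  apply: eq_cintegral => u _; rewrite mulrC -cintegralZ//.
  exact: cintegrable_kernel.
rewrite (cFubini mK Koo); apply: eq_cintegral => t _.
rewrite -cintegralZ//; last exact: cintegrable_kernel.
by apply: eq_cintegral => u _; rewrite /K /= mulrCA dotpC.
Qed.

Lemma FTJ (s : R) H u : memL1 H ->
  ((FT s H u)^*)%C = FT (- s) (fun t => (H t)^*%C) u.
Proof.
move=> H1; rewrite /FT -cintegralJ//; last exact: cintegrable_kernel.
by apply: eq_cintegral => t _; rewrite conjM expiJ mulNr.
Qed.

(** Abel weights: integrable, bounded by 1, increasing to 1 as [e] tends to 0,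
with an explicit nonnegative Fourier transform. *)
Definition weight (e : R) (b : Rn R n) : R := \prod_(i < n) abel e (tnth b i).

(** The Fourier transform of [weight e], evaluated at [s (t - v)]. *)
Definition poisson_kernel (e s : R) (t v : Rn R n) : R :=
  \prod_(i < n) poisson e (s * ((tnth t i : R) - (tnth v i : R))).

Lemma weight_ge0 e b : 0 <= weight e b.
Proof. by apply: prodr_ge0 => i _; exact: abel_ge0. Qed.

Lemma weight_le1 e b : 0 < e -> weight e b <= 1.
Proof.
move=> e0; apply: prodr_ile1 => i _; rewrite abel_ge0 /abel -expR0 ler_expR.
by rewrite mulNr oppr_le0 mulr_ge0// ltW.
Qed.

Lemma measurable_weight e : measurable_fun setT (weight e).
Proof.
apply: measurable_prod => i _; apply: (measurableT_comp (measurable_abel e)).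
exact: measurable_tnth.
Qed.

Lemma poisson_kernel_ge0 e s t v : 0 < e -> 0 <= poisson_kernel e s t v.
Proof. by move=> e0; apply: prodr_ge0 => i _; exact: poisson_ge0. Qed.

Lemma poisson_kernelC e s t v : poisson_kernel e s t v = poisson_kernel e s v t.
Proof.
apply: eq_bigr => i _; rewrite /poisson; congr (_ / (_ + _)).
by rewrite -sqrrN -mulrN opprB.
Qed.

Lemma measurable_poisson_kernel d (T : measurableType d) e s (f g : T -> Rn R n) :
  0 < e -> measurable_fun setT f -> measurable_fun setT g ->
  measurable_fun setT (fun x => poisson_kernel e s (f x) (g x)).
Proof.
move=> e0 mf mg; apply: measurable_prod => i _.
apply: (measurableT_comp (measurable_poisson e0)); apply: measurable_funM => //.
apply: measurable_funB.
  by apply: (measurableT_comp (measurable_tnth i)).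
by apply: (measurableT_comp (measurable_tnth i)).
Qed.

Lemma expi_sum m (a : 'I_m -> R) : expi (\sum_(i < m) a i) = \prod_(i < m) expi (a i).
Proof. exact: (big_morph _ (@expiD R) (@expi0 R)). Qed.

Lemma real_prodC m (a : 'I_m -> R) :
  ((\prod_(i < m) a i)%:C)%C = \prod_(i < m) ((a i)%:C)%C.
Proof. exact: rmorph_prod. Qed.

(** All factors split over the coordinates, which reduces the Fourier transform of
the weight to dimension one. *)
Lemma weight_tensorE e (s : R) (t v b : Rn R n) :
  ((weight e b)%:C)%C * expi (s * dotp b t) * expi (- s * dotp b v) =
  ctensor (fun i u => ((abel e u)%:C)%C *
    expi ((s * ((tnth t i : R) - (tnth v i : R))) * u)) b.
Proof.
rewrite /ctensor big_split /= -real_prodC -mulrA -expiD; congr (_ * _).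
rewrite -expi_sum; congr expi; rewrite /dotp !mulr_sumr -big_split /=.
by apply: eq_bigr => i _; ring.
Qed.

Lemma weight_fourier e (s : R) (t v : Rn R n) : 0 < e ->
  memL1 (fun b => ((weight e b)%:C)%C * expi (s * dotp b t) * expi (- s * dotp b v)) /\
  cintegral mu setT
    (fun b => ((weight e b)%:C)%C * expi (s * dotp b t) * expi (- s * dotp b v)) =
  ((poisson_kernel e s t v)%:C)%C.
Proof.
move=> e0.
have -> : (fun b => ((weight e b)%:C)%C * expi (s * dotp b t) * expi (- s * dotp b v)) =
  ctensor (fun i u => ((abel e u)%:C)%C *
    expi ((s * ((tnth t i : R) - (tnth v i : R))) * u)).
  by apply/funext => b; exact: weight_tensorE.
have ai i := abel_fourier (s * ((tnth t i : R) - (tnth v i : R))) e0.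
split; first by apply: cintegrable_tensor => i; have [] := ai i.
rewrite cintegral_tensor; last by move=> i; have [] := ai i.
rewrite /poisson_kernel real_prodC; apply: eq_bigr => i _.
by have [] := ai i.
Qed.

Lemma memL1_weight_expi e (s : R) (t : Rn R n) : 0 < e ->
  memL1 (fun b => ((weight e b)%:C)%C * expi (s * dotp b t)).
Proof.
move=> e0; have [w1 _] := weight_fourier s t t e0.
apply: (cintegrable_lec _ _ w1) => //; last first.
  by move=> b _; rewrite [leRHS]normcM normc_expi mulr1.
apply: cmeasurableM => //.
  by apply: cmeasurable_real; exact: measurable_weight.
by apply: cmeasurable_expi; apply: measurable_funM => //; exact: measurable_dotp.
Qed.

Lemma memL1_weight e : 0 < e -> memL1 (fun b => ((weight e b)%:C)%C).
Proof.
move=> e0; have w1 := memL1_weight_expi 0 [tuple (0 : R) | _ < n] e0.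
apply: (cintegrable_lec _ _ w1) => //; last first.
  by move=> b _; rewrite [leRHS]normcM normc_expi mulr1.
by apply: cmeasurable_real; exact: measurable_weight.
Qed.

Lemma FT_weight e s (t v : Rn R n) : 0 < e ->
  FT (- s) (fun b => ((weight e b)%:C)%C * expi (s * dotp b t)) v =
  ((poisson_kernel e s t v)%:C)%C.
Proof. by move=> e0; have [_ <-] := weight_fourier s t v e0. Qed.

Lemma memL1_weight_FT e s X : 0 < e -> memL1 X ->
  memL1 (fun b => ((weight e b)%:C)%C * FT (- s) X b).
Proof.
move=> e0 X1; have := cintegrable_FTM (- s) X1 (memL1_weight e0).
by congr cintegrable; apply/funext => b; rewrite mulrC.
Qed.

Lemma FT_weight_FT e s X t : 0 < e -> memL1 X ->
  FT s (fun b => ((weight e b)%:C)%C * FT (- s) X b) t =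
  cintegral mu setT (fun v => X v * ((poisson_kernel e s t v)%:C)%C).
Proof.
move=> e0 X1; transitivity (cintegral mu setT (fun b => FT (- s) X b *
    (((weight e b)%:C)%C * expi (s * dotp b t)))).
  by apply: eq_cintegral => b _; rewrite mulrA [_ * FT _ _ _]mulrC -mulrA.
rewrite FT_pairing//; last exact: memL1_weight_expi.
by apply: eq_cintegral => v _; rewrite FT_weight.
Qed.

(** Inserting an Abel weight turns the composition of the two transforms into
the convolution with the Poisson kernel. *)
Lemma abel_inversion e s H X : 0 < e -> memL1 H -> memL1 X ->
  cintegral mu setT (fun b => FT s H b * (((weight e b)%:C)%C * FT (- s) X b)) =
  cintegral mu setT (fun t => H t *
    cintegral mu setT (fun v => X v * ((poisson_kernel e s t v)%:C)%C)).
Proof.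
move=> e0 H1 X1; rewrite (FT_pairing s H1 (memL1_weight_FT s e0 X1)).
by apply: eq_cintegral => t _; rewrite FT_weight_FT.
Qed.

(** The factor by which [FT s] multiplies squared norms; it is also the mass of
every Poisson kernel, whatever [e]. *)
Definition planch (s : R) : R := (2 * pi / `|s|) ^+ n.

Lemma planch_gt0 s : s != 0 -> 0 < planch s.
Proof.
by move=> s0; rewrite exprn_gt0// divr_gt0 ?mulr_gt0 ?pi_gt0 ?normr_gt0.
Qed.

Lemma planchN s : planch (- s) = planch s.
Proof. by rewrite /planch normrN. Qed.

Definition poisson_unit (y : Rn R n) : R := \prod_(i < n) poisson 1 (tnth y i).

Lemma poisson_unit_ge0 y : 0 <= poisson_unit y.
Proof. by apply: prodr_ge0 => i _; exact: poisson_ge0. Qed.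

Lemma measurable_poisson_unit : measurable_fun setT poisson_unit.
Proof.
apply: measurable_prod => i _; apply: (measurableT_comp (measurable_poisson ltr01)).
exact: measurable_tnth.
Qed.

Lemma integral_poisson_unit : (\int[mu]_y (poisson_unit y)%:E = ((2 * pi) ^+ n)%:E)%E.
Proof.
rewrite (ge0_integral_tensor (f := fun _ => poisson 1)).
- rewrite (eq_bigr (fun=> (2 * pi)%:E)); last by move=> i _; exact: integral_poisson.
  by rewrite prodEFin prodr_const card_ord.
- by move=> i; exact: measurable_poisson.
- by move=> i x; exact: poisson_ge0.
Qed.

(** The substitution [v = t - (e / s) y] turns every Poisson kernel into the
kernel with [e = 1], up to a constant. *)
Definition recenter (e s : R) (t y : Rn R n) : Rn R n :=
  affine_map [tuple - (e / s) | _ < n] t y.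

Lemma absp_cst (c : R) : absp [tuple c | _ < n] = `|c| ^+ n :> R.
Proof.
rewrite /absp (eq_bigr (fun=> c)); last by move=> i _; rewrite tnth_mktuple.
by rewrite prodr_const card_ord normrX.
Qed.

Lemma Rn0_cst (c : R) : c != 0 -> Rn0 R n [tuple c | _ < n].
Proof. by move=> c0; rewrite /Rn0 /= absp_cst expf_neq0// normr_eq0. Qed.

Lemma poisson_kernel_recenter e s t y : 0 < e -> s != 0 ->
  absp [tuple - (e / s) | _ < n] * poisson_kernel e s t (recenter e s t y) =
  (`|s|^-1) ^+ n * poisson_unit y.
Proof.
move=> e0 s0; rewrite absp_cst normrN normrM (gtr0_norm e0) normfV exprMn -mulrA mulrCA.
congr (_ * _); rewrite -[X in X ^+ _]/e.
rewrite -[n in e ^+ n]card_ord -prodr_const -big_split /=; apply: eq_bigr => i _.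
rewrite !tnth_mktuple /poisson expr1n.
have -> : s * ((tnth t i : R) - (- (e / s) * tnth y i + tnth t i)) = e * tnth y i.
  by field.
have d0 : 1 + (tnth y i : R) ^+ 2 != 0 by rewrite gt_eqF// ltr_wpDr ?sqr_ge0.
field; rewrite d0 /=.
by rewrite exprMn -[X in X + _]mulr1 -mulrDr mulf_neq0// expf_neq0// gt_eqF.
Qed.

Lemma integral_poisson_kernel e s t : 0 < e -> s != 0 ->
  (\int[mu]_v (poisson_kernel e s t v)%:E = (planch s)%:E)%E.
Proof.
move=> e0 s0.
have es0 : - (e / s) != 0 by rewrite oppr_eq0 mulf_neq0 ?invr_eq0// gt_eqF.
rewrite (ge0_integral_affine_map t (Rn0_cst es0)); last 2 first.
- by apply/measurable_EFinP; exact: measurable_poisson_kernel.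
- by move=> v; rewrite lee_fin poisson_kernel_ge0.
rewrite -ge0_integralZl//; last 3 first.
- apply/measurable_EFinP; apply: measurable_poisson_kernel => //.
  exact: measurable_affine_map.
- by move=> v _; rewrite lee_fin poisson_kernel_ge0.
- by rewrite lee_fin normr_ge0.
transitivity (((`|s|^-1) ^+ n)%:E * \int[mu]_y (poisson_unit y)%:E)%E.
  rewrite -ge0_integralZl//; last 2 first.
  - by apply/measurable_EFinP; exact: measurable_poisson_unit.
  - by move=> y _; rewrite lee_fin poisson_unit_ge0.
  apply: eq_integral => y _; rewrite -!EFinM; congr EFin.
  exact: poisson_kernel_recenter.
by rewrite integral_poisson_unit -EFinM -exprMn mulrC.
Qed.

End fourier_integral.

(** * Boundedness of the Fourier transform and inversion on boxes *)

Section limit_tools.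
Context {R : realType}.

Lemma limn_einf_le (u : (\bar R)^nat) (c : \bar R) :
  (\forall k \near \oo, (u k <= c)%E) -> (limn_einf u <= c)%E.
Proof.
move=> uc; rewrite limn_einf_lim; apply: lime_le; first exact: is_cvg_einfs.
near=> k; apply: (@le_trans _ _ (u k)); last by near: k.
by apply: ereal_inf_lbound; exists k => //=.
Unshelve. all: by end_near. Qed.

Lemma fatou_le d (T : measurableType d) (mu : {measure set T -> \bar R})
    (f_ : nat -> T -> R) (f : T -> R) (c : \bar R) :
  (forall k, measurable_fun setT (f_ k)) -> (forall k x, 0 <= f_ k x) ->
  (forall x, (fun k => f_ k x) @ \oo --> f x) ->
  (\forall k \near \oo, (\int[mu]_x (f_ k x)%:E <= c)%E) ->
  (\int[mu]_x (f x)%:E <= c)%E.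
Proof.
move=> mf f0 ff fc.
apply: le_trans (limn_einf_le fc).
rewrite [leLHS](_ : _ = \int[mu]_x limn_einf (fun k => (f_ k x)%:E))%E; last first.
  apply: eq_integral => x _; apply/esym.
  have : (fun k => (f_ k x)%:E) @ \oo --> (f x)%:E.
    by apply/fine_cvgP; split; [exact: nearW|exact: ff].
  by move/cvg_limn_einf_sup => [].
apply: (fatou mu measurableT (f := fun k x => (f_ k x)%:E)).
  by move=> k; apply/measurable_EFinP; exact: mf.
by move=> k x _; rewrite lee_fin f0.
Qed.

Lemma ccvgZ (u : nat -> R[i]) l c : ccvg u l -> ccvg (fun k => c * u k) (c * l).
Proof.
move=> ul; apply: (@ccvg_le _ _ _ (fun k => normc c * normc (u k - l))).
  by move=> k; rewrite -mulrBr normcM.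
by rewrite -[X in _ --> X](mulr0 (normc c)); apply: cvgM => //; exact: cvg_cst.
Qed.

Lemma ccvg_real (r : nat -> R) (l : R) : r @ \oo --> l ->
  ccvg (fun k => ((r k)%:C)%C) ((l%:C)%C).
Proof.
by move=> rl; apply/ccvgE; split => /=; [exact: rl|exact: cvg_cst].
Qed.

Lemma ccvg_near (u : nat -> R[i]) l : (\forall k \near \oo, u k = l) -> ccvg u l.
Proof.
move=> ul; rewrite /ccvg; apply: cvg_near_cst.
by near=> k; rewrite (_ : u k = l) ?subrr ?normc0//; near: k.
Unshelve. all: by end_near. Qed.

(** Away from the endpoints, membership in a half-open interval is stable under
small perturbations. *)
Lemma near_itv (x : nat -> R) (t p q : R) : x @ \oo --> t -> t != p -> t != q ->
  \forall k \near \oo, (p < x k <= q) = (p < t <= q).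
Proof.
move=> xt tp tq.
have A : \forall k \near \oo, (p < x k) = (p < t).
  have [pt|pt|E] := ltgtP p t; last by rewrite E eqxx in tp.
    by apply: filterS (cvgr_gt _ xt _ pt) => k h; rewrite h.
  apply: filterS (cvgr_lt _ xt _ pt) => k xp.
  by apply/negbTE; rewrite -leNgt ltW.
have B : \forall k \near \oo, (x k <= q) = (t <= q).
  have [qt|qt|E] := ltgtP t q; last by rewrite E eqxx in tq.
    by apply: filterS (cvgr_lt _ xt _ qt) => k /ltW h; rewrite h.
  apply: filterS (cvgr_gt _ xt _ qt) => k xq.
  by apply/negbTE; rewrite -ltNge.
by near=> k; congr (_ && _); near: k.
Unshelve. all: by end_near. Qed.

End limit_tools.

Section plancherel_bound.
Context {R : realType} (n : nat).
Local Notation mu := (lebesgue_Rn R n).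
Implicit Types f g H X : Rn R n -> R[i].

Let eps (k : nat) : R := k.+1%:R^-1.

Let eps_gt0 k : 0 < eps k. Proof. by rewrite invr_gt0. Qed.

Let eps_cvg : eps @ \oo --> (0 : R).
Proof. exact: cvg_harmonic. Qed.

Lemma weightE e (b : Rn R n) : weight e b = expR (- e * \sum_(i < n) `|(tnth b i : R)|).
Proof. by rewrite mulr_sumr expR_sum. Qed.

Lemma weight_cvg (b : Rn R n) : (fun k => weight (eps k) b) @ \oo --> (1 : R).
Proof.
under eq_fun do rewrite weightE.
rewrite -(@expR0 R); apply: (@continuous_cvg _ _ _ _ _ _ (@expR R)).
  exact: continuous_expR.
rewrite -[X in _ --> X](mul0r (\sum_(i < n) `|(tnth b i : R)|)).
apply: cvgM; last exact: cvg_cst.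
by rewrite -oppr0; apply: cvgN; exact: eps_cvg.
Qed.

Lemma memL1_poisson_kernel e s X t : 0 < e -> memL1 X ->
  memL1 (fun v => X v * ((poisson_kernel e s t v)%:C)%C).
Proof.
move=> e0 X1; have := cintegrable_FTM (- s) (memL1_weight_expi s t e0) X1.
by congr cintegrable; apply/funext => v; rewrite FT_weight// mulrC.
Qed.

(** Schur's test: the product of the two moduli is at most half the sum of their
squares, and integrating the symmetric kernel in either variable gives the same
mass. *)
Lemma schur_poisson e s H : 0 < e -> s != 0 -> cmeasurable setT H ->
  (\int[mu]_t \int[mu]_v (normc (H t) * normc (H v) * poisson_kernel e s t v)%:E
   <= (planch n s)%:E * sqL2 H)%E.
Proof.
move=> e0 s0 mH.
pose A (p : Rn R n * Rn R n) := (2^-1 * normc (H p.1) ^+ 2 * poisson_kernel e s p.1 p.2)%:E.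
pose B (p : Rn R n * Rn R n) := (2^-1 * normc (H p.2) ^+ 2 * poisson_kernel e s p.1 p.2)%:E.
have mP : measurable_fun setT (fun p : Rn R n * Rn R n => poisson_kernel e s p.1 p.2).
  exact: measurable_poisson_kernel.
have mH1 : measurable_fun setT (fun p : Rn R n * Rn R n => normc (H p.1)).
  by apply: measurable_normc; apply: (cmeasurable_comp mH); exact: measurable_fst.
have mH2 : measurable_fun setT (fun p : Rn R n * Rn R n => normc (H p.2)).
  by apply: measurable_normc; apply: (cmeasurable_comp mH); exact: measurable_snd.
have mA : measurable_fun setT A.
  apply/measurable_EFinP; apply: measurable_funM => //.
  by apply: measurable_funM => //; exact: measurable_funX.
have mB : measurable_fun setT B.
  apply/measurable_EFinP; apply: measurable_funM => //.
  by apply: measurable_funM => //; exact: measurable_funX.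
have A0 p : (0 <= A p)%E.
  by rewrite lee_fin mulr_ge0 ?poisson_kernel_ge0// mulr_ge0 ?sqr_ge0.
have B0 p : (0 <= B p)%E.
  by rewrite lee_fin mulr_ge0 ?poisson_kernel_ge0// mulr_ge0 ?sqr_ge0.
have mC : measurable_fun setT (fun p : Rn R n * Rn R n =>
    (normc (H p.1) * normc (H p.2) * poisson_kernel e s p.1 p.2)%:E).
  by apply/measurable_EFinP; apply: measurable_funM => //; exact: measurable_funM.
have C0 (p : Rn R n * Rn R n) :
    (0 <= (normc (H p.1) * normc (H p.2) * poisson_kernel e s p.1 p.2)%:E)%E.
  by rewrite lee_fin mulr_ge0 ?poisson_kernel_ge0// mulr_ge0 ?normc_ge0.
rewrite -(fubini_tonelli1 (fun p : Rn R n * Rn R n =>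
    (normc (H p.1) * normc (H p.2) * poisson_kernel e s p.1 p.2)%:E))//.
apply: (@le_trans _ _ (\int[(mu \x mu)%E]_p (A p + B p))%E).
  apply: ge0_le_integral => //.
    by apply: emeasurable_funD.
  move=> p _; rewrite /A /B -EFinD lee_fin -mulrDl ler_wpM2r ?poisson_kernel_ge0//.
  have := sqr_ge0 (normc (H p.1) - normc (H p.2)); rewrite sqrrB; lra.
rewrite ge0_integralD//.
have half x : (2^-1 * normc (H x) ^+ 2)%:E = (2^-1%:E * (normc (H x) ^+ 2)%:E)%E.
  by rewrite EFinM.
have AE : (\int[(mu \x mu)%E]_p A p = (planch n s)%:E * (2^-1%:E * sqL2 H))%E.
  rewrite fubini_tonelli1// /fubini_F.
  rewrite -ge0_integralZl//; last 2 first.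
  - exact: measurable_normc2.
  - by move=> x _; rewrite lee_fin sqr_ge0.
  rewrite -ge0_integralZl//; last 3 first.
  - by apply: measurable_funeM; exact: measurable_normc2.
  - by move=> x _; rewrite mule_ge0 ?lee_fin ?sqr_ge0.
  - by rewrite lee_fin ltW// planch_gt0.
  apply: eq_integral => t _; rewrite -half muleC -(integral_poisson_kernel t e0 s0).
  rewrite -ge0_integralZl//; last 3 first.
  - by apply/measurable_EFinP; exact: measurable_poisson_kernel.
  - by move=> x _; rewrite lee_fin poisson_kernel_ge0.
  - by rewrite lee_fin mulr_ge0 ?sqr_ge0.
have BE : (\int[(mu \x mu)%E]_p B p = (planch n s)%:E * (2^-1%:E * sqL2 H))%E.
  rewrite fubini_tonelli2// /fubini_G.
  rewrite -ge0_integralZl//; last 2 first.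
  - exact: measurable_normc2.
  - by move=> x _; rewrite lee_fin sqr_ge0.
  rewrite -ge0_integralZl//; last 3 first.
  - by apply: measurable_funeM; exact: measurable_normc2.
  - by move=> x _; rewrite mule_ge0 ?lee_fin ?sqr_ge0.
  - by rewrite lee_fin ltW// planch_gt0.
  apply: eq_integral => t _; rewrite -half muleC -(integral_poisson_kernel t e0 s0).
  rewrite -ge0_integralZl//; last 3 first.
  - by apply/measurable_EFinP; exact: measurable_poisson_kernel.
  - by move=> x _; rewrite lee_fin poisson_kernel_ge0.
  - by rewrite lee_fin mulr_ge0 ?sqr_ge0.
  by apply: eq_integral => v _; rewrite /B /= poisson_kernelC -EFinM.
rewrite AE BE -muleDr; last 2 first.
- by [].
- by rewrite ge0_adde_def// inE mule_ge0 ?sqL2_ge0.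
rewrite lee_wpmul2l ?lee_fin ?(ltW (planch_gt0 n s0))//.
rewrite -[leRHS](mul1e (sqL2 H)) (_ : 1%E = (2^-1)%:E + (2^-1)%:E :> \bar R)%E.
  by rewrite ge0_muleDl ?lee_fin.
by rewrite -EFinD; congr EFin; field.
Qed.

(** With the weight inserted, the squared modulus of the transform is paired with
the Poisson convolution, to which Schur's test applies. *)
Lemma weighted_bessel e s H : 0 < e -> s != 0 -> memL1 H ->
  (\int[mu]_b (weight e b * normc (FT s H b) ^+ 2)%:E <= (planch n s)%:E * sqL2 H)%E.
Proof.
move=> e0 s0 H1; have mH := cintegrable_measurable H1.
have HJ1 := cintegrableJ measurableT H1.
pose K b := ((weight e b * normc (FT s H b) ^+ 2)%:C)%C.
have KE b : FT s H b * (((weight e b)%:C)%C * FT (- s) (fun t => (H t)^*%C) b) = K b.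
  by rewrite -FTJ// mulrCA mulJc -rmorphM.
have K1 : memL1 K.
  have := cintegrable_FTM s H1 (memL1_weight_FT s e0 HJ1).
  by congr cintegrable; apply/funext => b; rewrite KE.
have Kr : mu.-integrable setT (fun b => (weight e b * normc (FT s H b) ^+ 2)%:E).
  by case: K1.
rewrite -(fineK (integrable_fin_num measurableT Kr)).
apply: (@le_trans _ _ (normc (cintegral mu setT K))%:E).
  rewrite lee_fin (le_trans (ler_norm _))//.
  exact: (le_trans _ (abs_Re (cintegral mu setT K))).
have -> : cintegral mu setT K = cintegral mu setT (fun t => H t *
    FT s (fun b => ((weight e b)%:C)%C * FT (- s) (fun t => (H t)^*%C) b) t).
  rewrite -FT_pairing//; last exact: memL1_weight_FT.
  by apply: eq_cintegral => b _; rewrite KE.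
apply: le_trans (schur_poisson e0 s0 mH).
apply: le_trans (le_normc_cintegral measurableT _) _.
  have := cintegrable_FTM s (memL1_weight_FT s e0 HJ1) H1.
  by congr cintegrable; apply/funext => b; rewrite mulrC.
have mpk : measurable_fun setT (fun p : Rn R n * Rn R n =>
    (normc (H p.1) * normc (H p.2) * poisson_kernel e s p.1 p.2)%:E).
  apply/measurable_EFinP; apply: measurable_funM; last exact: measurable_poisson_kernel.
  apply: measurable_funM; apply: measurable_normc => //; apply: (cmeasurable_comp mH).
    exact: measurable_fst.
  exact: measurable_snd.
apply: ge0_le_integral => //.
- by move=> t _; rewrite lee_fin normc_ge0.
- apply: measurable_normcE => //; apply: cmeasurableM => //; apply: cmeasurable_FT.
  exact: (cintegrable_measurable (memL1_weight_FT s e0 HJ1)).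
- apply: (measurable_fun_fubini_tonelli_F (fun p : Rn R n * Rn R n =>
    (normc (H p.1) * normc (H p.2) * poisson_kernel e s p.1 p.2)%:E)) => // p.
  by rewrite lee_fin mulr_ge0 ?poisson_kernel_ge0// mulr_ge0 ?normc_ge0.
- move=> t _; rewrite FT_weight_FT// normcM EFinM.
  apply: (@le_trans _ _ ((normc (H t))%:E *
    \int[mu]_v (normc (H v) * poisson_kernel e s t v)%:E)%E).
    rewrite lee_wpmul2l ?lee_fin ?normc_ge0//.
    apply: le_trans (le_normc_cintegral measurableT (memL1_poisson_kernel s t e0 HJ1)) _.
    rewrite le_eqVlt; apply/orP; left; apply/eqP; apply: eq_integral => v _.
    by rewrite normcM normcJ normc_real ger0_norm// poisson_kernel_ge0.
  rewrite -ge0_integralZl//; last 3 first.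
  - apply/measurable_EFinP; apply: measurable_funM; first exact: measurable_normc.
    exact: measurable_poisson_kernel.
  - by move=> v _; rewrite lee_fin mulr_ge0 ?normc_ge0 ?poisson_kernel_ge0.
  - by rewrite lee_fin normc_ge0.
  by rewrite le_eqVlt; apply/orP; left; apply/eqP; apply: eq_integral => v _;
    rewrite -EFinM mulrA.
Qed.

(** The weights increase to 1, so Fatou's lemma removes them. *)
Lemma bessel s H : s != 0 -> memL1 H -> (sqL2 (FT s H) <= (planch n s)%:E * sqL2 H)%E.
Proof.
move=> s0 H1; have mH := cintegrable_measurable H1.
apply: (@fatou_le _ _ _ _ (fun k b => weight (eps k) b * normc (FT s H b) ^+ 2)).
- move=> k; apply: measurable_funM; first exact: measurable_weight.
  by apply: measurable_funX; apply: measurable_normc => //; exact: cmeasurable_FT.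
- by move=> k b; rewrite mulr_ge0 ?weight_ge0 ?sqr_ge0.
- move=> b; rewrite -[X in _ --> X]mul1r; apply: cvgM; last exact: cvg_cst.
  exact: weight_cvg.
- by apply: nearW => k; exact: weighted_bessel.
Qed.

Lemma memL2_FT s H : s != 0 -> memL1 H -> memL2 H -> memL2 (FT s H).
Proof.
move=> s0 H1 [mH Hoo]; split; first exact: cmeasurable_FT.
apply: le_lt_trans (bessel s0 H1) _.
by rewrite lte_mul_pinfty// lee_fin ltW// planch_gt0.
Qed.

Definition boxfun (p q : Rn R n) : Rn R n -> R[i] := fun x => ((\1_(box p q) x)%:C)%C.

Lemma boxfun_tensor p q : boxfun p q =
  ctensor (fun i x => ((\1_(`](tnth p i : R), (tnth q i : R)]%classic) x)%:C)%C).
Proof.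
apply/funext => x; rewrite /boxfun /ctensor -real_prodC; congr (_%:C)%C.
rewrite indicE; case: (boolP (x \in box p q)) => [|xB].
  rewrite inE /= => xB; rewrite big1// => i _; rewrite indicE mem_set//=.
  by rewrite in_itv /= xB.
have : ~ (forall i, (tnth p i : R) < tnth x i <= (tnth q i : R)).
  by move=> H; move/negP : xB; apply; rewrite inE.
move/existsNP => [i /negP xi]; rewrite (bigD1 i)//= indicE memNset ?mul0r//=.
by rewrite in_itv /=; exact/negP.
Qed.

Lemma memL1_boxfun p q : memL1 (boxfun p q).
Proof.
rewrite boxfun_tensor; apply: cintegrable_tensor => i; split.
  exact: integrable_indic_itv.
rewrite (_ : _ \o _ = cst 0%E); first exact: integrable0.
by apply/funext => x.
Qed.

Lemma memL2_boxfun p q : memL2 (boxfun p q).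
Proof.
have /cintegrableP[//|mB Boo] := memL1_boxfun p q; split => //.
move: Boo; rewrite (eq_integral (fun t => (normc (boxfun p q t) ^+ 2)%:E))// => t _.
by rewrite /boxfun normc_real indicE; case: (_ \in _); rewrite ?normr1 ?normr0 ?expr1n ?expr0n.
Qed.

Lemma normc_boxfun p q x : normc (boxfun p q x) <= 1.
Proof.
by rewrite /boxfun normc_real indicE; case: (_ \in _); rewrite ?normr1 ?normr0.
Qed.

Lemma recenter_cvg s (t y : Rn R n) (i : 'I_n) :
  (fun k => (tnth (recenter (eps k) s t y) i : R)) @ \oo --> (tnth t i : R).
Proof.
have h1 : (fun k => - (eps k / s) * (tnth y i : R)) @ \oo --> (0 : R).
  rewrite -(mul0r (tnth y i : R)); apply: cvgM; last exact: cvg_cst.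
  rewrite -oppr0; apply: cvgN; rewrite -(mul0r s^-1).
  by apply: cvgM; [exact: eps_cvg|exact: cvg_cst].
have h2 : (fun k => - (eps k / s) * (tnth y i : R) + (tnth t i : R)) @ \oo
    --> (0 + (tnth t i : R)).
  by apply: cvgD => //; exact: cvg_cst.
rewrite add0r in h2.
rewrite (_ : (fun k => _) = (fun k => - (eps k / s) * (tnth y i : R) + (tnth t i : R)))//.
by apply/funext => k; rewrite /recenter /affine_map !tnth_mktuple.
Qed.

Let offboundary (p q t : Rn R n) :=
  forall i, (tnth t i : R) != tnth p i /\ (tnth t i : R) != tnth q i.

Let ae_offboundary p q : {ae mu, forall t, offboundary p q t}.
Proof.
apply: filter_forall => i.
apply: (@ae_tnth _ _ i (fun x => x != tnth p i /\ x != tnth q i)).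
exact: ae_imply2 (ae_neq (tnth p i)) (ae_neq (tnth q i)).
Qed.

Lemma poisson_approx_bound e s p q t : 0 < e -> s != 0 ->
  normc (cintegral mu setT (fun v => boxfun p q v * ((poisson_kernel e s t v)%:C)%C))
    <= planch n s.
Proof.
move=> e0 s0; rewrite -lee_fin -(integral_poisson_kernel t e0 s0).
have B1 := memL1_boxfun p q.
apply: le_trans (le_normc_cintegral measurableT (memL1_poisson_kernel s t e0 B1)) _.
apply: ge0_le_integral => //.
- by move=> v _; rewrite lee_fin normc_ge0.
- apply: measurable_normcE => //.
  exact: (cintegrable_measurable (memL1_poisson_kernel s t e0 B1)).
- by apply/measurable_EFinP; exact: measurable_poisson_kernel.
- move=> v _; rewrite lee_fin normcM normc_real (ger0_norm (poisson_kernel_ge0 _ _ _ e0)).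
  by rewrite ler_piMl ?poisson_kernel_ge0// normc_boxfun.
Qed.

(** After recentring, the mass of the kernel is spread by a fixed integrable
profile at distance of order [e] from [t]; for [t] off the boundary of the box
the indicator is locally constant, and dominated convergence applies. *)
Lemma poisson_approx s p q t : s != 0 -> offboundary p q t ->
  ccvg (fun k => cintegral mu setT
    (fun v => boxfun p q v * ((poisson_kernel (eps k) s t v)%:C)%C))
    (((planch n s)%:C)%C * boxfun p q t).
Proof.
move=> s0 tb; have B1 := memL1_boxfun p q.
pose Q (y : Rn R n) : R[i] := ((`|s|^-1 ^+ n * poisson_unit y)%:C)%C.
have c0 : 0 <= `|s|^-1 ^+ n by rewrite exprn_ge0// invr_ge0.
have Pi : mu.-integrable setT (EFin \o @poisson_unit R n).
  apply/integrableP; split; first by apply/measurable_EFinP; exact: measurable_poisson_unit.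
  rewrite [ltLHS](_ : _ = \int[mu]_y (poisson_unit y)%:E)%E.
    by rewrite integral_poisson_unit ltry.
  by apply: eq_integral => y _; rewrite /= ger0_norm ?poisson_unit_ge0.
have Qi : cintegrable mu setT Q.
  split; first exact: (rintegrableZ measurableT).
  rewrite (_ : _ \o _ = cst 0%E); first exact: integrable0.
  by apply/funext => x.
have QE : cintegral mu setT Q = ((planch n s)%:C)%C.
  apply: eqC; rewrite /cintegral /=.
    rewrite RintegralZl//.
    by rewrite /Rintegral integral_poisson_unit /= -exprMn mulrC.
  by rewrite Rintegral_cst// mul0r.
have E k : cintegral mu setT
    (fun v => boxfun p q v * ((poisson_kernel (eps k) s t v)%:C)%C) =
    cintegral mu setT (fun y => boxfun p q (recenter (eps k) s t y) * Q y).
  have es0 : - (eps k / s) != 0 by rewrite oppr_eq0 mulf_neq0 ?invr_eq0// gt_eqF.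
  have [ai ->] := cintegral_affine_map t (Rn0_cst n es0)
    (memL1_poisson_kernel s t (eps_gt0 k) B1).
  rewrite -cintegralZ//; apply: eq_cintegral => y _.
  rewrite /= mulrCA -rmorphM; congr (_ * (_%:C)%C).
  exact: poisson_kernel_recenter.
rewrite -QE mulrC -cintegralZ//.
rewrite (_ : (fun k => _) = (fun k => cintegral mu setT
  (fun y => boxfun p q (recenter (eps k) s t y) * Q y))); last exact/funext.
have mb := cintegrable_measurable B1.
have mQ := cintegrable_measurable Qi.
apply: (@cdominated_convergence _ _ _ mu setT measurableT _ _ (fun y => normc (Q y))).
- move=> k; apply: cmeasurableM => //; apply: (cmeasurable_comp mb).
  exact: measurable_affine_map.
- exact: cmeasurableZ.
- apply: aeW => y _; apply: ccvg_near.
  have : \forall k \near \oo, forall i,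
      ((tnth p i : R) < tnth (recenter (eps k) s t y) i <= (tnth q i : R)) =
      ((tnth p i : R) < tnth t i <= (tnth q i : R)).
    apply: filter_forall => i; have [tp tq] := tb i.
    have h := @near_itv R _ _ (tnth p i) (tnth q i) (@recenter_cvg s t y i) tp tq.
    exact: h.
  apply: filterS => k h; rewrite /boxfun !indicE.
  rewrite (_ : (recenter (eps k) s t y \in box p q) = (t \in box p q))//.
  by apply/idP/idP; rewrite !inE /box /= => H i; [rewrite -h|rewrite h].
- exact: integrable_normc.
- by move=> k y _; rewrite normcM ler_piMl ?normc_ge0 ?normc_boxfun.
Qed.

(** Both sides are the limit of the same weighted integrals: with the weight, the
pairing is dominated by its unweighted integrand; after [abel_inversion], it
involves the Poisson approximation of the box, bounded by [planch n s]. *)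
Lemma inversion_box s H p q : s != 0 -> memL1 H -> memL2 (FT s H) ->
  cintegral mu setT (fun b => FT s H b * FT (- s) (boxfun p q) b) =
  ((planch n s)%:C)%C * cintegral mu setT (fun t => H t * boxfun p q t).
Proof.
move=> s0 H1 F2; have B1 := memL1_boxfun p q; have B2 := memL2_boxfun p q.
have mH := cintegrable_measurable H1.
have FB2 : memL2 (FT (- s) (boxfun p q)) by apply: memL2_FT => //; rewrite oppr_eq0.
have FF1 := cintegrableM F2 FB2.
have HB1 : memL1 (fun t => H t * boxfun p q t).
  apply: (cintegrable_lec _ _ H1) => //.
    by apply: cmeasurableM => //; exact: cintegrable_measurable B1.
  by move=> t _; rewrite normcM ler_piMr ?normc_ge0 ?normc_boxfun.
rewrite -cintegralZ//.
pose u k := cintegral mu setT (fun b => FT s H b *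
   (((weight (eps k) b)%:C)%C * FT (- s) (boxfun p q) b)).
apply: (@ccvg_unique _ u).
  apply: (@cdominated_convergence _ _ _ mu setT measurableT _ _
    (fun b => normc (FT s H b * FT (- s) (boxfun p q) b))).
  - move=> k; apply: cmeasurableM => //; first by case: F2.
    apply: cmeasurableM => //; last by case: FB2.
    by apply: cmeasurable_real; exact: measurable_weight.
  - exact: cintegrable_measurable FF1.
  - apply: aeW => b _; rewrite (_ : (fun k => _) = (fun k =>
      (FT s H b * FT (- s) (boxfun p q) b) * ((weight (eps k) b)%:C)%C)); last first.
      by apply/funext => k; ring.
    rewrite -[X in ccvg _ X]mulr1; apply: ccvgZ; apply: ccvg_real.
    exact: weight_cvg.
  - exact: integrable_normc.
  - move=> k b _; rewrite !normcM ler_wpM2l ?normc_ge0// ler_piMl ?normc_ge0//.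
    by rewrite normc_real ger0_norm ?weight_ge0// weight_le1.
rewrite (_ : u = (fun k => cintegral mu setT (fun t => H t * cintegral mu setT
    (fun v => boxfun p q v * ((poisson_kernel (eps k) s t v)%:C)%C)))); last first.
  apply/funext => k; exact: abel_inversion.
have Hn := integrable_normc measurableT H1.
apply: (@cdominated_convergence _ _ _ mu setT measurableT _ _
    (fun b => planch n s * normc (H b))).
- move=> k; apply: cmeasurableM => //.
  rewrite (_ : (fun x => _) = FT s (fun b => ((weight (eps k) b)%:C)%C *
    FT (- s) (boxfun p q) b)).
    apply: cmeasurable_FT; exact: cintegrable_measurable (memL1_weight_FT s (eps_gt0 k) B1).
  by apply/funext => t; rewrite FT_weight_FT.
- by apply: cmeasurableZ => //; exact: cintegrable_measurable HB1.
- apply: (ae_imply _ (ae_offboundary p q)) => t tb _; rewrite mulrCA.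
  by apply: ccvgZ; exact: poisson_approx.
- exact: (rintegrableZ measurableT).
- move=> k t _; rewrite normcM mulrC ler_wpM2r ?normc_ge0//.
  exact: poisson_approx_bound.
Qed.

End plancherel_bound.

(** * Completeness of the square-integrable functions *)

Section riesz_fischer.
Context {R : realType} (n : nat).
Local Notation mu := (lebesgue_Rn R n).
Implicit Types f g : Rn R n -> R[i].

Lemma cvg_bounded_variation (h : nat -> R) (K : R) :
  (forall m, \sum_(0 <= j < m) `|h j.+1 - h j| <= K) -> cvgn h.
Proof.
move=> hK; have : cvgn [normed series (fun j => h j.+1 - h j)].
  apply: nondecreasing_is_cvgn.
    move=> a b ab; rewrite /series /=.
    rewrite -(subnKC ab); elim: (b - a)%N => [|c IH]; first by rewrite addn0.
    by rewrite addnS seriesSr (le_trans IH)// lerDl.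
  by exists K => _ [m _ <-]; exact: hK.
move/normed_cvg => cs.
have -> : h = (fun m => series (fun j => h j.+1 - h j) m + h 0%N).
  by apply/funext => m; rewrite /series /= telescope_sumr// subrK.
by apply: is_cvgD => //; exact: is_cvg_cst.
Qed.

Lemma ccvg_normc (u : nat -> R[i]) l : ccvg u l ->
  (fun k => normc (u k)) @ \oo --> normc l.
Proof.
move=> ul; apply/dist_cvg0; apply: (squeeze_cvgr _ (cvg_cst 0) ul).
near=> k; rewrite normr_ge0 /= ler_norml; apply/andP; split.
  rewrite lerNl opprB lerBlDr -[X in normc X](subrK (u k) l) normc_distC.
  by rewrite (le_trans (le_normcD _ _)).
by rewrite lerBlDr -[X in normc X](subrK l (u k)) (le_trans (le_normcD _ _)).
Unshelve. all: by end_near. Qed.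

Lemma ccvgBr (u : nat -> R[i]) l c : ccvg u l -> ccvg (fun k => u k - c) (l - c).
Proof.
move=> ul; rewrite /ccvg (_ : (fun k => _) = (fun k => normc (u k - l)))//.
by apply/funext => k; congr normc; ring.
Qed.

Lemma cmeasurable_ccvg (f_ : nat -> Rn R n -> R[i]) f :
  (forall k, cmeasurable setT (f_ k)) -> (forall x, ccvg (f_ ^~ x) (f x)) ->
  cmeasurable setT f.
Proof.
move=> mf ff; split.
  apply: (@measurable_fun_cvg _ _ _ _ (fun k x => complex.Re (f_ k x))).
    by move=> k; case: (mf k).
  by move=> x _; have /ccvgE[] := ff x.
apply: (@measurable_fun_cvg _ _ _ _ (fun k x => complex.Im (f_ k x))).
  by move=> k; case: (mf k).
by move=> x _; have /ccvgE[] := ff x.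
Qed.

(** Along a subsequence the increments [D j] have squared norm at most [4 ^- j].
Weighting them by [2 ^ j] keeps the sum integrable, hence finite almost
everywhere; since [a <= 2 ^- j + 2 ^ j * a ^+ 2], the subsequence then has
bounded variation at almost every point. Fatou's lemma compares the pointwise
limit with the whole sequence. *)
Lemma riesz_fischer (f_ : nat -> Rn R n -> R[i]) (tail : nat -> R) :
  (forall k, memL2 (f_ k)) -> tail @ \oo --> (0 : R) ->
  (forall j k, (k <= j)%N -> (sqL2 (fun x => f_ j x - f_ k x)%R <= (tail k)%:E)%E) ->
  exists2 F, memL2 F & L2cvg f_ F.
Proof.
move=> f2 tail0 ftail.
have /choice[N HN] : forall j, exists N, forall k, (N <= k)%N -> tail k <= 4^-1 ^+ j.
  move=> j; have q0 : (0 : R) < 4^-1 ^+ j by rewrite exprn_gt0.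
  have := cvgr_lt _ tail0 _ q0 => -[N _ H]; exists N => k Nk; apply: ltW; exact: H.
(* The sum makes the indices nondecreasing and at least [N j]; the term [j]
   makes them tend to infinity. *)
pose ph j := (j + \sum_(i < j.+1) N i)%N.
have phS j : (ph j <= ph j.+1)%N.
  by rewrite /ph leq_add// [leqRHS]big_ord_recr /= leq_addr.
have phN j : (N j <= ph j)%N.
  by rewrite /ph big_ord_recr /= addnA leq_addl.
have phj j : (j <= ph j)%N by rewrite /ph leq_addr.
pose g j := f_ (ph j).
have g2 j : memL2 (g j) by exact: f2.
pose D j x := g j.+1 x - g j x.
have mD j : cmeasurable setT (D j) by have [] := memL2B (g2 j.+1) (g2 j).
have D4 j : (sqL2 (D j) <= (4^-1 ^+ j)%:E)%E.
  by apply: (le_trans (ftail _ _ (phS j))); rewrite lee_fin; apply: HN; exact: phN.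
pose m j x := (2 ^+ j * normc (D j x) ^+ 2)%:E.
have mm j : measurable_fun setT (m j).
  apply/measurable_EFinP; apply: measurable_funM => //.
  by apply: measurable_funX; exact: measurable_normc.
have m0 j x : (0 <= m j x)%E by rewrite lee_fin mulr_ge0 ?sqr_ge0// exprn_ge0.
pose M x := (\sum_(0 <= j <oo) m j x)%E.
have mM : measurable_fun setT M by apply: ge0_emeasurable_sum.
have M0 x : (0 <= M x)%E by apply: nneseries_ge0.
have geo (k : nat) : \sum_(0 <= j < k) (2^-1 ^+ j : R) <= 2.
  have E : \sum_(0 <= j < k) (2^-1 ^+ j : R) = 2 - 2 * 2^-1 ^+ k.
    elim: k => [|k IH]; first by rewrite big_nil expr0; ring.
    by rewrite big_nat_recr//= IH exprS; field.
  by rewrite E gerBl mulr_ge0// exprn_ge0// invr_ge0.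
have Moo : (\int[mu]_x M x <= 2%:E)%E.
  rewrite integral_nneseries//.
  apply: lime_le; first by apply: is_cvg_nneseries => j _ _; exact: integral_ge0.
  apply: nearW => k; apply: (@le_trans _ _ (\sum_(0 <= j < k) (2^-1 ^+ j)%:E)%E).
    apply: lee_sum => j _.
    rewrite [leLHS](_ : _ = (2 ^+ j)%:E * sqL2 (D j))%E; last first.
      rewrite /sqL2 -ge0_integralZl//.
      - exact: measurable_normc2.
      - by move=> x _; rewrite lee_fin sqr_ge0.
    apply: (@le_trans _ _ ((2 ^+ j)%:E * (4^-1 ^+ j)%:E)%E).
      by rewrite lee_wpmul2l// lee_fin exprn_ge0.
    by rewrite -EFinM lee_fin -exprMn (_ : 2 * 4^-1 = 2^-1 :> R)//; field.
  by rewrite sumEFin lee_fin.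
pose A := [set x | (M x < +oo)%E].
have mA : measurable A by rewrite -[A]setTI; exact: emeasurable_fun_infty_o.
have aeA : {ae mu, forall x, A x}.
  have Mi : mu.-integrable setT M.
    apply/integrableP; split => //; apply: (@le_lt_trans _ _ 2%:E); last exact: ltry.
    by rewrite (eq_integral M)// => x _; rewrite gee0_abs.
  apply: (ae_imply _ (integrable_ae measurableT Mi)) => x /(_ I) Mx.
  by rewrite /A /= -ge0_fin_numE.
have bound (h : nat -> R) x : A x ->
    (forall j, `|h j.+1 - h j| <= normc (D j x)) -> cvgn h.
  move=> Ax hD; apply: (@cvg_bounded_variation _ (2 + fine (M x))) => k.
  apply: (@le_trans _ _ (\sum_(0 <= j < k) (2^-1 ^+ j + 2 ^+ j * normc (D j x) ^+ 2))).
    apply: ler_sum => j _; apply: le_trans (hD j) _.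
    set a := normc _; have a0 : 0 <= a := normc_ge0 _.
    rewrite -subr_ge0.
    have c0 : (0 : R) < 2 ^+ j by rewrite exprn_gt0.
    set c := 2 ^+ j in c0 *.
    have -> : (2^-1 : R) ^+ j = c^-1 by rewrite exprVn.
    have -> : c^-1 + c * a ^+ 2 - a = c^-1 * ((c * a - 1) ^+ 2 + c * a).
      by field; rewrite gt_eqF.
    by rewrite mulr_ge0 ?invr_ge0 ?(ltW c0)// addr_ge0 ?sqr_ge0// mulr_ge0// ltW.
  rewrite big_split /= lerD//.
  rewrite -lee_fin fineK ?ge0_fin_numE// -sumEFin.
  exact: (nneseries_lim_ge k (fun j _ _ => m0 j x)).
(* On the null set where the variation may be infinite the limit is 0. *)
pose g' j x := ((\1_A x)%:C)%C * g j x.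
have g'E x j : A x -> g' j x = g j x.
  by move=> Ax; rewrite /g' indicE mem_set// mul1r.
have g'c x : exists l, ccvg (g' ^~ x) l.
  have [xA|xA] := pselect (A x); last first.
    exists 0; rewrite (_ : g' ^~ x = fun=> 0); first exact: ccvg_cst.
    by apply/funext => j; rewrite /g' indicE memNset// mul0r.
  have c1 : cvgn (fun j => complex.Re (g' j x)).
    apply: (bound _ x) => // j; rewrite !g'E// -ReN -ReD; exact: abs_Re.
  have c2 : cvgn (fun j => complex.Im (g' j x)).
    apply: (bound _ x) => // j; rewrite !g'E// -ImN -ImD; exact: abs_Im.
  exists (limn (fun j => complex.Re (g' j x)) +i* limn (fun j => complex.Im (g' j x)))%C.
  by apply/ccvgE; split.
have [F g'F] := choice g'c.
have mg' j : cmeasurable setT (g' j).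
  apply: cmeasurableM => //; last by case: (g2 j).
  by apply: cmeasurable_real; exact: measurable_indic.
have mF : cmeasurable setT F by apply: (cmeasurable_ccvg mg').
have Fk k : (sqL2 (fun x => F x - f_ k x)%R <= (tail k)%:E)%E.
  have mfk : cmeasurable setT (f_ k) by case: (f2 k).
  apply: (@fatou_le _ _ _ _ (fun j x => normc (g' j x - f_ k x) ^+ 2)).
  - by move=> j; apply: measurable_funX; apply: measurable_normc => //; exact: cmeasurableB.
  - by move=> j x; exact: sqr_ge0.
  - move=> x; have cn : (fun j => normc (g' j x - f_ k x)) @ \oo --> normc (F x - f_ k x).
      by apply: ccvg_normc; exact: ccvgBr.
    under eq_fun do rewrite expr2.
    by rewrite expr2; apply: cvgM.
  - near=> j; have kj : (k <= ph j)%N.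
      by apply: leq_trans (phj j); near: j; exact: nbhs_infty_ge.
    apply: le_trans (ftail _ _ kj); rewrite le_eqVlt; apply/orP; left; apply/eqP.
    apply: ge0_ae_eq_integral => //.
    + by apply: measurable_normc2 => //; exact: cmeasurableB.
    + by apply: measurable_normc2 => //; apply: cmeasurableB => //; case: (g2 j).
    + by move=> x _; rewrite lee_fin sqr_ge0.
    + by move=> x _; rewrite lee_fin sqr_ge0.
    + by apply: (ae_imply _ aeA) => x Ax _; rewrite g'E.
have F2 : memL2 F.
  have h : memL2 (fun x => F x - f_ 0%N x).
    split; last by apply: le_lt_trans (Fk 0%N) _; exact: ltry.
    by apply: cmeasurableB => //; case: (f2 0%N).
  have := memL2D h (f2 0%N); congr memL2; apply/funext => x; exact: subrK.
exists F => //; rewrite /L2cvg.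
apply: (@squeeze_cvge _ _ _ _ (cst 0%E) _ (fun k => (tail k)%:E)).
- apply: nearW => k; rewrite /cst; apply/andP; split.
    by apply: integral_ge0 => x _; rewrite lee_fin sqr_ge0.
  apply: le_trans (Fk k); rewrite le_eqVlt; apply/orP; left; apply/eqP.
  by apply: eq_sqL2 => x; exact: normc_distC.
- exact: cvg_cst.
- by apply/fine_cvgP; split; [exact: nearW|exact: tail0].
Unshelve. all: by end_near. Qed.

End riesz_fischer.

(** * The Fourier transform of square-integrable functions *)

Section fourier_L2.
Context {R : realType} (n : nat).
Local Notation mu := (lebesgue_Rn R n).
Implicit Types f g F G H X : Rn R n -> R[i].

Lemma sqL2J f : memL2 f ->
  cintegral mu setT (fun x => f x * (f x)^*%C) = ((fine (sqL2 f))%:C)%C.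
Proof.
move=> f2; rewrite (@eq_cintegral _ _ _ mu setT (fun x => ((normc (f x) ^+ 2)%:C)%C)).
  by apply: eqC => //; rewrite /cintegral /= Rintegral_cst// mul0r.
by move=> x _; exact: mulJc.
Qed.

Lemma ae_eq_sqL2 f g : cmeasurable setT f -> cmeasurable setT g ->
  {ae mu, forall x, f x = g x} -> sqL2 f = sqL2 g.
Proof.
move=> mf mg fg; apply: ge0_ae_eq_integral => //.
- exact: measurable_normc2.
- exact: measurable_normc2.
- by move=> x _; rewrite lee_fin sqr_ge0.
- by move=> x _; rewrite lee_fin sqr_ge0.
- by apply: (ae_imply _ fg) => x ->.
Qed.

Lemma cvg_cintegralMr (g_ : nat -> Rn R n -> R[i]) f g :
  (forall k, memL2 (g_ k)) -> memL2 g -> memL2 f -> L2cvg g_ g ->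
  ccvg (fun k => cintegral mu setT (fun x => f x * g_ k x))
       (cintegral mu setT (fun x => f x * g x)).
Proof.
move=> g_2 g2 f2 gg; have := cvg_cintegralM g_2 g2 f2 gg.
under eq_fun do (under eq_cintegral do rewrite mulrC).
under eq_cintegral do rewrite mulrC.
exact.
Qed.

Lemma sqL2_eq0 f : cmeasurable setT f ->
  sqL2 f = 0%E -> {ae mu, forall x, f x = 0}.
Proof.
move=> mf z.
have : {ae mu, forall x, setT x -> (normc (f x) ^+ 2)%:E = 0%E}.
  apply/ae_eq_integral_abs => //; first exact: measurable_normc2.
  rewrite -[RHS]z; apply: eq_integral => x _.
  by rewrite gee0_abs// lee_fin sqr_ge0.
by apply: ae_imply => x /(_ I) [] /eqP; rewrite sqrf_eq0 => /eqP /eq0_normc.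
Qed.

(** The difference of the two limits is orthogonal to itself, because the pairing
is continuous. *)
Lemma L2cvg_unique (f_ : nat -> Rn R n -> R[i]) f g :
  (forall k, memL2 (f_ k)) -> memL2 f -> memL2 g -> L2cvg f_ f -> L2cvg f_ g ->
  {ae mu, forall x, f x = g x}.
Proof.
move=> f_2 f2 g2 ff fg.
have fg2 := memL2B f2 g2; have fgJ := memL2J fg2.
have E : cintegral mu setT (fun x => f x * (f x - g x)^*%C) =
         cintegral mu setT (fun x => g x * (f x - g x)^*%C).
  exact: (ccvg_unique (cvg_cintegralM f_2 f2 fgJ ff) (cvg_cintegralM f_2 g2 fgJ fg)).
have : cintegral mu setT (fun x => (f x - g x) * (f x - g x)^*%C) = 0.
  rewrite (@eq_cintegral _ _ _ mu setT
    (fun x => f x * (f x - g x)^*%C - g x * (f x - g x)^*%C)); last first.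
    by move=> x _; rewrite mulrBl.
  by rewrite cintegralB ?E ?subrr//; exact: cintegrableM.
rewrite sqL2J// => /(congr1 (@complex.Re R)) /= z.
have z' : sqL2 (fun x => f x - g x)%R = 0%E by rewrite -(fineK (sqL2_fin fg2)) z.
apply: (ae_imply _ (sqL2_eq0 (proj1 fg2) z')) => x /eqP.
by rewrite subr_eq0 => /eqP.
Qed.

Lemma ae_eq_boxfun F G :
  (forall p q, memL1 (fun x => F x * boxfun p q x)) ->
  (forall p q, memL1 (fun x => G x * boxfun p q x)) ->
  (forall p q, cintegral mu setT (fun x => F x * boxfun p q x) =
               cintegral mu setT (fun x => G x * boxfun p q x)) ->
  {ae mu, forall x, F x = G x}.
Proof.
move=> F1 G1 FG.
have D1 p q : memL1 (fun x => (F x - G x) * boxfun p q x).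
  have := cintegrableB measurableT (F1 p q) (G1 p q).
  by congr cintegrable; apply/funext => x; rewrite mulrBl.
have D0 p q : cintegral mu setT (fun x => (F x - G x) * boxfun p q x) = 0.
  rewrite (@eq_cintegral _ _ _ mu setT
    (fun x => F x * boxfun p q x - G x * boxfun p q x)).
    by rewrite (cintegralB measurableT (F1 p q) (G1 p q)) FG subrr.
  by move=> x _; rewrite mulrBl.
have patchE (h : Rn R n -> R) p q :
    (EFin \o (fun x => h x * \1_(box p q) x)) = (EFin \o h) \_ (box p q).
  apply/funext => x; rewrite /= patchE indicE; case: (x \in box p q).
    by rewrite mulr1.
  by rewrite mulr0.
have ReE p q : (EFin \o (complex.Re (R:=R) \o (fun x => (F x - G x) * boxfun p q x)))
    = (EFin \o (fun x => complex.Re (F x - G x))) \_ (box p q).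
  by rewrite -patchE; apply/funext => x /=; rewrite ReM /= mulr0 subr0.
have ImE p q : (EFin \o (complex.Im (R:=R) \o (fun x => (F x - G x) * boxfun p q x)))
    = (EFin \o (fun x => complex.Im (F x - G x))) \_ (box p q).
  by rewrite -patchE; apply/funext => x /=; rewrite ImM /= mulr0 add0r.
have re : {ae mu, forall x, complex.Re (F x - G x) = 0}.
  apply: ae_eq0_boxes.
    move=> k; apply/(integrable_mkcond _ (measurable_box _ _)).2.
    by rewrite -ReE; case: (D1 [tuple - (k%:R : R) | _ < n] [tuple (k%:R : R) | _ < n]).
  move=> p q _ _; have [Di _] := D1 p q.
  rewrite integral_mkcond -[X in integral _ _ X]/(_ \_ _) -ReE.
  rewrite -[LHS](fineK (integrable_fin_num measurableT Di)).
  by have := congr1 (@complex.Re R) (D0 p q); rewrite /cintegral /= /Rintegral => ->.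
have im : {ae mu, forall x, complex.Im (F x - G x) = 0}.
  apply: ae_eq0_boxes.
    move=> k; apply/(integrable_mkcond _ (measurable_box _ _)).2.
    by rewrite -ImE; case: (D1 [tuple - (k%:R : R) | _ < n] [tuple (k%:R : R) | _ < n]).
  move=> p q _ _; have [_ Di] := D1 p q.
  rewrite integral_mkcond -[X in integral _ _ X]/(_ \_ _) -ImE.
  rewrite -[LHS](fineK (integrable_fin_num measurableT Di)).
  by have := congr1 (@complex.Im R) (D0 p q); rewrite /cintegral /= /Rintegral => ->.
apply: (ae_imply2 _ re im) => x xr xi.
by apply/eqP; rewrite -subr_eq0; apply/eqP/eqC.
Qed.

Definition cut k f : Rn R n -> R[i] := fun x => ((\1_(cube k) x)%:C)%C * f x.

Lemma memL1_cut k f : memL2 f -> memL1 (cut k f).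
Proof. by move=> f2; apply: cintegrableM => //; exact: memL2_boxfun. Qed.

Lemma normc_cut k f x : normc (cut k f x) <= normc (f x).
Proof.
by rewrite /cut normcM ler_piMl ?normc_ge0//; exact: normc_boxfun.
Qed.

Lemma cmeasurable_cut k f : cmeasurable setT f -> cmeasurable setT (cut k f).
Proof.
move=> mf; apply: cmeasurableM => //; apply: cmeasurable_real.
apply: measurable_indic; exact: measurable_box.
Qed.

Lemma memL2_cut k f : memL2 f -> memL2 (cut k f).
Proof.
move=> f2; apply: (memL2_le _ f2); last exact: normc_cut.
by apply: cmeasurable_cut; case: f2.
Qed.

Lemma cut_near f x : \forall k \near \oo, cut k f x = f x.
Proof.
have : (\bigcup_k cube k) x by rewrite bigcup_cube.
move=> [N _ xN]; exists N => // k /= Nk.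
by rewrite /cut indicE mem_set ?mul1r//; exact: (cube_sub Nk).
Qed.

Lemma L2cvg_cut f : memL2 f -> L2cvg (cut ^~ f) f.
Proof.
move=> f2; have [mf foo] := f2.
rewrite /L2cvg -(@integral0 _ _ _ mu setT).
have fi : mu.-integrable setT (fun x => (normc (f x) ^+ 2)%:E).
  apply/integrableP; split; first exact: measurable_normc2.
  rewrite (eq_integral (fun x => (normc (f x) ^+ 2)%:E))// => x _.
  by rewrite gee0_abs// lee_fin sqr_ge0.
have [] := @dominated_convergence _ _ _ mu setT measurableT
  (fun k x => (normc (cut k f x - f x) ^+ 2)%:E) (cst 0%E)
  (fun x => (normc (f x) ^+ 2)%:E) _ _ _ fi _ => //.
- move=> k; apply: measurable_normc2 => //; apply: cmeasurableB => //.
  exact: cmeasurable_cut.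
- apply: aeW => x _; apply: cvg_near_cst.
  by apply: filterS (cut_near f x) => k ->; rewrite subrr normc0 expr0n.
- apply: aeW => x k _; rewrite gee0_abs ?lee_fin ?sqr_ge0//.
  rewrite ler_pXn2r ?nnegrE ?normc_ge0// /cut indicE.
  by case: (_ \in _); rewrite ?mul1r ?mul0r ?subrr ?sub0r ?normcN ?normc0 ?normc_ge0.
Qed.

Lemma FTB s H G u : memL1 H -> memL1 G ->
  FT s (fun t => H t - G t) u = FT s H u - FT s G u.
Proof.
move=> H1 G1; rewrite /FT -cintegralB//; last 2 first.
- exact: cintegrable_kernel.
- exact: cintegrable_kernel.
by apply: eq_cintegral => t _; rewrite mulrBl.
Qed.

(** The transform of a square-integrable function is determined up to a null set
by the exchange formula [FT_pairing] against test functions. This form passes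
to the limit and needs no density statement. *)
Definition is_hat s f F := memL2 F /\
  forall X, memL1 X -> memL2 X ->
    cintegral mu setT (fun u => F u * X u) = cintegral mu setT (fun t => f t * FT s X t).

(** The transforms of the truncations form a Cauchy sequence by [bessel], and the
exchange formula is continuous in [f]. *)
Lemma hat_exists s f : s != 0 -> memL2 f ->
  exists2 F, is_hat s f F & L2cvg (fun k => FT s (cut k f)) F.
Proof.
move=> s0 f2; have [mf foo] := f2.
have c1 k := memL1_cut k f2; have c2 k := memL2_cut k f2.
have d2 k := memL2B (c2 k) f2.
pose tail k := planch n s * fine (sqL2 (fun x => cut k f x - f x)%R).
have Fc2 k : memL2 (FT s (cut k f)) by exact: memL2_FT.
have [||F F2 FF] := riesz_fischer Fc2 (tail := tail).
- rewrite -[X in _ --> X](mulr0 (planch n s)); apply: cvgM; first exact: cvg_cst.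
  by have /fine_cvgP[_] := L2cvg_cut f2.
- move=> j k kj.
  rewrite (@eq_sqL2 _ _ _ (FT s (fun t => cut j f t - cut k f t))); last first.
    by move=> u; rewrite FTB.
  apply: le_trans (bessel s0 (cintegrableB measurableT (c1 j) (c1 k))) _.
  rewrite /tail EFinM lee_wpmul2l ?lee_fin ?(ltW (planch_gt0 n s0))//.
  rewrite fineK ?sqL2_fin//; apply: ge0_le_integral => //.
  + by move=> x _; rewrite lee_fin sqr_ge0.
  + by apply: measurable_normc2 => //; have [] := memL2B (c2 j) (c2 k).
  + by apply: measurable_normc2 => //; case: (d2 k).
  + move=> x _; rewrite lee_fin ler_pXn2r ?nnegrE ?normc_ge0// /cut !indicE.
    have [xk|xk] := boolP (x \in cube k).
      rewrite (_ : x \in cube j) ?subrr ?normc0 ?normc_ge0//.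
      by move: xk; rewrite !inE; exact: cube_sub.
    rewrite !mul0r subr0 sub0r normcN normcM ler_piMl ?normc_ge0//.
    by rewrite normc_real; case: (_ \in _); rewrite ?normr1 ?normr0.
exists F => //; split => // X X1 X2.
have FX2 : memL2 (FT s X) by exact: memL2_FT.
apply: (ccvg_unique (cvg_cintegralM Fc2 F2 X2 FF)).
rewrite (_ : (fun k => _) = (fun k => cintegral mu setT (fun x => cut k f x * FT s X x))).
  exact: cvg_cintegralM c2 f2 FX2 (L2cvg_cut f2).
by apply/funext => k; exact: FT_pairing.
Qed.

Lemma hat_FT s H : s != 0 -> memL1 H -> memL2 H -> is_hat s H (FT s H).
Proof.
move=> s0 H1 H2; split; first exact: memL2_FT.
by move=> X X1 X2; exact: FT_pairing.
Qed.

Lemma hat_unique s f F G : is_hat s f F -> is_hat s f G ->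
  {ae mu, forall x, F x = G x}.
Proof.
move=> [F2 HF] [G2 HG]; apply: ae_eq_boxfun => p q.
- by apply: cintegrableM => //; exact: memL2_boxfun.
- by apply: cintegrableM => //; exact: memL2_boxfun.
- have B1 := @memL1_boxfun R n p q; have B2 := @memL2_boxfun R n p q.
  by rewrite HF// HG.
Qed.

Lemma ae_eq_hat s f F G : cmeasurable setT G -> is_hat s f F ->
  {ae mu, forall x, F x = G x} -> is_hat s f G.
Proof.
move=> mG [F2 HF] FG; split.
  split => //; rewrite -[ltLHS]/(sqL2 G) -(ae_eq_sqL2 (proj1 F2) mG FG).
  by case: F2.
move=> X X1 X2; rewrite -HF//; apply: ae_eq_cintegral => //.
- by apply: cmeasurableM => //; case: X2.
- by apply: cmeasurableM => //; [case: F2|case: X2].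
- by apply: (ae_imply _ FG) => x ->.
Qed.

Lemma hat_cut s f F : s != 0 -> memL2 f -> is_hat s f F -> L2cvg (fun k => FT s (cut k f)) F.
Proof.
move=> s0 f2 hF; have [G hG GG] := hat_exists s0 f2.
have FG := hat_unique hF hG.
have F2 : cmeasurable setT F by case: hF => -[].
have G2 : cmeasurable setT G by case: hG => -[].
have E : (fun k => \int[mu]_t (normc (FT s (cut k f) t - F t) ^+ 2)%:E)%E =
         (fun k => \int[mu]_t (normc (FT s (cut k f) t - G t) ^+ 2)%:E)%E.
  apply/funext => k; have mk : cmeasurable setT (FT s (cut k f)).
    by apply: cmeasurable_FT; apply: cmeasurable_cut; case: f2.
  apply: (@ae_eq_sqL2 (fun t => FT s (cut k f) t - F t) (fun t => FT s (cut k f) t - G t)).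
  - exact: cmeasurableB.
  - exact: cmeasurableB.
  - by apply: (ae_imply _ FG) => x ->.
by rewrite /L2cvg E.
Qed.

(** Both functions have the same integrals over boxes: by [inversion_box] for the
truncations of [f], then by continuity. *)
Lemma hat_inv s f F : s != 0 -> memL2 f -> is_hat s f F ->
  is_hat (- s) F (fun x => ((planch n s)%:C)%C * f x).
Proof.
move=> s0 f2 hF; have [F2 _] := hF; have sN0 : - s != 0 by rewrite oppr_eq0.
have [G hG _] := hat_exists sN0 F2; have [G2 HG] := hG.
apply: (ae_eq_hat _ hG).
  by apply: cmeasurableZ; case: f2.
have Pf2 := memL2Z ((planch n s)%:C)%C f2.
have c1 k := memL1_cut k f2; have c2 k := memL2_cut k f2.
apply: ae_eq_boxfun => p q.
- by apply: cintegrableM => //; exact: memL2_boxfun.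
- by apply: cintegrableM => //; exact: memL2_boxfun.
have B1 := @memL1_boxfun R n p q; have B2 := @memL2_boxfun R n p q.
rewrite HG//.
have FB2 : memL2 (FT (- s) (boxfun p q)) by exact: memL2_FT.
have Fc2 k : memL2 (FT s (cut k f)) by exact: memL2_FT.
apply: (ccvg_unique (cvg_cintegralM Fc2 F2 FB2 (hat_cut s0 f2 hF))).
rewrite (_ : (fun k => _) = (fun k => ((planch n s)%:C)%C *
    cintegral mu setT (fun x => cut k f x * boxfun p q x))).
  rewrite (@eq_cintegral _ _ _ mu setT
    (fun x => ((planch n s)%:C)%C * (f x * boxfun p q x))); last first.
    by move=> x _; rewrite mulrA.
  rewrite cintegralZ//; last exact: cintegrableM.
  by apply: ccvgZ; exact: cvg_cintegralM c2 f2 B2 (L2cvg_cut f2).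
by apply/funext => k; exact: (inversion_box p q s0 (c1 k) (Fc2 k)).
Qed.

(** For a truncation of [g], conjugation turns [FT s] into [FT (- s)], and the
duality that characterises the inverse transform [hat_inv] gives the claim. *)
Lemma parseval s f g F G : s != 0 -> memL2 f -> memL2 g ->
  is_hat s f F -> is_hat s g G ->
  cintegral mu setT (fun u => F u * (G u)^*%C) =
  ((planch n s)%:C)%C * cintegral mu setT (fun t => f t * (g t)^*%C).
Proof.
move=> s0 f2 g2 hF hG; have [F2 _] := hF; have [G2 _] := hG.
have sN0 : - s != 0 by rewrite oppr_eq0.
have c1 k := memL1_cut k g2; have c2 k := memL2_cut k g2.
have Fc2 k : memL2 (FT s (cut k g)) by exact: memL2_FT.
have [_ HP] := hat_inv s0 f2 hF.
apply: (ccvg_unique (cvg_cintegralMr (fun k => memL2J (Fc2 k)) (memL2J G2) F2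
  (L2cvgJ (hat_cut s0 g2 hG)))).
rewrite (_ : (fun k => _) = (fun k => ((planch n s)%:C)%C *
    cintegral mu setT (fun x => f x * (cut k g x)^*%C))).
  apply: ccvgZ; exact: (cvg_cintegralMr (fun k => memL2J (c2 k)) (memL2J g2) f2
    (L2cvgJ (L2cvg_cut g2))).
apply/funext => k.
transitivity (cintegral mu setT (fun u => F u * FT (- s) (fun t => (cut k g t)^*%C) u)).
  by apply: eq_cintegral => u _; rewrite FTJ.
rewrite -HP; [|exact: (cintegrableJ measurableT (c1 k))|exact: memL2J].
rewrite -cintegralZ//; last by apply: cintegrableM => //; exact: memL2J.
by apply: eq_cintegral => x _; rewrite mulrA.
Qed.

Lemma plancherel s f F : s != 0 -> memL2 f -> is_hat s f F ->
  sqL2 F = ((planch n s)%:E * sqL2 f)%E.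
Proof.
move=> s0 f2 hF; have [F2 _] := hF.
have := parseval s0 f2 f2 hF hF; rewrite !sqL2J// -rmorphM => /(congr1 (@complex.Re R)) /=.
by move=> E; rewrite -(fineK (sqL2_fin F2)) -(fineK (sqL2_fin f2)) E.
Qed.

(** Transforming [FT s H] back gives a square-integrable function, which agrees
with [H] up to a constant because both have the same integrals over boxes. *)
Lemma memL2_of_FT s H : s != 0 -> memL1 H -> memL2 (FT s H) -> memL2 H.
Proof.
move=> s0 H1 F2; have sN0 : - s != 0 by rewrite oppr_eq0.
have mH := cintegrable_measurable H1.
have [K [K2 HK] _] := hat_exists sN0 F2.
have KH : {ae mu, forall x, K x = ((planch n s)%:C)%C * H x}.
  apply: ae_eq_boxfun => p q.
  - by apply: cintegrableM => //; exact: memL2_boxfun.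
  - apply: (cintegrable_lec _ _ (cintegrableZ measurableT ((planch n s)%:C)%C H1)) => //.
      apply: cmeasurableM => //; first exact: cmeasurableZ.
      by case: (@memL2_boxfun R n p q).
    by move=> x _; rewrite normcM ler_piMr ?normc_ge0 ?normc_boxfun.
  have B1 := @memL1_boxfun R n p q; have B2 := @memL2_boxfun R n p q.
  rewrite HK// inversion_box// -cintegralZ//.
    by apply: eq_cintegral => x _; rewrite mulrA.
  apply: (cintegrable_lec _ _ H1) => //; first by apply: cmeasurableM => //; case: B2.
  by move=> x _; rewrite normcM ler_piMr ?normc_ge0 ?normc_boxfun.
have p0 : planch n s != 0 by rewrite gt_eqF// planch_gt0.
have : memL2 (fun x => ((planch n s)^-1%:C)%C * K x) by exact: memL2Z.
move=> [mK Koo]; split => //.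
rewrite -[ltLHS]/(sqL2 H) -(ae_eq_sqL2 mK mH)//.
apply: (ae_imply _ KH) => x ->; rewrite mulrA -rmorphM mulVf//.
by rewrite rmorph1 mul1r.
Qed.

(** If one side is infinite so is the other: by [memL2_of_FT] the transform of an
integrable function that is not square-integrable is not square-integrable. *)
Lemma plancherel_FT s H : s != 0 -> memL1 H ->
  sqL2 (FT s H) = ((planch n s)%:E * sqL2 H)%E.
Proof.
move=> s0 H1; have mH := cintegrable_measurable H1.
have [Hoo|Hoo] := ltP (sqL2 H) +oo%E.
  have H2 : memL2 H by split.
  by rewrite (plancherel s0 H2 (hat_FT s0 H1 H2)).
have HE : sqL2 H = +oo%E by apply/eqP; rewrite eq_le leey.
rewrite HE gt0_muley ?lte_fin ?planch_gt0//.
apply/eqP; rewrite eq_le leey /= leNgt; apply/negP => Foo.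
have F2 : memL2 (FT s H) by split => //; exact: cmeasurable_FT.
by have [_] := memL2_of_FT s0 H1 F2; rewrite -/(sqL2 H) HE ltxx.
Qed.

End fourier_L2.

(** * Dilations and translations *)

Section dilations.
Context {R : realType} (n : nat).
Local Notation mu := (lebesgue_Rn R n).
Implicit Types (a b u : Rn R n) (h psi Psi X : Rn R n -> R[i]).

Definition cmul a u : Rn R n := [tuple (tnth a i : R) * (tnth u i : R) | i < n].

Definition zeroRn : Rn R n := [tuple (0 : R) | _ < n].

Definition invRn a : Rn R n := [tuple ((tnth a i : R)^-1 : R) | i < n].

Lemma cmulE a u : cmul a u = affine_map a zeroRn u.
Proof. by apply: eq_from_tnth => i; rewrite !tnth_mktuple addr0. Qed.

Lemma cmulC a u : cmul a u = cmul u a.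
Proof. by apply: eq_from_tnth => i; rewrite !tnth_mktuple mulrC. Qed.

Lemma absp_cmul a u : absp (cmul a u) = absp a * absp u.
Proof.
rewrite /absp -normrM -big_split /=; congr `|_|.
by apply: eq_bigr => i _; rewrite tnth_mktuple.
Qed.

Lemma absp_ge0 a : 0 <= absp a. Proof. exact: normr_ge0. Qed.

Lemma Rn0_gt0 a : Rn0 R n a -> 0 < absp a.
Proof. by move=> a0; rewrite lt_neqAle eq_sym a0 absp_ge0. Qed.

Lemma Rn0_coord a i : Rn0 R n a -> (tnth a i : R) != 0.
Proof.
by rewrite /Rn0 /= /absp normr_eq0 => /prodf_neq0 /(_ i isT).
Qed.

Lemma absp_inv a : absp (invRn a) = (absp a)^-1.
Proof.
rewrite /absp -normfV -prodfV; congr `|_|.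
by apply: eq_bigr => i _; rewrite tnth_mktuple.
Qed.

Lemma Rn0_inv a : Rn0 R n a -> Rn0 R n (invRn a).
Proof. by rewrite /Rn0 /= absp_inv invr_eq0. Qed.

Lemma dilateE a b t : dilate a b t =
  affine_map (invRn a) [tuple - ((tnth b i : R) / (tnth a i : R)) | i < n] t.
Proof.
apply: eq_from_tnth => i; rewrite !tnth_mktuple mulrBl; congr (_ - _).
by rewrite mulrC.
Qed.

Lemma dilate_affine a b y : Rn0 R n a -> dilate a b (affine_map a b y) = y.
Proof.
move=> a0; apply: eq_from_tnth => i; rewrite !tnth_mktuple.
by have := Rn0_coord i a0 => ai0; field.
Qed.

Lemma measurable_tuple_fun d (T : measurableType d) (f : 'I_n -> T -> R) :
  (forall i, measurable_fun setT (f i)) ->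
  measurable_fun setT (fun x => [tuple (f i x : measurableTypeR R) | i < n] : Rn R n).
Proof.
move=> mf; apply/measurable_fun_tnthP => i.
rewrite (_ : _ \o _ = f i); first exact: mf.
by apply/funext => t /=; rewrite tnth_mktuple.
Qed.

Lemma measurable_coord d (T : measurableType d) (f : T -> Rn R n) i :
  measurable_fun setT f -> measurable_fun setT (fun x => (tnth (f x) i : R)).
Proof. by move=> mf; apply: (measurableT_comp (measurable_tnth i)). Qed.

(** The inverse is the pointwise limit of [x / (x ^+ 2 + 1 / k)], which covers
the default value at 0. *)
Lemma measurable_inverse : measurable_fun setT (fun x : R => x^-1).
Proof.
apply: (@measurable_fun_cvg _ _ R setT (fun (k : nat) (x : R) => x / (x ^+ 2 + k.+1%:R^-1))).
  move=> k; apply: continuous_measurable_fun => x.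
  have k0 : (0 : R) < k.+1%:R^-1 by rewrite invr_gt0.
  apply: cvgM; first exact: cvg_id.
  apply: cvgV; first by rewrite gt_eqF// ltr_wpDl ?sqr_ge0.
  by apply: cvgD; [exact: exprn_continuous|exact: cvg_cst].
move=> x _; have [->|x0] := eqVneq x 0.
  rewrite invr0 (_ : (fun k => _) = cst (0 : R)); first exact: cvg_cst.
  by apply/funext => k; rewrite mul0r.
have h : (fun k : nat => x / (x ^+ 2 + k.+1%:R^-1)) @ \oo --> x / (x ^+ 2 + 0).
  apply: cvgM; first exact: cvg_cst.
  apply: cvgV; first by rewrite addr0 sqrf_eq0.
  by apply: cvgD; [exact: cvg_cst|exact: cvg_harmonic].
have E : x / (x ^+ 2 + 0) = x^-1 by rewrite addr0; field.
by rewrite E in h.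
Qed.

Lemma measurable_cmul d (T : measurableType d) (f g : T -> Rn R n) :
  measurable_fun setT f -> measurable_fun setT g ->
  measurable_fun setT (fun x => cmul (f x) (g x)).
Proof.
move=> mf mg; apply: measurable_tuple_fun => i.
by apply: measurable_funM; exact: measurable_coord.
Qed.

Lemma measurable_dilate d (T : measurableType d) (f g k : T -> Rn R n) :
  measurable_fun setT f -> measurable_fun setT g -> measurable_fun setT k ->
  measurable_fun setT (fun x => dilate (f x) (g x) (k x)).
Proof.
move=> mf mg mk; apply: measurable_tuple_fun => i.
apply: measurable_funM; first by apply: measurable_funB; exact: measurable_coord.
apply: (measurableT_comp (f := fun x : R => x^-1)); last exact: measurable_coord.
exact: measurable_inverse.
Qed.

Lemma measurable_abspV d (T : measurableType d) (f : T -> Rn R n) :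
  measurable_fun setT f -> measurable_fun setT (fun x => (absp (f x))^-1).
Proof.
move=> mf; apply: (measurableT_comp (f := fun x : R => x^-1)).
  exact: measurable_inverse.
by apply: (measurableT_comp (@measurable_absp R n)).
Qed.

Lemma sqL2_affine a b h : Rn0 R n a -> cmeasurable setT h ->
  sqL2 h = ((absp a)%:E * sqL2 (h \o affine_map a b))%E.
Proof.
move=> a0 mh; rewrite /sqL2 (ge0_integral_affine_map b a0)//.
  exact: measurable_normc2.
by move=> x; rewrite lee_fin sqr_ge0.
Qed.

Lemma memL2_affine a b h : Rn0 R n a -> memL2 h -> memL2 (h \o affine_map a b).
Proof.
move=> a0 [mh hoo]; split; first by apply: (cmeasurable_comp mh); exact: measurable_affine_map.
move: hoo; rewrite -/(sqL2 h) (sqL2_affine b a0 mh) -lte_pdivlMl ?Rn0_gt0//.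
by rewrite mulry gtr0_sg ?invr_gt0 ?Rn0_gt0// mul1e.
Qed.

Lemma memL2_dilate a b h : Rn0 R n a -> memL2 h -> memL2 (fun t => h (dilate a b t)).
Proof.
move=> a0 h2; rewrite (_ : (fun t => _) = h \o affine_map (invRn a)
  [tuple - ((tnth b i : R) / (tnth a i : R)) | i < n]).
  by apply: memL2_affine => //; exact: Rn0_inv.
by apply/funext => t; rewrite /= dilateE.
Qed.

Lemma memL2_cmul a h : Rn0 R n a -> memL2 h -> memL2 (fun u => h (cmul a u)).
Proof.
move=> a0 h2; rewrite (_ : (fun t => _) = h \o affine_map a zeroRn).
  exact: memL2_affine.
by apply/funext => t; rewrite /= cmulE.
Qed.

Lemma dotp_cmul a (x y : Rn R n) : dotp (cmul a x) y = dotp x (cmul a y).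
Proof. by apply: eq_bigr => i _; rewrite !tnth_mktuple; ring. Qed.

Lemma dotpDr (x y z : Rn R n) : dotp x [tuple (tnth y i : R) + (tnth z i : R) | i < n] =
  dotp x y + dotp x z.
Proof.
by rewrite /dotp -big_split /=; apply: eq_bigr => i _; rewrite tnth_mktuple mulrDr.
Qed.

(** The substitution [t = a y + b] moves the dilation and the translation to the
test function, where the Fourier integral shows their effect. *)
Lemma hat_dilate s a b psi Psi : s != 0 -> Rn0 R n a -> memL2 psi -> is_hat s psi Psi ->
  is_hat s (fun t => psi (dilate a b t))
    (fun u => ((absp a)%:C)%C * (expi (s * dotp b u) * Psi (cmul a u))).
Proof.
move=> s0 a0 psi2 [Psi2 hP]; have ap := Rn0_gt0 a0.
have ia0 := Rn0_inv a0.
split.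
  apply: memL2Z; apply: memL2M_expi; first exact: memL2_cmul.
  by apply: measurable_funM => //; apply: measurable_dotp.
move=> X X1 X2.
pose Y v := expi (s * dotp b (cmul (invRn a) v)) * X (cmul (invRn a) v).
have mY : cmeasurable setT Y.
  apply: cmeasurableM => //.
    apply: cmeasurable_expi; apply: measurable_funM => //; apply: measurable_dotp => //.
    exact: measurable_cmul.
  by case: (memL2_cmul ia0 X2).
have Y2 : memL2 Y.
  apply: (memL2_le mY (memL2_cmul ia0 X2)) => v.
  by rewrite normcM normc_expi mul1r.
have Y1 : memL1 Y.
  have [Xi _] := cintegral_affine_map zeroRn ia0 X1.
  apply: (cintegrable_lec _ mY Xi) => // v _.
  by rewrite normcM normc_expi mul1r /= -cmulE.
have FE y : FT s X (affine_map a b y) = (((absp a)^-1)%:C)%C * FT s Y y.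
  rewrite /FT (proj2 (cintegral_affine_map zeroRn ia0 (cintegrable_kernel s _ X1))) absp_inv.
  congr (_ * _); apply: eq_cintegral => v _; rewrite /= -cmulE /Y.
  rewrite [RHS]mulrAC mulrC -expiD; congr (expi _ * _).
  rewrite -mulrDr; congr (_ * _).
  rewrite (_ : affine_map a b y =
     [tuple (tnth (cmul a y) i : R) + (tnth b i : R) | i < n]); last first.
    by apply: eq_from_tnth => i; rewrite !tnth_mktuple.
  rewrite dotpDr [dotp b _]dotpC addrC; congr (_ + _).
  rewrite dotp_cmul; congr dotp; apply: eq_from_tnth => i; rewrite !tnth_mktuple.
  by rewrite mulrA mulVf ?mul1r// Rn0_coord.
have FX2 : memL2 (FT s X) by exact: memL2_FT.
have [_ ->] := cintegral_affine_map b a0 (cintegrableM (memL2_dilate b a0 psi2) FX2).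
rewrite [X in _ = _ * X](@eq_cintegral _ _ _ mu setT
    (fun y => (((absp a)^-1)%:C)%C * (psi y * FT s Y y))); last first.
  by move=> y _; rewrite /= FE dilate_affine// mulrCA.
have FY2 : memL2 (FT s Y) by exact: memL2_FT.
rewrite cintegralZ//; last exact: cintegrableM.
rewrite mulrA -rmorphM mulfV ?gt_eqF// rmorph1 mul1r -hP//.
have [PYi ->] := cintegral_affine_map zeroRn a0 (cintegrableM Psi2 Y2).
rewrite -cintegralZ//; apply: eq_cintegral => u _; rewrite /= -cmulE.
rewrite /Y (_ : cmul (invRn a) (cmul a u) = u); first by ring.
apply: eq_from_tnth => i; rewrite !tnth_mktuple.
by rewrite mulrA mulVf ?mul1r// Rn0_coord.
Qed.

End dilations.

(** * The wavelet transform and its energy *)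

Section wavelet_transform.
Context {R : realType} (n : nat).
Local Notation mu := (lebesgue_Rn R n).
Implicit Types (a b t u : Rn R n) (f g h k psi phi Psi Phi : Rn R n -> R[i]).

(** [wav] and [cwt] are the atoms and the wavelet transform without chirps. The
inverse of 0 being 0, they vanish when [a] has a zero coordinate, so that
integrals over [Rn0 R n] can be taken over the whole space. *)
Definition wav psi a b : Rn R n -> R[i] :=
  fun t => (((Num.sqrt (absp a))^-1)%:C)%C * psi (dilate a b t).

Definition cwt psi h a b : R[i] := cintegral mu setT (fun t => h t * ((wav psi a b t)^*)%C).

Lemma wav_eq0 psi a b t : ~ Rn0 R n a -> wav psi a b t = 0.
Proof.
move=> /negP; rewrite negbK => /eqP a0.
by rewrite /wav a0 sqrtr0 invr0 mul0r.
Qed.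

Lemma memL2_wav psi a b : memL2 psi -> memL2 (wav psi a b).
Proof.
move=> psi2; have [a0|a0] := pselect (Rn0 R n a).
  by apply: memL2Z; exact: memL2_dilate.
rewrite (_ : wav psi a b = fun t => 0 * psi t); first exact: memL2Z.
by apply/funext => t; rewrite wav_eq0// mul0r.
Qed.

Lemma cwt_off psi h a b : ~ Rn0 R n a -> cwt psi h a b = 0.
Proof.
move=> a0; rewrite /cwt (@eq_cintegral _ _ _ mu setT (fun=> 0)).
  exact: cintegral0.
by move=> t _; rewrite wav_eq0// conjc0 mulr0.
Qed.

Lemma cmeasurable_cwt psi h : cmeasurable setT psi -> cmeasurable setT h ->
  cmeasurable setT (fun p : Rn R n * Rn R n => cwt psi h p.1 p.2).
Proof.
move=> mpsi mh.
apply: (@cmeasurable_cintegral _ _ _ _ R mu (fun p : (Rn R n * Rn R n) * Rn R n =>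
  h p.2 * ((wav psi p.1.1 p.1.2 p.2)^*)%C)).
have m1 : measurable_fun setT (fun p : (Rn R n * Rn R n) * Rn R n => p.1.1).
  by apply: measurableT_comp => //; exact: measurable_fst.
have m2 : measurable_fun setT (fun p : (Rn R n * Rn R n) * Rn R n => p.1.2).
  by apply: (measurableT_comp measurable_snd); exact: measurable_fst.
have m3 : measurable_fun setT (fun p : (Rn R n * Rn R n) * Rn R n => p.2).
  exact: measurable_snd.
apply: cmeasurableM => //; first exact: (cmeasurable_comp mh).
apply: cmeasurableJ; apply: cmeasurableM => //.
  apply: cmeasurable_real; apply: (measurableT_comp (@measurable_inverse R)).
  apply: (@measurableT_comp _ _ _ _ _ _ (@Num.sqrt R)).
    by apply: continuous_measurable_fun => x; exact: sqrt_continuous.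
  by apply: (measurableT_comp (@measurable_absp R n)).
by apply: (cmeasurable_comp mpsi); exact: measurable_dilate.
Qed.

(** On the Fourier side, the wavelet transform at scale [a] multiplies by the
conjugate of the dilated transform of the wavelet. *)
Definition freq Psi H a : Rn R n -> R[i] := fun u => H u * ((Psi (cmul a u))^*)%C.

Lemma memL1_freq Psi H a : memL2 Psi -> memL2 H -> Rn0 R n a -> memL1 (freq Psi H a).
Proof.
by move=> P2 H2 a0; apply: cintegrableM => //; apply: memL2J; exact: memL2_cmul.
Qed.

(** Parseval's identity, together with the transform [hat_dilate] of an atom; its
modulation by [b] is the kernel of [FT (- s)]. *)
Lemma cwt_freq s psi h Psi H a b : s != 0 -> memL2 psi -> memL2 h ->
  is_hat s psi Psi -> is_hat s h H -> Rn0 R n a ->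
  cwt psi h a b = (((planch n s)^-1 * Num.sqrt (absp a))%:C)%C * FT (- s) (freq Psi H a) b.
Proof.
move=> s0 psi2 h2 hpsi hH a0; have ap := Rn0_gt0 a0.
have P2 : memL2 Psi by case: hpsi.
have H2 : memL2 H by case: hH.
have p0 : planch n s != 0 by rewrite gt_eqF// planch_gt0.
have hd := hat_dilate b s0 a0 psi2 hpsi.
have d2 := memL2_dilate b a0 psi2.
have := parseval s0 h2 d2 hH hd.
have -> : cintegral mu setT (fun u => H u *
    (((absp a)%:C)%C * (expi (s * dotp b u) * Psi (cmul a u)))^*%C) =
    ((absp a)%:C)%C * FT (- s) (freq Psi H a) b.
  rewrite /FT -cintegralZ//; last exact: (cintegrable_kernel _ _ (memL1_freq P2 H2 a0)).
  apply: eq_cintegral => u _; rewrite !conjM expiJ conjc_real -mulNr dotpC /freq; ring.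
move=> E; rewrite /cwt.
rewrite (@eq_cintegral _ _ _ mu setT (fun t => (((Num.sqrt (absp a))^-1)%:C)%C *
   (h t * ((psi (dilate a b t))^*)%C))); last first.
  by move=> t _; rewrite /wav conjM conjc_real mulrCA.
rewrite cintegralZ//; last by apply: cintegrableM => //; exact: memL2J.
have -> : cintegral mu setT (fun t => h t * (psi (dilate a b t))^*%C) =
   (((planch n s)^-1)%:C)%C * (((absp a)%:C)%C * FT (- s) (freq Psi H a) b).
  by rewrite E mulrA -rmorphM mulVf// rmorph1 mul1r.
rewrite !mulrA -!rmorphM; congr ((_%:C)%C * _).
have sq0 : Num.sqrt (absp a) != 0 by rewrite gt_eqF// sqrtr_gt0.
rewrite -{2}(sqr_sqrtr (ltW ap)); field; rewrite sq0 p0//.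
Qed.

(** The classical admissibility constant of a wavelet with transform [Psi]. *)
Definition adm Psi : \bar R := (\int[mu]_v (normc (Psi v) ^+ 2 / absp v)%:E)%E.

Lemma adm_ge0 Psi : (0 <= adm Psi)%E.
Proof.
by apply: integral_ge0 => v _; rewrite lee_fin divr_ge0 ?sqr_ge0 ?absp_ge0.
Qed.

Lemma measurable_adm Psi : cmeasurable setT Psi ->
  measurable_fun setT (fun v => normc (Psi v) ^+ 2 / absp v).
Proof.
move=> mP; apply: measurable_funM; first by apply: measurable_funX; exact: measurable_normc.
exact: measurable_abspV.
Qed.

(** [freq Psi H a] is integrable, but may fail to be square-integrable; hence
[plancherel_FT], which allows infinite values. *)
Lemma integral_sqr_cwt s psi h Psi H a : s != 0 -> memL2 psi -> memL2 h ->
  is_hat s psi Psi -> is_hat s h H ->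
  (\int[mu]_b (normc (cwt psi h a b) ^+ 2 / absp a ^+ 2)%:E =
   ((planch n s)^-1 / absp a)%:E * sqL2 (freq Psi H a))%E.
Proof.
move=> s0 psi2 h2 hpsi hH; have sN0 : - s != 0 by rewrite oppr_eq0.
have pp := planch_gt0 n s0.
have P2 : memL2 Psi by case: hpsi.
have H2 : memL2 H by case: hH.
have [a0|a0] := pselect (Rn0 R n a); last first.
  have aa : absp a = 0 by move: a0 => /negP; rewrite negbK => /eqP.
  rewrite aa invr0 mulr0 mul0e; under eq_integral do rewrite expr0n invr0 mulr0.
  exact: integral0.
have ap := Rn0_gt0 a0.
have L1 := memL1_freq P2 H2 a0.
transitivity (((planch n s)^-1 ^+ 2 / absp a)%:E * sqL2 (FT (- s) (freq Psi H a)))%E.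
  rewrite /sqL2 -ge0_integralZl//; last 3 first.
  - apply: measurable_normc2 => //; apply: cmeasurable_FT; exact: cintegrable_measurable L1.
  - by move=> x _; rewrite lee_fin sqr_ge0.
  - by rewrite lee_fin divr_ge0 ?absp_ge0// exprn_ge0// invr_ge0 ltW.
  apply: eq_integral => b _; rewrite (cwt_freq b s0 psi2 h2 hpsi hH a0).
  rewrite normcM normc_real ger0_norm; last by rewrite mulr_ge0 ?sqrtr_ge0// invr_ge0 ltW.
  rewrite -EFinM; congr EFin; rewrite !exprMn sqr_sqrtr ?absp_ge0//.
  by field; rewrite !gt_eqF.
rewrite plancherel_FT// planchN muleA -EFinM; congr (_%:E * _)%E.
by field; rewrite !gt_eqF.
Qed.

Lemma measurable_freq Psi H : cmeasurable setT Psi -> cmeasurable setT H ->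
  cmeasurable setT (fun p : Rn R n * Rn R n => freq Psi H p.1 p.2).
Proof.
move=> mP mH; apply: cmeasurableM => //; first by apply: (cmeasurable_comp mH).
by apply: cmeasurableJ; apply: (cmeasurable_comp mP); exact: measurable_cmul.
Qed.

(** The measure with density [1 / absp] is invariant under coordinatewise
dilations by vectors without zero coordinate. *)
Lemma adm_scaled Psi u : cmeasurable setT Psi -> Rn0 R n u ->
  (\int[mu]_a (normc (Psi (cmul a u)) ^+ 2 / absp a)%:E = adm Psi)%E.
Proof.
move=> mP u0; have up := Rn0_gt0 u0.
rewrite /adm [RHS](ge0_integral_affine_map (@zeroRn R n) u0); last 2 first.
- by apply/measurable_EFinP; exact: measurable_adm.
- by move=> v; rewrite lee_fin divr_ge0 ?sqr_ge0 ?absp_ge0.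
rewrite -ge0_integralZl//; last 3 first.
- apply/measurable_EFinP.
  apply: (measurableT_comp (measurable_adm mP)); exact: measurable_affine_map.
- by move=> v _; rewrite lee_fin divr_ge0 ?sqr_ge0 ?absp_ge0.
- by rewrite lee_fin ltW.
apply: eq_integral => a _; rewrite -cmulE -EFinM cmulC absp_cmul; congr EFin.
by rewrite invfM mulrCA [absp u * _]mulrA mulfV ?mul1r ?gt_eqF.
Qed.

Lemma measurable_energy_density Psi H : cmeasurable setT Psi -> cmeasurable setT H ->
  measurable_fun setT (fun p : Rn R n * Rn R n =>
    ((absp p.1)^-1 * normc (freq Psi H p.1 p.2) ^+ 2)%:E).
Proof.
move=> mP mH; apply/measurable_EFinP; apply: measurable_funM; first exact: measurable_abspV.
by apply: measurable_funX; apply: measurable_normc => //; exact: measurable_freq.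
Qed.

Lemma sqL2_freq Psi H a : cmeasurable setT Psi -> cmeasurable setT H ->
  ((absp a)^-1%:E * sqL2 (freq Psi H a) =
   \int[mu]_u ((absp a)^-1 * normc (freq Psi H a u) ^+ 2)%:E)%E.
Proof.
move=> mP mH; rewrite /sqL2 -ge0_integralZl//.
- apply: measurable_normc2 => //.
  exact: (cmeasurable_comp (measurable_freq mP mH) (pair1_measurable a)).
- by move=> x _; rewrite lee_fin sqr_ge0.
- by rewrite lee_fin invr_ge0 absp_ge0.
Qed.

Lemma measurable_sqL2_freq Psi H : cmeasurable setT Psi -> cmeasurable setT H ->
  measurable_fun setT (fun a => (absp a)^-1%:E * sqL2 (freq Psi H a))%E.
Proof.
move=> mP mH; under eq_fun do rewrite sqL2_freq//.
apply: (measurable_fun_fubini_tonelli_F (fun p : Rn R n * Rn R n =>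
    ((absp p.1)^-1 * normc (freq Psi H p.1 p.2) ^+ 2)%:E)).
  exact: measurable_energy_density.
by move=> p; rewrite lee_fin mulr_ge0 ?sqr_ge0// invr_ge0 absp_ge0.
Qed.

(** By Tonelli the integral over the scale can be taken first, where
[adm_scaled] gives a value that does not depend on [u]. *)
Lemma energy_freq Psi H : memL2 Psi -> memL2 H ->
  (\int[mu]_a ((absp a)^-1%:E * sqL2 (freq Psi H a)) = sqL2 H * adm Psi)%E.
Proof.
move=> [mP Poo] [mH Hoo].
pose K (p : Rn R n * Rn R n) := ((absp p.1)^-1 * normc (freq Psi H p.1 p.2) ^+ 2)%:E.
have mK : measurable_fun setT K by exact: measurable_energy_density.
have K0 p : (0 <= K p)%E by rewrite lee_fin mulr_ge0 ?sqr_ge0// invr_ge0 absp_ge0.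
under eq_integral do rewrite sqL2_freq//.
rewrite -[LHS]/(\int[mu]_a \int[mu]_u K (a, u))%E.
rewrite (fubini_tonelli K)// /sqL2 -ge0_integralZr//; last 3 first.
- exact: measurable_normc2.
- by move=> x _; rewrite lee_fin sqr_ge0.
- exact: adm_ge0.
apply: ge0_ae_eq_integral => //.
- exact: (measurable_fun_fubini_tonelli_G K).
- apply: emeasurable_funM; last exact: measurable_cst.
  exact: measurable_normc2.
- by move=> u _; apply: integral_ge0.
- by move=> u _; rewrite mule_ge0 ?adm_ge0// lee_fin sqr_ge0.
apply: (ae_imply _ (ae_Rn0 n)) => u u0 _.
rewrite -(adm_scaled mP u0) -ge0_integralZl//; last 3 first.
- apply/measurable_EFinP; apply: measurable_funM; last exact: measurable_abspV.
  apply: measurable_funX; apply: measurable_normc => //.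
  by apply: (cmeasurable_comp mP); exact: measurable_cmul.
- by move=> v _; rewrite lee_fin divr_ge0 ?sqr_ge0 ?absp_ge0.
- by rewrite lee_fin sqr_ge0.
apply: eq_integral => a _; rewrite /K /freq /= -EFinM; congr EFin.
by rewrite normcM normcJ exprMn; ring.
Qed.

(** Plancherel in [b], then [energy_freq] in the scale, then Plancherel for [h]:
the two Plancherel constants cancel. *)
Lemma energy s psi h Psi H : s != 0 -> memL2 psi -> memL2 h ->
  is_hat s psi Psi -> is_hat s h H ->
  (\int[mu]_a \int[mu]_b (normc (cwt psi h a b) ^+ 2 / absp a ^+ 2)%:E =
   sqL2 h * adm Psi)%E.
Proof.
move=> s0 psi2 h2 hpsi hH; have pp := planch_gt0 n s0.
have P2 : memL2 Psi by case: hpsi.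
have H2 : memL2 H by case: hH.
under eq_integral do rewrite (integral_sqr_cwt _ s0 psi2 h2 hpsi hH) EFinM -muleA.
rewrite ge0_integralZl//; last 3 first.
- by apply: measurable_sqL2_freq; [case: P2|case: H2].
- move=> a _; rewrite mule_ge0 ?sqL2_ge0// lee_fin invr_ge0 absp_ge0//.
- by rewrite lee_fin invr_ge0 ltW.
rewrite energy_freq// (plancherel s0 h2 hH) !muleA -EFinM mulVf ?gt_eqF//.
by rewrite mul1e.
Qed.

End wavelet_transform.

(** * The reconstruction formula without chirps *)

Lemma scale_sesqui (R : realType) (x y z : R) (X Y : R[i]) : x * y * y = z ->
  (x%:C)%C * ((y%:C)%C * X * ((y%:C)%C * Y)^*%C) = (z%:C)%C * (X * Y^*%C).
Proof.
move=> <-; have -> : ((x * y * y)%:C)%C = (x%:C)%C * ((y%:C)%C * (y%:C)%C).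
  by rewrite -!rmorphM mulrA.
by rewrite conjM conjc_real mulrACA [LHS]mulrA.
Qed.

Section weighted_products.
Context d1 d2 (T1 : measurableType d1) (T2 : measurableType d2) (R : realType).
Variables (m1 : {sigma_finite_measure set T1 -> \bar R})
  (m2 : {sigma_finite_measure set T2 -> \bar R}).

(** A product is at most the sum of the squares of its factors. *)
Lemma integral_weighted_product (f g : T1 * T2 -> R[i]) (w : T1 -> R) :
  cmeasurable setT f -> cmeasurable setT g -> measurable_fun setT w ->
  (forall x, 0 <= w x) ->
  (\int[m1]_x \int[m2]_y (w x * normc (f (x, y)) ^+ 2)%:E < +oo)%E ->
  (\int[m1]_x \int[m2]_y (w x * normc (g (x, y)) ^+ 2)%:E < +oo)%E ->
  (\int[m1]_x \int[m2]_y
     (normc (((w x)%:C)%C * (f (x, y) * (g (x, y))^*%C)))%:E < +oo)%E.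
Proof.
move=> mf mg mw w0 foo goo.
pose sq (h : T1 * T2 -> R[i]) p := (w p.1 * normc (h p) ^+ 2)%:E.
have msq h : cmeasurable setT h -> measurable_fun setT (sq h).
  move=> mh; apply/measurable_EFinP; apply: measurable_funM.
    exact: (measurableT_comp mw).
  by apply: measurable_funX; exact: measurable_normc.
have sq0 h p : (0 <= sq h p)%E by rewrite lee_fin mulr_ge0 ?sqr_ge0.
have mF h : cmeasurable setT h -> measurable_fun setT (fun x => \int[m2]_y sq h (x, y))%E.
  by move=> mh; apply: (measurable_fun_fubini_tonelli_F (sq h)) => //; exact: msq.
have ms h x : cmeasurable setT h -> measurable_fun setT (fun y => sq h (x, y)).
  by move=> mh; apply: (measurableT_comp (msq _ mh)); exact: pair1_measurable.
pose k p := (normc (((w p.1)%:C)%C * (f p * (g p)^*%C)))%:E.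
have mk : measurable_fun setT k.
  apply: measurable_normcE => //; apply: cmeasurableM => //.
    by apply: cmeasurable_real; exact: (measurableT_comp mw).
  by apply: cmeasurableM => //; exact: cmeasurableJ.
have k0 p : (0 <= k p)%E by rewrite lee_fin normc_ge0.
apply: (@le_lt_trans _ _ (\int[m1]_x (\int[m2]_y sq f (x, y) + \int[m2]_y sq g (x, y)))%E).
  apply: ge0_le_integral => //.
  - by move=> x _; apply: integral_ge0 => y _; exact: (k0 (x, y)).
  - exact: (measurable_fun_fubini_tonelli_F k).
  - by apply: emeasurable_funD; exact: mF.
  move=> x _; rewrite -ge0_integralD//; [|exact: ms..].
  apply: ge0_le_integral => //.
  - by move=> y _; exact: (k0 (x, y)).
  - by apply: (measurableT_comp mk); exact: pair1_measurable.
  - by apply: emeasurable_funD; exact: ms.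
  move=> y _; rewrite lee_fin !normcM normcJ normc_real ger0_norm//= -mulrDr.
  rewrite ler_wpM2l//.
  have := sqr_ge0 (normc (f (x, y)) - normc (g (x, y))).
  have := sqr_ge0 (normc (f (x, y))); have := sqr_ge0 (normc (g (x, y))).
  nra.
rewrite ge0_integralD//.
- exact: (lte_add_pinfty foo goo).
- by move=> x _; apply: integral_ge0.
- exact: mF.
- by move=> x _; apply: integral_ge0.
- exact: mF.
Qed.

End weighted_products.

Section reconstruction.
Context {R : realType} (n : nat).
Local Notation mu := (lebesgue_Rn R n).
Variables (s : R) (psi phi h k Psi Phi H K : Rn R n -> R[i]).
Hypotheses (s0 : s != 0) (psi2 : memL2 psi) (phi2 : memL2 phi).
Hypotheses (h2 : memL2 h) (k2 : memL2 k).
Hypotheses (hpsi : is_hat s psi Psi) (hphi : is_hat s phi Phi).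
Hypotheses (hh : is_hat s h H) (hk : is_hat s k K).
Hypotheses (admPsi : (adm Psi < +oo)%E) (admPhi : (adm Phi < +oo)%E).

Let sN0 : - s != 0. Proof. by rewrite oppr_eq0. Qed.
Let pp := planch_gt0 n s0.
Let Psi2 : memL2 Psi. Proof. by case: hpsi. Qed.
Let Phi2 : memL2 Phi. Proof. by case: hphi. Qed.
Let H2 : memL2 H. Proof. by case: hh. Qed.
Let K2 : memL2 K. Proof. by case: hk. Qed.

(** The integrand, tested against [g], of the synthesis integral. *)
Definition pairing (p : Rn R n * Rn R n) : R[i] :=
  (((absp p.1 ^+ 2)^-1)%:C)%C * (cwt psi h p.1 p.2 * (cwt phi k p.1 p.2)^*%C).

Definition cross (Phi' Psi' : Rn R n -> R[i]) : R[i] :=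
  cintegral mu setT (fun v => (((absp v)^-1)%:C)%C * (Psi' v * (Phi' v)^*%C)).

Lemma measurable_abspV2 : measurable_fun setT (fun a : Rn R n => (absp a ^+ 2)^-1).
Proof.
rewrite (_ : (fun a => _) = fun a : Rn R n => (absp a)^-1 ^+ 2).
  by apply: measurable_funX; exact: measurable_abspV.
by apply/funext => a; rewrite exprVn.
Qed.

Lemma cmeasurable_pairing : cmeasurable setT pairing.
Proof.
apply: cmeasurableM => //.
  apply: cmeasurable_real.
  by apply: (measurableT_comp measurable_abspV2); exact: measurable_fst.
apply: cmeasurableM => //; first by apply: cmeasurable_cwt; [case: psi2|case: h2].
by apply: cmeasurableJ; apply: cmeasurable_cwt; [case: phi2|case: k2].
Qed.

Lemma energy_fin psi' h' Psi' H' : memL2 psi' -> memL2 h' -> is_hat s psi' Psi' ->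
  is_hat s h' H' -> (adm Psi' < +oo)%E ->
  (\int[mu]_a \int[mu]_b ((absp a ^+ 2)^-1 * normc (cwt psi' h' a b) ^+ 2)%:E < +oo)%E.
Proof.
move=> psi'2 h'2 hpsi' hh' aoo.
under eq_integral do under eq_integral do rewrite mulrC.
rewrite (energy s0 psi'2 h'2 hpsi' hh').
by rewrite lte_mul_pinfty// ?sqL2_ge0// sqL2_fin.
Qed.

Lemma pairing_fin : (\int[mu]_a \int[mu]_b (normc (pairing (a, b)))%:E < +oo)%E.
Proof.
apply: (integral_weighted_product (m1 := mu) (m2 := mu)
   (f := fun p => cwt psi h p.1 p.2) (g := fun p => cwt phi k p.1 p.2)
   (w := fun a => (absp a ^+ 2)^-1)) => //.
- by apply: cmeasurable_cwt; [case: psi2|case: h2].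
- by apply: cmeasurable_cwt; [case: phi2|case: k2].
- exact: measurable_abspV2.
- by move=> a; rewrite invr_ge0 sqr_ge0.
- exact: (energy_fin psi2 h2 hpsi hh admPsi).
- exact: (energy_fin phi2 k2 hphi hk admPhi).
Qed.

(** The energy identity on the Fourier side bounds the integral over [a] of the
squared norms, which are therefore finite for almost every scale. *)
Lemma ae_freq_fin Psi' H' : memL2 Psi' -> memL2 H' -> (adm Psi' < +oo)%E ->
  {ae mu, forall a, Rn0 R n a -> memL2 (freq Psi' H' a)}.
Proof.
move=> P2 H'2 aoo; have [mP _] := P2; have [mH _] := H'2.
have : mu.-integrable setT (fun a => (absp a)^-1%:E * sqL2 (freq Psi' H' a))%E.
  apply/integrableP; split; first exact: measurable_sqL2_freq.
  under eq_integral => a _ do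
    rewrite gee0_abs ?(mule_ge0 _ (sqL2_ge0 _)) ?lee_fin ?invr_ge0 ?absp_ge0//.
  by rewrite energy_freq// lte_mul_pinfty// ?sqL2_ge0// sqL2_fin.
move=> /(integrable_ae measurableT); apply: ae_imply => a /(_ I) fa a0.
split.
  exact: (cmeasurable_comp (measurable_freq mP mH) (pair1_measurable a)).
rewrite -[ltLHS]/(sqL2 (freq Psi' H' a)) -ge0_fin_numE ?sqL2_ge0//.
have -> : sqL2 (freq Psi' H' a) =
    ((absp a)%:E * ((absp a)^-1%:E * sqL2 (freq Psi' H' a)))%E.
  by rewrite muleA -EFinM mulfV ?gt_eqF ?Rn0_gt0// mul1e.
exact: fin_numM.
Qed.

(** The counterpart of [pairing] on the Fourier side: for a given scale the two
have proportional integrals. *)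
Definition freq_pairing (p : Rn R n * Rn R n) : R[i] :=
  (((absp p.1)^-1)%:C)%C * (freq Psi H p.1 p.2 * (freq Phi K p.1 p.2)^*%C).

Lemma cmeasurable_freq_pairing : cmeasurable setT freq_pairing.
Proof.
apply: cmeasurableM => //.
  apply: cmeasurable_real; exact: measurable_abspV.
apply: cmeasurableM => //; first by apply: measurable_freq; [case: Psi2|case: H2].
by apply: cmeasurableJ; apply: measurable_freq; [case: Phi2|case: K2].
Qed.

Lemma freq_fin Psi' H' : memL2 Psi' -> memL2 H' -> (adm Psi' < +oo)%E ->
  (\int[mu]_a \int[mu]_u ((absp a)^-1 * normc (freq Psi' H' a u) ^+ 2)%:E < +oo)%E.
Proof.
move=> P2 H'2 aoo; have [mP _] := P2; have [mH _] := H'2.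
under eq_integral do rewrite -sqL2_freq//.
by rewrite energy_freq// lte_mul_pinfty// ?sqL2_ge0// sqL2_fin.
Qed.

Lemma freq_pairing_fin :
  (\int[mu]_a \int[mu]_u (normc (freq_pairing (a, u)))%:E < +oo)%E.
Proof.
apply: (integral_weighted_product (m1 := mu) (m2 := mu)
   (f := fun p => freq Psi H p.1 p.2) (g := fun p => freq Phi K p.1 p.2)
   (w := fun a => (absp a)^-1)) => //.
- by apply: measurable_freq; [case: Psi2|case: H2].
- by apply: measurable_freq; [case: Phi2|case: K2].
- exact: measurable_abspV.
- by move=> a; rewrite invr_ge0 absp_ge0.
- exact: freq_fin.
- exact: freq_fin.
Qed.

Lemma cintegral_pairing a : Rn0 R n a -> memL2 (freq Psi H a) -> memL2 (freq Phi K a) ->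
  cintegral mu setT (fun b => pairing (a, b)) =
  (((planch n s)^-1)%:C)%C * cintegral mu setT (fun u => freq_pairing (a, u)).
Proof.
move=> a0 f2 g2; have ap := Rn0_gt0 a0.
have f1 := memL1_freq Psi2 H2 a0; have g1 := memL1_freq Phi2 K2 a0.
have hf := hat_FT sN0 f1 f2; have hg := hat_FT sN0 g1 g2.
have := parseval sN0 f2 g2 hf hg; rewrite planchN => P.
rewrite [in RHS]/freq_pairing /= cintegralZ//; last exact: cintegrableM (memL2J g2).
have p0 : planch n s != 0 by rewrite gt_eqF.
have c (z : R[i]) : (((planch n s)^-1)%:C)%C * ((((absp a)^-1)%:C)%C * z) =
    (((planch n s)^-1 ^+ 2 * (absp a)^-1)%:C)%C * (((planch n s)%:C)%C * z).
  rewrite !mulrA -!rmorphM; congr ((_%:C)%C * _).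
  by rewrite mulrAC expr2 -[_ * _ * planch n s]mulrA mulVf// mulr1.
have i : memL1 (fun u => FT (- s) (freq Psi H a) u * (FT (- s) (freq Phi K a) u)^*%C).
  by apply: cintegrableM; [case: hf|apply: memL2J; case: hg].
rewrite c -P -(cintegralZ measurableT _ i).
apply: eq_cintegral => b _.
rewrite -[pairing (a, b)]/((((absp a ^+ 2)^-1)%:C)%C * (cwt psi h a b * (cwt phi k a b)^*%C)).
rewrite (cwt_freq b s0 psi2 h2 hpsi hh a0) (cwt_freq b s0 phi2 k2 hphi hk a0).
have r : (absp a ^+ 2)^-1 * ((planch n s)^-1 * Num.sqrt (absp a)) *
    ((planch n s)^-1 * Num.sqrt (absp a)) = (planch n s)^-1 ^+ 2 * (absp a)^-1.
  rewrite -mulrA mulrACA -!expr2 sqr_sqrtr ?absp_ge0// mulrCA; congr (_ * _).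
  by rewrite expr2 invfM -mulrA mulVf ?mulr1 ?gt_eqF.
exact: scale_sesqui.
Qed.

Lemma cintegrable_cross : memL1 (fun v : Rn R n =>
  (((absp v)^-1)%:C)%C * (Psi v * (Phi v)^*%C)).
Proof.
have [mP _] := Psi2; have [mQ _] := Phi2.
have m : cmeasurable setT (fun v : Rn R n => (((absp v)^-1)%:C)%C * (Psi v * (Phi v)^*%C)).
  apply: cmeasurableM => //; first by apply: cmeasurable_real; exact: measurable_abspV.
  by apply: cmeasurableM => //; exact: cmeasurableJ.
have aI (P : Rn R n -> R[i]) : cmeasurable setT P -> (adm P < +oo)%E ->
    mu.-integrable setT (EFin \o (fun v => normc (P v) ^+ 2 / absp v)).
  move=> mP' aoo; apply/integrableP; split.
    by apply/measurable_EFinP; exact: measurable_adm.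
  under eq_integral => v _ do
    rewrite gee0_abs ?lee_fin ?divr_ge0 ?sqr_ge0 ?absp_ge0//.
  exact: aoo.
apply: (cintegrable_le _ m (rintegrableD _ (aI _ mP admPsi) (aI _ mQ admPhi))) => // v _.
rewrite !normcM normcJ normc_real ger0_norm ?invr_ge0 ?absp_ge0// -mulrDl mulrC.
rewrite ler_wpM2r ?invr_ge0 ?absp_ge0//.
have := sqr_ge0 (normc (Psi v) - normc (Phi v)).
have := sqr_ge0 (normc (Psi v)); have := sqr_ge0 (normc (Phi v)).
nra.
Qed.

(** Invariance of the density [1 / absp] under dilation by [u]. *)
Lemma cross_scaled u : Rn0 R n u ->
  let g a := (((absp a)^-1)%:C)%C * (Psi (cmul a u) * (Phi (cmul a u))^*%C) in
  memL1 g /\ cintegral mu setT g = cross Phi Psi.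
Proof.
move=> u0 g; have up := Rn0_gt0 u0.
have [Ci] := cintegral_affine_map (@zeroRn R n) u0 cintegrable_cross.
rewrite -/(cross Phi Psi) => ->.
pose g' := (fun v : Rn R n => (((absp v)^-1)%:C)%C * (Psi v * (Phi v)^*%C)) \o
  affine_map u (@zeroRn R n).
have -> : g = fun a => ((absp u)%:C)%C * g' a.
  apply/funext => a; rewrite /g /g' /= -cmulE absp_cmul [cmul u a]cmulC.
  rewrite invfM [in RHS]rmorphM !mulrA -rmorphM mulfV ?gt_eqF//.
  by rewrite rmorph1 mul1r.
by split; [exact: cintegrableZ|exact: cintegralZ].
Qed.

(** Parseval in [b], Fubini on the Fourier side, the dilation [v = a u] in the
scale, and Parseval in [u]. *)
Theorem cintegral_reconstruction :
  cintegrable (mu \x mu)%E setT pairing /\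
  cintegral mu setT (fun a => cintegral mu setT (fun b => pairing (a, b))) =
  (cross Phi Psi)^*%C * cintegral mu setT (fun t => h t * (k t)^*%C).
Proof.
have [mP _] := Psi2; have [mQ _] := Phi2; have [mH _] := H2; have [mK _] := K2.
split; first exact: (cintegrable_prod cmeasurable_pairing pairing_fin).
have mF := cmeasurable_cintegral mu cmeasurable_freq_pairing.
transitivity ((((planch n s)^-1)%:C)%C *
    cintegral mu setT (fun a => cintegral mu setT (fun u => freq_pairing (a, u)))).
  rewrite -cintegralZ//; last first.
    exact: (cintegrable_cintegral cmeasurable_freq_pairing freq_pairing_fin).
  apply: ae_eq_cintegral => //.
  - exact: (cmeasurable_cintegral mu cmeasurable_pairing).
  - exact: cmeasurableZ.
  have A := ae_freq_fin Psi2 H2 admPsi; have B := ae_freq_fin Phi2 K2 admPhi.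
  apply: (ae_imply2 _ (ae_Rn0 n) (ae_imply2 _ A B)); last by move=> x; exact: conj.
  by move=> a a0 [Aa Ba] _; apply: cintegral_pairing => //; [exact: Aa|exact: Ba].
rewrite (cFubini cmeasurable_freq_pairing freq_pairing_fin).
transitivity ((((planch n s)^-1)%:C)%C *
    cintegral mu setT (fun u => (cross Phi Psi)^*%C * (H u * (K u)^*%C))).
  congr (_ * _); apply: ae_eq_cintegral => //.
  - apply: (cmeasurable_cintegral mu (f := fun q => freq_pairing (q.2, q.1))).
    by apply: (cmeasurable_comp cmeasurable_freq_pairing); exact: measurable_swap.
  - by apply: cmeasurableZ; apply: cmeasurableM => //; exact: cmeasurableJ.
  apply: (ae_imply _ (ae_Rn0 n)) => u u0 _.
  have [gi <-] := cross_scaled u0.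
  rewrite -cintegralJ// mulrC -cintegralZ//; last exact: cintegrableJ.
  apply: eq_cintegral => a _.
  by rewrite /freq_pairing /freq /= !conjM !conjcK conjc_real; ring.
rewrite cintegralZ//; last by apply: cintegrableM => //; exact: memL2J.
rewrite (parseval s0 h2 k2 hh hk) mulrCA; congr (_ * _).
by rewrite mulrA -rmorphM mulVf ?gt_eqF// rmorph1 mul1r.
Qed.

End reconstruction.

(** * The fractional transforms *)

Lemma sin_natpi (R : realType) k : sin (k%:R * pi) = 0 :> R.
Proof.
elim: k => [|k IH]; first by rewrite mul0r sin0.
by rewrite -natr1 mulrDl mul1r sinD IH sinpi mul0r mulr0 addr0.
Qed.

Lemma sin_intpi (R : realType) (k : int) : sin (k%:~R * pi) = 0 :> R.
Proof.
case: k => k; first exact: sin_natpi.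
by rewrite NegzE rmorphN mulNr sinN (sin_natpi R k.+1) oppr0.
Qed.

(** Reducing modulo [pi] leaves a zero of the sine in the interval from [0] to
[pi], where only [0] is possible. *)
Lemma sin_eq0 (R : realType) (x : R) : sin x = 0 -> exists k : int, x = k%:~R * pi.
Proof.
move=> sx; have p0 := pi_gt0 R; pose k := Num.floor (x / pi); exists k.
have /andP[k1 k2] := floor_itv (x / pi).
have r0 : 0 <= x - k%:~R * pi by rewrite subr_ge0 -ler_pdivlMr.
have r1 : x - k%:~R * pi < pi.
  by rewrite ltrBlDl -[X in _ + X]mul1r -mulrDl -ltr_pdivrMr// -[1]/(1%:~R) -intrD.
have sr : sin (x - k%:~R * pi) = 0 by rewrite sinB sx sin_intpi mul0r mulr0 subr0.
apply/eqP; rewrite -subr_eq0 eq_le r0 andbT leNgt; apply/negP => rp.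
by have := sin_gt0_pi (introT andP (conj rp r1)); rewrite sr ltxx.
Qed.

Section fractional_transform.
Context {R : realType} (n : nat) (alpha : R).
Local Notation mu := (lebesgue_Rn R n).
Local Notation s := (- csc alpha).
Implicit Types (a b t u : Rn R n) (f g phi psi Phi Psi : Rn R n -> R[i]).

(** Multiplication by the conjugate of the chirp. *)
Definition unchirp f : Rn R n -> R[i] := fun t => expi (sqnorm t * cot alpha / 2) * f t.

Lemma measurable_chirp_phase :
  measurable_fun setT (fun t : Rn R n => sqnorm t * cot alpha / 2).
Proof.
apply: measurable_funM => //; apply: measurable_funM => //.
by apply: measurable_dotp; exact: measurable_id.
Qed.

Lemma memL2_unchirp f : memL2 f -> memL2 (unchirp f).
Proof. by move=> f2; apply: memL2M_expi => //; exact: measurable_chirp_phase. Qed.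

Lemma memL2_chirp f : memL2 f -> memL2 (chirp alpha f).
Proof.
move=> f2; apply: memL2M_expi => //; apply: measurableT_comp => //.
exact: measurable_chirp_phase.
Qed.

Lemma sqL2_unchirp f : sqL2 (unchirp f) = sqL2 f.
Proof. by apply: eq_sqL2 => t; rewrite normcM normc_expi mul1r. Qed.

Lemma atomE psi a b t : atom alpha psi a b t =
  expi (sqnorm b * cot alpha / 2) *
    (expi (- (sqnorm t * cot alpha / 2)) * wav psi a b t).
Proof.
rewrite /atom /wav -/(wav psi a b t) mulrA -expiD mulrC; congr (expi _ * _).
by rewrite !mulrBl opprB.
Qed.

Lemma memL2_atom psi a b : memL2 psi -> memL2 (atom alpha psi a b).
Proof.
move=> psi2; rewrite (_ : atom _ _ _ _ = fun t => expi (sqnorm b * cot alpha / 2) *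
  chirp alpha (wav psi a b) t); last by apply/funext => t; exact: atomE.
by apply: memL2Z; apply: memL2_chirp; exact: memL2_wav.
Qed.

Lemma CFrWT_cwt psi f a b : memL2 psi -> memL2 f ->
  CFrWT alpha psi f b a = expi (- (sqnorm b * cot alpha / 2)) * cwt psi (unchirp f) a b.
Proof.
move=> psi2 f2; have w2 := memL2_wav a b psi2.
rewrite /cwt -(cintegralZ measurableT _ (cintegrableM (memL2_unchirp f2) (memL2J w2))).
apply: eq_cintegral => t _; rewrite atomE !conjM !expiJ opprK /unchirp; ring.
Qed.

Lemma L2inner_atom phi g a b : memL2 phi -> memL2 g ->
  L2inner (atom alpha phi a b) g = (CFrWT alpha phi g b a)^*%C.
Proof.
move=> phi2 g2; have a2 := memL2_atom a b phi2.
rewrite -(cintegralJ measurableT (cintegrableM g2 (memL2J a2))).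
by apply: eq_cintegral => t _; rewrite conjM conjcK mulrC.
Qed.

Lemma L2inner_synthesis phi psi f g a b : memL2 phi -> memL2 psi -> memL2 f -> memL2 g ->
  L2inner (fun t => atom alpha phi a b t * CFrWT alpha psi f b a *
                    (((absp a ^+ 2)^-1)%:C)%C) g =
  pairing psi phi (unchirp f) (unchirp g) (a, b).
Proof.
move=> phi2 psi2 f2 g2; have a2 := memL2_atom a b phi2.
transitivity (CFrWT alpha psi f b a * (((absp a ^+ 2)^-1)%:C)%C *
              L2inner (atom alpha phi a b) g).
  rewrite -(cintegralZ measurableT _ (cintegrableM a2 (memL2J g2))).
  by apply: eq_cintegral => t _; ring.
rewrite L2inner_atom// !CFrWT_cwt// conjM expiJ opprK /pairing.
set x := sqnorm b * cot alpha / 2.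
rewrite -[RHS]mul1r -(expiNM x) /fst /snd; ring.
Qed.

(** The integral in the definition of a wavelet is the energy of [cwt] at
[unchirp psi], that is, [sqL2 psi * adm Psi] with a nonzero first factor. *)
Lemma wavelet_adm psi Psi : s != 0 -> wavelet alpha psi -> is_hat s psi Psi ->
  (adm Psi < +oo)%E.
Proof.
move=> s0 [psi2 psi0 psioo] hpsi; have h2 := memL2_unchirp psi2.
have [H hH _] := hat_exists s0 h2.
have : (sqL2 psi * adm Psi < +oo)%E.
  rewrite -sqL2_unchirp -(energy s0 psi2 h2 hpsi hH); move: psioo.
  rewrite integral_mkcond; congr (_ < _)%E; apply: eq_integral => a _.
  rewrite patchE; case: ifPn => [_|/negP aD].
    apply: eq_integral => b _; rewrite L2inner_atom// CFrWT_cwt//.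
    by rewrite normcJ normcM normc_expi mul1r.
  rewrite integral0_eq// => b _; rewrite cwt_off; last by move=> a0; apply: aD; rewrite inE.
  by rewrite normc0 expr0n mul0r.
have [->//|oo] := eqVneq (adm Psi) +oo%E; last by move=> _; rewrite ltey.
rewrite gt0_muley// lt_neqAle sqL2_ge0 andbT eq_sym.
by apply/eqP => z; apply: psi0; apply: sqL2_eq0 => //; case: psi2.
Qed.

Definition chirp_factor u : R[i] := Calpha n alpha * expi (sqnorm u * cot alpha / 2).

(** Completing the square: the chirp of [phi] cancels the quadratic factor of the
kernel in [t], and what remains is a factor in [u]. *)
Lemma FrFT1_cut phi k u : memL2 phi ->
  FrFT1 alpha (cut k (chirp alpha phi)) u = chirp_factor u * FT s (cut k phi) u.
Proof.
move=> phi2; have c1 := cintegrable_kernel s u (memL1_cut k phi2).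
rewrite /FT -(cintegralZ measurableT _ c1); apply: eq_cintegral => t _.
rewrite /Kalpha /cut /chirp /chirp_factor.
set x := sqnorm t * cot alpha / 2; set y := sqnorm u * cot alpha / 2.
have -> : expi ((sqnorm t + sqnorm u) * cot alpha / 2 - dotp t u * csc alpha) =
    expi x * expi y * expi (- csc alpha * dotp t u).
  by rewrite -!expiD; congr expi; rewrite /x /y; ring.
transitivity (((\1_(cube k) t)%:C)%C * phi t * (Calpha n alpha * expi y *
  expi (- csc alpha * dotp t u)) * (expi (- x) * expi x)); first by ring.
by rewrite expiNM; ring.
Qed.

Lemma normc_chirp_factor u : normc (chirp_factor u) = normc (Calpha n alpha).
Proof. by rewrite normcM normc_expi mulr1. Qed.

Lemma memL2_chirp_factorM f : memL2 f -> memL2 (fun u => chirp_factor u * f u).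
Proof.
move=> f2; rewrite (_ : (fun u => _) = fun u => Calpha n alpha * unchirp f u).
  by apply: memL2Z; exact: memL2_unchirp.
by apply/funext => u; rewrite /chirp_factor /unchirp mulrA.
Qed.

Lemma L2cvg_chirp_factor (f_ : nat -> Rn R n -> R[i]) f : (forall k, cmeasurable setT (f_ k)) ->
  cmeasurable setT f -> L2cvg f_ f ->
  L2cvg (fun k u => chirp_factor u * f_ k u) (fun u => chirp_factor u * f u).
Proof.
move=> mf_ mf ff; rewrite /L2cvg.
have -> : (fun k => \int[mu]_t (normc (chirp_factor t * f_ k t - chirp_factor t * f t) ^+ 2)%:E)%E =
    (fun k => (normc (Calpha n alpha) ^+ 2)%:E * \int[mu]_t (normc (f_ k t - f t) ^+ 2)%:E)%E.
  apply/funext => k; rewrite -ge0_integralZl//; last 3 first.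
  - by apply: measurable_normc2 => //; exact: cmeasurableB.
  - by move=> t _; rewrite lee_fin sqr_ge0.
  - by rewrite lee_fin sqr_ge0.
  apply: eq_integral => t _; rewrite -mulrBr normcM normc_chirp_factor exprMn.
  by rewrite EFinM.
by rewrite -[X in _ --> X](mule0 (normc (Calpha n alpha) ^+ 2)%:E); exact: cvgeZl.
Qed.

(** [FrFT] is a choice among the limits in the sense of [is_FrFT]. If there is
one, uniqueness of limits along the truncations of [phi] identifies it;
otherwise the chosen value is the zero function. *)
Lemma FrFT_chirp phi Phi : s != 0 -> memL2 phi -> is_hat s phi Phi ->
  (memL2 (FrFT alpha (chirp alpha phi)) /\
   {ae mu, forall u, FrFT alpha (chirp alpha phi) u = chirp_factor u * Phi u}) \/
  FrFT alpha (chirp alpha phi) = fun=> 0.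
Proof.
move=> s0 phi2 hphi; have [Phi2 _] := hphi; rewrite /FrFT.
case: xgetP => [F _ [F2 HF]|]; last by right.
left; split => //.
have c2 := memL2_chirp phi2.
have E : (fun k => FrFT1 alpha (cut k (chirp alpha phi))) =
    (fun k u => chirp_factor u * FT s (cut k phi) u).
  by apply/funext => k; apply/funext => u; exact: FrFT1_cut.
have F2k k : memL2 (FT s (cut k phi)).
  by apply: memL2_FT => //; [exact: memL1_cut|exact: memL2_cut].
have L1 := HF (fun k => cut k (chirp alpha phi))
  (fun k => conj (memL1_cut k c2) (memL2_cut k c2)) (L2cvg_cut c2).
rewrite E in L1.
apply: (L2cvg_unique _ F2 _ L1); last first.
- apply: L2cvg_chirp_factor; last exact: hat_cut.
  + by move=> k; case: (F2k k).
  + by case: Phi2.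
- exact: memL2_chirp_factorM.
- by move=> k; exact: memL2_chirp_factorM.
Qed.

(** The zero function as a value of [FrFT] is excluded because it would make
[cross_const] vanish. *)
Lemma cross_constE phi psi Phi Psi : s != 0 -> memL2 phi -> memL2 psi ->
  is_hat s phi Phi -> is_hat s psi Psi -> (adm Phi < +oo)%E -> (adm Psi < +oo)%E ->
  cross_const alpha phi psi <> 0 ->
  cross_const alpha phi psi =
    ((normc (Calpha n alpha) ^+ 2)%:C)%C * cross Phi Psi.
Proof.
move=> s0 phi2 psi2 hphi hpsi aPhi aPsi; rewrite /cross_const => nz.
have zero : cintegral mu (Rn0 R n) (fun=> 0 : R[i]) = 0.
  by rewrite cintegral_mkcond ?cintegral0.
have [[F2 FE]|F0] := FrFT_chirp s0 phi2 hphi; last first.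
  case: nz; rewrite F0 -[RHS]zero; apply: eq_cintegral => u _.
  by rewrite conjc0 !mul0r.
have [[G2 GE]|G0] := FrFT_chirp s0 psi2 hpsi; last first.
  by case: nz; rewrite G0 -[RHS]zero; apply: eq_cintegral => u _; rewrite mulr0 mul0r.
rewrite cintegral_mkcond; last first.
  by move=> u /negP; rewrite negbK => /eqP ->; rewrite invr0 mulr0.
rewrite /cross -(cintegralZ measurableT _ (cintegrable_cross hpsi hphi aPsi aPhi)).
have mV : cmeasurable setT (fun u : Rn R n => (((absp u)^-1)%:C)%C).
  by apply: cmeasurable_real; exact: measurable_abspV.
have [mPhi _] := proj1 hphi; have [mPsi _] := proj1 hpsi.
apply: ae_eq_cintegral => //.
- apply: cmeasurableM => //; apply: cmeasurableM => //.
    by apply: cmeasurableJ; case: F2.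
  by case: G2.
- apply: cmeasurableZ; apply: cmeasurableM => //; apply: cmeasurableM => //.
  exact: cmeasurableJ.
apply: (ae_imply2 _ FE GE) => u -> -> _.
rewrite -(normc_chirp_factor u) -mulJc conjM; ring.
Qed.

End fractional_transform.

Theorem theorem3p3 (R : realType) (n : nat) (alpha : R)
    (phi psi f : Rn R n -> R[i])
    (alpha_notin_piZ : ~ exists k : int, alpha = k%:~R * pi)
    (wavelet_phi : wavelet alpha phi)
    (wavelet_psi : wavelet alpha psi)
    (cross_phi_psi : cross_admissible alpha phi psi)
    (f_L2 : memL2 f)
    (cross_const_neq0 : cross_const alpha phi psi <> 0) :
  exists I : Rn R n -> R[i],
    is_weak_integral (fun a b t =>
      atom alpha phi a b t * CFrWT alpha psi f b a
      * (((absp a ^+ 2)^-1)%:C)%C) I /\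
    {ae lebesgue_Rn R n, forall t,
      f t = ((normc (Calpha n alpha) ^+ 2)%:C)%C
            / ((cross_const alpha phi psi)^*)%C * I t}.
Proof.
have s0 : - csc alpha != 0.
  by rewrite oppr_eq0 invr_eq0; apply/eqP => /sin_eq0.
have [phi2 _ _] := wavelet_phi; have [psi2 _ _] := wavelet_psi.
have [Phi hphi _] := hat_exists s0 phi2; have [Psi hpsi _] := hat_exists s0 psi2.
have aPhi := wavelet_adm s0 wavelet_phi hphi; have aPsi := wavelet_adm s0 wavelet_psi hpsi.
have CE := cross_constE s0 phi2 psi2 hphi hpsi aPhi aPsi cross_const_neq0.
have h2 := memL2_unchirp alpha f_L2; have [H hH _] := hat_exists s0 h2.
exists (fun t => (cross Phi Psi)^*%C * f t); split; last first.
  apply: aeW => t; move: cross_const_neq0; rewrite CE => /eqP.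
  rewrite mulf_eq0 negb_or => /andP[k0 c0].
  have cJ0 : (cross Phi Psi)^*%C != 0 by rewrite conjc_eq0.
  by rewrite conjM conjc_real invfM [X in X * _]mulrA mulfV// mul1r mulrA mulVf// mul1r.
split; first exact: memL2Z.
move=> g g2; have k2 := memL2_unchirp alpha g2; have [K hK _] := hat_exists s0 k2.
have [pI pE] := cintegral_reconstruction s0 psi2 phi2 h2 k2 hpsi hphi hH hK aPsi aPhi.
have E a b := L2inner_synthesis alpha a b phi2 psi2 f_L2 g2.
split.
  have -> : (fun ab : Rn R n * Rn R n => L2inner (fun t => atom alpha phi ab.1 ab.2 t *
      CFrWT alpha psi f ab.2 ab.1 * (((absp ab.1 ^+ 2)^-1)%:C)%C) g) =
      pairing psi phi (unchirp alpha f) (unchirp alpha g).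
    by apply/funext => -[a b]; rewrite E.
  have mD : measurable (Rn0 R n `*` [set: Rn R n]).
    by apply: measurableX => //; exact: measurable_Rn0.
  by case: pI => pR pM; split; apply: (integrableS measurableT).
transitivity (cintegral (lebesgue_Rn R n) setT (fun a => cintegral (lebesgue_Rn R n) setT
    (fun b => pairing psi phi (unchirp alpha f) (unchirp alpha g) (a, b)))).
  rewrite pE (@eq_cintegral _ _ _ (lebesgue_Rn R n) setT
    (fun t => f t * (g t)^*%C)); last first.
    move=> t _; rewrite /unchirp conjM expiJ mulrACA -expiD subrr expi0 mul1r//.
  rewrite -(cintegralZ measurableT _ (cintegrableM f_L2 (memL2J g2))).
  by apply: eq_cintegral => t _; rewrite mulrA.
rewrite -(@cintegral_mkcond _ _ _ _ (Rn0 R n)); last first.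
  move=> a a0; rewrite (@eq_cintegral _ _ _ (lebesgue_Rn R n) setT (fun=> 0)).
    exact: cintegral0.
  by move=> b _; rewrite /pairing cwt_off// mul0r mulr0.
by apply: eq_cintegral => a _; apply: eq_cintegral => b _; rewrite E.
Qed.
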